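(* Let $Q=P_1P_2P_3P_4$ be a circular quadrilateral, with vertices labeled such that it is convex and positively oriented, and let $\lambda,\mu\in(-\pi,\pi)$ be the signed angles $\lambda=\measuredangle(\overrightarrow{P_1P_2},\overrightarrow{P_4P_3})$ and $\mu=\measuredangle(\overrightarrow{P_4P_1},\overrightarrow{P_3P_2})$ determined by the two pairs of opposite edges. Suppose $\gamma$ is a (continuous) convex Jordan curve all of whose inner angles have size larger than $\min(|\lambda|,|\mu|)$. Then $\gamma$ inscribes $Q$.
   Context: A Jordan curve is an injective continuous map $\gamma:S^1\to\mathbb{R}^2$, identified with its image; it is convex if the region it bounds is convex. For a convex Jordan curve $\gamma$, the inner angle at $P\in\gamma$ is $\alpha_P=\sup\measuredangle APB\in(0,\pi]$, the supremum ranging over all $A,B\in\gamma\setminus\{P\}$. A Jordan curve $\gamma$ inscribes a quadrilateral $Q$ if there is an orientation-preserving similarity transformation of the plane (a composition of translations, rotations and scalings) that sends all four vertices of $Q$ into the image of $\gamma$. A circular quadrilateral is a quadrilateral that has a circumcircle. A convex quadrilateral $P_1P_2P_3P_4$ is positively oriented if $P_1,\dots,P_4$ lie counter-clockwise around its boundary; the vertices of any circular quadrilateral can be relabeled so that it is convex and positively oriented, and this does not affect inscribability. If $\alpha,\beta,\zeta,\delta$ are the inner angles of $Q$ at $P_1,P_2,P_3,P_4$ respectively, then $\lambda=\alpha+\delta-\pi=\pi-\beta-\zeta$ and $\mu=\zeta+\delta-\pi=\pi-\alpha-\beta$. *)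

(* Defs.v *)
From HB Require Import structures.
From mathcomp Require Import all_boot all_order all_algebra.
From mathcomp Require Import all_classical all_reals all_analysis.

Set Implicit Arguments.
Unset Strict Implicit.
Unset Printing Implicit Defensive.

Import Order.TTheory GRing.Theory Num.Theory.
Import numFieldNormedType.Exports.

Local Open Scope classical_set_scope.
Local Open Scope ring_scope.

                                                                              
                                                                     
                                             
Notation plane R := (R^o * R^o)%type.

Definition dot (R : realType) (u v : plane R) : R := u.1 * v.1 + u.2 * v.2.

Definition cross (R : realType) (u v : plane R) : R := u.1 * v.2 - u.2 * v.1.

Definition enorm (R : realType) (u : plane R) : R := Num.sqrt (dot u u).

                                                             
Definition vangle (R : realType) (u v : plane R) : R :=
  acos (dot u v / (enorm u * enorm v)).

                                                                             
                                                                       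
Definition signed_angle (R : realType) (u v : plane R) : R :=
  if 0 <= cross u v then vangle u v else - vangle u v.

Definition unit_circle (R : realType) : set (plane R) := [set x | enorm x = 1].
Arguments unit_circle R : clear implicits.

                                                       
Definition jordan_curve (R : realType) (g : plane R -> plane R) : Prop :=
  {within unit_circle R, continuous g} /\ set_inj (unit_circle R) g.

Definition curve_image (R : realType) (g : plane R -> plane R) :
  set (plane R) := g @` unit_circle R.

                                                                         
                                                                              
                     
Definition bounded_region (R : realType) (C U : set (plane R)) : Prop :=
  bounded_set U /\ exists2 p, (~` C) p & U = connected_component (~` C) p.

Definition convex_curve (R : realType) (g : plane R -> plane R) : Prop :=
  exists2 U : set (plane R), bounded_region (curve_image g) U & convex_set U.

Definition inner_angle (R : realType) (C : set (plane R)) (P : plane R) : R :=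
  sup [set t | exists A B : plane R,
    [/\ (C `\ P) A, (C `\ P) B & t = vangle (A - P) (B - P)]].

Definition rotate (R : realType) (t : R) (p : plane R) : plane R :=
  (cos t * p.1 - sin t * p.2, sin t * p.1 + cos t * p.2).

Inductive similarity (R : realType) : (plane R -> plane R) -> Prop :=
| similarity_translation (v : plane R) : similarity (fun p => p + v)
| similarity_rotation (t : R) : similarity (rotate t)
| similarity_scaling (s : R) : 0 < s -> similarity (fun p => s *: p)
| similarity_comp (S T : plane R -> plane R) :
    similarity S -> similarity T -> similarity (S \o T).

Definition inscribes (R : realType) (g : plane R -> plane R)
    (P1 P2 P3 P4 : plane R) : Prop :=
  exists2 T : plane R -> plane R, similarity T &
    [/\ curve_image g (T P1), curve_image g (T P2),
        curve_image g (T P3) & curve_image g (T P4)].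

Definition has_circumcircle (R : realType) (P1 P2 P3 P4 : plane R) : Prop :=
  exists (c : plane R) (r : R), 0 < r /\
    [/\ enorm (P1 - c) = r, enorm (P2 - c) = r,
        enorm (P3 - c) = r & enorm (P4 - c) = r].

Definition left_of (R : realType) (A B X : plane R) : bool :=
  0 < cross (B - A) (X - A).

                                                                             
                                                                              
Definition convex_positive (R : realType) (P1 P2 P3 P4 : plane R) : Prop :=
  [/\ left_of P1 P2 P3 && left_of P1 P2 P4,
      left_of P2 P3 P4 && left_of P2 P3 P1,
      left_of P3 P4 P1 && left_of P3 P4 P2 &
      left_of P4 P1 P2 && left_of P4 P1 P3].

(* Main.v *)
(** Let K be the convex body bounded by the curve. If the lines P1P2 and P4P3
    meet at an angle lambda > 0, the vertices of Q lie on the two sides of a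
    wedge, at distances a < b and a' < b' from the apex, and a b = a' b' because
    Q is circular. Among all wedges of angle lambda, with apex Y and sides along
    the unit vectors e and f, minimise
      al |K right of Y + R e| + be |K left of Y + R f| + |T minus K|,
    where al = a / (b - a), be = a' / (b' - a') and T is a triangle with vertices
    Y, Y + q1 e in K and Y + q2 f in K (the last term does not depend on q1, q2).
    Area is lower semicontinuous on the compact set of configurations, so there
    is a minimiser. If its apex is outside K, comparison with translated and
    rotated wedges bounds the end points of the two chords cut out by the sides,
    and these bounds are exactly what is needed to find on the boundary of K four
    points at distances r a, r b, r a', r b' from Y. If its apex is in K, a small
    move lowers the functional, unless K lies in the wedge; then the inner angle
    at Y is at most lambda. When lambda = 0 the same argument applies to two
    parallel lines at distance w, with |K below| / b1 + |K above| / b2 + w^2 / 2h,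
    for a trapezoid of bases b1, b2 and height h. *)

From HB Require Import structures.
Require Import Defs.
From mathcomp Require Import all_boot all_order all_algebra.
From mathcomp Require Import all_classical all_reals all_analysis.
From mathcomp Require Import measurable_realfun measurable_function.
From mathcomp Require Import ring lra.

Import Order.TTheory GRing.Theory Num.Theory.
Import numFieldNormedType.Exports.

Local Open Scope classical_set_scope.
Local Open Scope ring_scope.
Set Implicit Arguments.
Unset Strict Implicit.
Unset Printing Implicit Defensive.


(** * Plane area *)

(** The weights come from a first variation. Pushing the side along e parallel to itself by d
    changes its cap by d times the chord that K cuts from the side, and T minus K by d times the gap
    between Y and K. So at a smooth minimum the gap is al times the chord, and the ends of the chord
    divide the side as a and b do. Turning both sides by one angle, each about one of its points,
    compares squares of lengths, and for the best pivots it relates the products of the end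
    distances on the two sides. Nothing here is differentiable: each variation is a finite move, its
    areas are estimated up to a margin [h], and only an inequality results. A side that merely
    touches K can be varied in one direction only. Its chord may then be too long, but all of it
    lies on the boundary, so the points may be taken inside the chord. Compactness may bring the
    apex onto K, where these variations give nothing. There the triangle costs only order d^2 for a
    move of size d, so the caps have to lose more than that. *)

Section Area.
Variable R : realType.
Local Notation leb := (@lebesgue_measure R).
Local Notation mu2 := (leb \x leb)%E.

Lemma lebesgue_measure_shift (a : R) (A : set R) : measurable A ->
  pushforward leb (fun x => x + a : measurableTypeR R) A = leb A.
Proof.
move=> mA; apply/esym/lebesgue_measure_unique => //=.
  exact: measurable_funD.
move=> mf _ [[b c]] _ <-; rewrite /pushforward.
have -> : (fun x => x + a) @^-1` [set` `]b, c]] = [set` `]b - a, c - a]] :> set R.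
  apply/seteqP; split => x /=; rewrite !in_itv /=; lra.
rewrite !lebesgue_measure_itv/= !lte_fin ltrD2r.
by case: ifP => //; rewrite -!EFinD => _; congr EFin; ring.
Qed.

Lemma product_measureC (E : set (R * R)) : measurable E -> mu2 E = (leb \x^ leb)%E E.
Proof.
move=> mE; apply: product_measure_unique => // B C mB mC/=; rewrite product_measure2E //.
Qed.

Lemma measurable_lin (a b c : R) :
  measurable_fun [set: R * R] (fun z : R * R => a * z.1 + b * z.2 + c).
Proof.
apply: measurable_funD => //; apply: measurable_funD => //;
 apply: measurable_funM => //.
Qed.

(** The horizontal sections of the preimage are translates of those of [E], so integrating over the
    second coordinate gives equal areas. *)
Lemma area_shearl (a c : R) (E : set (R * R)) : measurable E ->
  mu2 ((fun z => (z.1 + a * z.2 + c, z.2)) @^-1` E) = mu2 E.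
Proof.
move=> mE.
have mf : measurable_fun [set: R * R] (fun z : R * R => (z.1 + a * z.2 + c, z.2)).
  apply: measurable_fun_pair => //.
  by have := measurable_lin 1 a c; under eq_fun do rewrite mul1r.
have mE' := mf measurableT _ mE; rewrite setTI in mE'.
rewrite !product_measureC // /product_measure2; apply: eq_integral => y _ /=.
rewrite -[RHS](lebesgue_measure_shift (a * y + c)) /pushforward; last exact: measurable_ysection.
congr (leb _); apply/seteqP; split => x; rewrite /ysection /= !inE /= !addrA //.
Qed.

Lemma area_swap (E : set (R * R)) : measurable E ->
  mu2 ((fun z => (z.2, z.1)) @^-1` E) = mu2 E.
Proof.
move=> mE.
have mf : measurable_fun [set: R * R] (fun z : R * R => (z.2, z.1)).
  exact: measurable_fun_pair.
have mE' := mf measurableT _ mE; rewrite setTI in mE'.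
rewrite [RHS]product_measureC // /product_measure2 /product_measure1; apply: eq_integral => y _ /=.
Qed.


Definition area_preserving (f : plane R -> plane R) :=
  measurable_fun [set: R * R] (f : R * R -> R * R) /\
  forall E : set (R * R), measurable E -> mu2 (f @^-1` E) = mu2 E.

Lemma area_preserving_comp f g : area_preserving f -> area_preserving g ->
  area_preserving (g \o f).
Proof.
move=> [mf f_] [mg g_]; split; first exact: measurableT_comp mg mf.
move=> E mE; rewrite comp_preimage f_ ?g_ //.
by rewrite -[X in measurable X]setTI; exact: mg.
Qed.

Lemma area_preserving_swap : area_preserving (fun z => (z.2, z.1)).
Proof. by split; [exact: measurable_fun_pair | exact: area_swap]. Qed.

Lemma area_preserving_shear (a c : R) :
  area_preserving (fun z => (z.1 + a * z.2 + c, z.2)).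
Proof.
split; last exact: area_shearl.
apply: measurable_fun_pair => //.
by have := measurable_lin 1 a c; under eq_fun do rewrite mul1r.
Qed.

Lemma area_preserving_shearr (a c : R) :
  area_preserving (fun z => (z.1, z.2 + a * z.1 + c)).
Proof.
have h := area_preserving_comp (area_preserving_comp area_preserving_swap
   (area_preserving_shear a c)) area_preserving_swap.
exact: h.
Qed.

(** Coordinates with origin [Q] and first axis the unit vector [e]; a preimage under [frame e Q] is
    a set described in these coordinates. *)
Definition frame (e Q z : plane R) : plane R := (dot e (z - Q), cross e (z - Q)).

(** A rotation is a product of three shears, horizontal, vertical and horizontal again. The factor
    [p] is the tangent of half the angle. *)
Lemma area_preserving_frame (e Q : plane R) : dot e e = 1 ->
  area_preserving (frame e Q).
Proof.
have tr : area_preserving (fun z => z - Q).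
  have := area_preserving_comp (area_preserving_shear 0 (- Q.1))
    (area_preserving_shearr 0 (- Q.2)).
  congr (area_preserving _); apply/funext => z /=.
  by rewrite !mul0r !addr0.
have rot0 (u : plane R) : dot u u = 1 -> u.2 != 0 ->
    area_preserving (fun z => (dot u z, cross u z)).
  move=> u1 u2; pose p := (1 - u.1) / u.2.
  have := area_preserving_comp (area_preserving_comp (area_preserving_shear p 0)
    (area_preserving_shearr (- u.2) 0)) (area_preserving_shear p 0).
  have e1 : 1 - p * u.2 = u.1 by rewrite /p divfK //; ring.
  have e2 : p * (1 + u.1) = u.2.
    rewrite /p; apply: (mulIf u2); rewrite mulrAC divfK //.
    by move: u1; rewrite /dot => u1; lra.
  congr (area_preserving _); apply/funext => -[x y] /=; rewrite /dot /cross /=.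
  rewrite !addr0; congr pair.
    transitivity ((1 - p * u.2) * x + p * (1 + (1 - p * u.2)) * y); first by ring.
    by rewrite e1 e2.
  transitivity ((1 - p * u.2) * y - u.2 * x); first by ring.
  by rewrite e1.
have rot (u : plane R) : dot u u = 1 -> area_preserving (fun z => (dot u z, cross u z)).
  (* A horizontal [u] gives the identity or a half-turn, written as four or two quarter-turns, to
     which the shears do apply. *)
  move=> u1; have [u2|] := eqVneq u.2 0; last exact: rot0.
  have i1 : dot (0, 1) (0, 1) = 1 :> R by rewrite /dot /=; ring.
  have ri := rot0 _ i1 (oner_neq0 _).
  have u11 : (u.1 - 1) * (u.1 + 1) = 0 by move: u1; rewrite /dot u2 => u1; lra.
  move/eqP: u11; rewrite mulf_eq0 subr_eq0 addr_eq0 => /orP[] /eqP u11.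
    have := area_preserving_comp ri (area_preserving_comp ri
      (area_preserving_comp ri ri)).
    congr (area_preserving _); apply/funext => -[x y] /=.
    by rewrite /dot /cross /= u11 u2; congr pair; ring.
  have := area_preserving_comp ri ri.
  congr (area_preserving _); apply/funext => -[x y] /=.
  by rewrite /dot /cross /= u11 u2; congr pair; ring.
by move=> e1; exact: (area_preserving_comp tr (rot e e1)).
Qed.

Definition conj2 (z : plane R) : plane R := (z.1, - z.2).

Lemma area_preserving_conj : area_preserving conj2.
Proof.
have i1 : dot (0, 1) (0, 1) = 1 :> R by rewrite /dot /=; ring.
have := area_preserving_comp area_preserving_swap
  (area_preserving_frame (0 : plane R) i1).
congr (area_preserving _); apply/funext => -[x y] /=.
by rewrite /frame /conj2 /dot /cross /=; congr pair; ring.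
Qed.

(** An open set is the countable union of the squares with rational centre and radius that it
    contains, and each square is a product of intervals. *)
Lemma open_measurable2 (A : set (plane R)) : open A -> measurable (A : set (R * R)).
Proof.
move=> oA.
have -> : A = \bigcup_(p in [set p : (rat * rat) * rat |
     (`]ratr p.1.1 - ratr p.2, ratr p.1.1 + ratr p.2[ `*`
     `]ratr p.1.2 - ratr p.2, ratr p.1.2 + ratr p.2[) `<=` A])
     (`](ratr p.1.1 : R) - ratr p.2, ratr p.1.1 + ratr p.2[ `*`
     `](ratr p.1.2 : R) - ratr p.2, ratr p.1.2 + ratr p.2[).
  apply/seteqP; split => [[x y] Axy|z [p] pA]; last exact: pA.
  have /nbhs_ballP[e /= e0 eA] := open_nbhs_nbhs (conj oA Axy).
  have [d] := rat_in_itvoo (e0 : 0 < e).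
  rewrite in_itv /= => /andP[d0 de].
  have d2 : 0 < ratr d / 2 :> R by lra.
  have [p] := rat_in_itvoo (ltr_pwDr d2 (lexx x)).
  rewrite in_itv /= => /andP[px1 px2].
  have [q] := rat_in_itvoo (ltr_pwDr d2 (lexx y)).
  rewrite in_itv /= => /andP[qy1 qy2].
  have r2 : ratr (d / 2) = ratr d / 2 :> R by rewrite rmorphM fmorphV /= ratr_nat.
  exists ((p, q), d / 2) => /=; rewrite r2.
    move=> [u v] /=; rewrite !in_itv /= => -[/andP[u1 u2] /andP[v1 v2]].
    by apply: eA; split => /=; rewrite /ball /= ltr_norml; lra.
  by rewrite !in_itv /=; split; lra.
rewrite bigcup_mkcond; apply: countable_bigcupT_measurable => [|p].
  exact: countableP.
by case: ifP => // _; apply: measurableX; exact: measurable_itv.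
Qed.

Definition area (E : set (plane R)) : R := fine (mu2 E).

(* On measurable bounded sets [area] is not a junk value of [fine]. *)
Definition tame (E : set (plane R)) :=
  measurable (E : set (R * R)) /\
  exists M : R, forall z, E z -> `|z.1| <= M /\ `|z.2| <= M.

Lemma mu2_box (u w s t : R) (b1 b2 b3 b4 : bool) : u <= w -> s <= t ->
  mu2 ([set` Interval (BSide b1 u) (BSide b2 w)] `*`
       [set` Interval (BSide b3 s) (BSide b4 t)]) = ((w - u) * (t - s))%:E.
Proof.
move=> uw st; rewrite product_measure1E /=; try exact: measurable_itv.
rewrite !lebesgue_measure_itv /= !lte_fin.
have h (x y : R) : x <= y -> (if x < y then (y%:E - x%:E)%E else 0%E) = (y - x)%:E.
  by rewrite le_eqVlt => /predU1P[->|->//]; rewrite ltxx subrr.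
by rewrite !h.
Qed.

Lemma areaE (E : set (plane R)) : tame E -> mu2 E = (area E)%:E.
Proof.
move=> [mE [M EM]]; rewrite /area fineK // ge0_fin_numE //.
have M0 : - `|M| <= `|M| by have := normr_ge0 M; lra.
apply: (@le_lt_trans _ _ (mu2 (`[- `|M|, `|M|] `*` `[- `|M|, `|M|]))).
  apply: le_measure; rewrite ?inE //.
    by apply: measurableX; exact: measurable_itv.
  move=> z /EM[z1 z2] /=; have := ler_norm M.
  by move: z1 z2; rewrite !in_itv /= !ler_norml => ? ? ?; split; lra.
by rewrite mu2_box // ltry.
Qed.

Lemma area_ge0 E : 0 <= area E.
Proof. exact: fine_ge0. Qed.

Lemma tameS A B : measurable (A : set (R * R)) -> A `<=` B -> tame B -> tame A.
Proof. by move=> mA AB [_ [M BM]]; split => //; exists M => z /AB/BM. Qed.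

Lemma tame0 : tame set0.
Proof. by split => //; exists 0. Qed.

Lemma tameU A B : tame A -> tame B -> tame (A `|` B).
Proof.
move=> [mA [M AM]] [mB [N BN]]; split; first exact: measurableU.
exists (Num.max M N) => z; rewrite !le_max.
by move=> [/AM[-> ->]|/BN[-> ->]]; rewrite ?orbT.
Qed.

Lemma tameD A B : tame A -> measurable (B : set (R * R)) -> tame (A `\` B).
Proof.
move=> tA mB; apply: tameS (tA) => [|z []//].
by apply: measurableD => //; case: tA.
Qed.

Lemma area_le A B : tame A -> tame B -> A `<=` B -> area A <= area B.
Proof.
move=> tA tB AB; rewrite -lee_fin -!areaE //.
by apply: le_measure => //; rewrite inE; [case: tA|case: tB].
Qed.

Lemma areaU A B : tame A -> tame B -> A `&` B = set0 ->
  area (A `|` B) = area A + area B.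
Proof.
move=> tA tB AB; apply: EFin_inj; rewrite EFinD -!areaE //; last exact: tameU.
by apply: measureU => //; [case: tA|case: tB].
Qed.

(** Passing from [B] to [A] gains at most [C] and loses at least [D]. Most comparisons of energies
    below are instances of this. *)
Lemma area_exchange A B C D : tame A -> tame B -> tame C -> tame D ->
  A `<=` B `|` C -> D `<=` B -> A `&` D = set0 ->
  area A + area D <= area B + area C.
Proof.
move=> tA tB tC tD ABC DB AD; have mC : measurable (C : set (R * R)) by case: tC.
have tAC : tame (A `\` C) by exact: tameD.
have AC : area A <= area (A `\` C) + area C.
  rewrite -areaU //; last by apply/seteqP; split => // z [[]].
  apply: area_le => //; first exact: tameU.
  by move=> z Az; have [Cz|Cz] := pselect (C z); [right|left].
have fin (x y z w v : R) : x <= y + v -> y + z <= w -> x + z <= w + v by clear; lra.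
apply: (fin _ _ _ _ _ AC).
rewrite -areaU //.
  apply: area_le => //; first exact: tameU.
  by move=> z [[/ABC[]//]|/DB].
by apply/seteqP; split => // z [[Az _] Dz]; rewrite -AD.
Qed.

Lemma area_subU A B C : tame A -> tame B -> tame C -> A `<=` B `|` C ->
  area A <= area B + area C.
Proof.
move=> tA tB tC ABC; have := area_exchange tA tB tC tame0 ABC (@sub0set _ _).
rewrite setI0 => /(_ erefl); apply: le_trans.
by rewrite lerDl area_ge0.
Qed.

Lemma area_disj A B D : tame A -> tame B -> tame D -> A `<=` B -> D `<=` B ->
  A `&` D = set0 -> area A + area D <= area B.
Proof.
move=> tA tB tD AB DB AD.
have := @area_exchange A B set0 D tA tB tame0 tD (subset_trans AB (@subsetUl _ _ _)) DB AD.
by rewrite {4}/area measure0 addr0.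
Qed.

Lemma area_frame (e Q : plane R) (E : set (plane R)) : dot e e = 1 ->
  measurable (E : set (R * R)) -> area (frame e Q @^-1` E) = area E.
Proof.
by move=> e1 mE; rewrite /area; have [_ ->] := area_preserving_frame Q e1.
Qed.

Lemma measurable_frame (e Q : plane R) (E : set (plane R)) : dot e e = 1 ->
  measurable (E : set (R * R)) -> measurable (frame e Q @^-1` E : set (R * R)).
Proof.
move=> e1 mE; have [mf _] := area_preserving_frame Q e1.
by rewrite -[X in measurable X]setTI; exact: mf.
Qed.

Lemma area_conj (E : set (plane R)) :
  measurable (E : set (R * R)) -> area (conj2 @^-1` E) = area E.
Proof. by move=> mE; rewrite /area; have [_ ->] := area_preserving_conj. Qed.

Definition box (u w s t : R) : set (plane R) := [set z | u <= z.1 <= w /\ s <= z.2 <= t].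
Definition obox (u w s t : R) : set (plane R) := [set z | u < z.1 < w /\ s < z.2 < t].

Lemma boxE u w s t : box u w s t = `[u, w] `*` `[s, t].
Proof. by apply/seteqP; split => z /=; rewrite /box /= !in_itv. Qed.

Lemma oboxE u w s t : obox u w s t = `]u, w[ `*` `]s, t[.
Proof. by apply/seteqP; split => z /=; rewrite /obox /= !in_itv. Qed.

Lemma tame_box u w s t : tame (box u w s t).
Proof.
split; first by rewrite boxE; apply: measurableX; exact: measurable_itv.
exists (`|u| + `|w| + `|s| + `|t|) => z [/andP[h1 h2] /andP[h3 h4]].
have := normr_ge0 u; have := normr_ge0 w; have := normr_ge0 s; have := normr_ge0 t.
have := ler_norm w; have := ler_norm t.
have := ler_norm (- u); have := ler_norm (- s); rewrite !normrN !ler_norml.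
by move=> *; split; lra.
Qed.

Lemma tame_obox u w s t : tame (obox u w s t).
Proof.
apply: tameS (tame_box u w s t).
  by rewrite oboxE; apply: measurableX; exact: measurable_itv.
by move=> z [/andP[h1 h2] /andP[h3 h4]]; split; lra.
Qed.

Lemma area_box u w s t : u <= w -> s <= t -> area (box u w s t) = (w - u) * (t - s).
Proof. by move=> uw st; rewrite /area boxE mu2_box. Qed.

Lemma area_obox u w s t : u <= w -> s <= t -> area (obox u w s t) = (w - u) * (t - s).
Proof. by move=> uw st; rewrite /area oboxE mu2_box. Qed.

Lemma frame_bound (e Q z : plane R) (M : R) : dot e e = 1 ->
  `|(frame e Q z).1| <= M -> `|(frame e Q z).2| <= M ->
  `|z.1| <= 2 * M + `|Q.1| /\ `|z.2| <= 2 * M + `|Q.2|.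
Proof.
case: e => e1 e2; case: Q => Q1 Q2; case: z => x y; rewrite /frame /dot /cross /= => ee.
set a := e1 * _ + _; set b := e1 * _ - _ => aM bM.
have ax : x = e1 * a - e2 * b + Q1.
  transitivity ((e1 * e1 + e2 * e2) * (x - Q1) + Q1); first by rewrite ee; ring.
  by rewrite /a /b; ring.
have ay : y = e2 * a + e1 * b + Q2.
  transitivity ((e1 * e1 + e2 * e2) * (y - Q2) + Q2); first by rewrite ee; ring.
  by rewrite /a /b; ring.
have n1 : `|e1| <= 1 by rewrite ler_norml; nra.
have n2 : `|e2| <= 1 by rewrite ler_norml; nra.
have h (c d : R) : `|c| <= 1 -> `|d| <= M -> `|c * d| <= M.
  move=> c1 dM; rewrite normrM; have := normr_ge0 c; have := normr_ge0 d; nra.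
rewrite ax ay; split; apply: le_trans (ler_normD _ _) _; rewrite lerD2r.
  apply: le_trans (ler_normB _ _) _; have := h _ _ n1 aM; have := h _ _ n2 bM; lra.
apply: le_trans (ler_normD _ _) _; have := h _ _ n1 bM; have := h _ _ n2 aM; lra.
Qed.

Lemma tame_frame (e Q : plane R) (E : set (plane R)) : dot e e = 1 ->
  tame E -> tame (frame e Q @^-1` E).
Proof.
move=> e1 [mE [M EM]]; split; first exact: measurable_frame.
exists (2 * M + `|Q.1| + `|Q.2|) => z /EM [h1 h2].
have [] := frame_bound e1 h1 h2; have := normr_ge0 Q.1; have := normr_ge0 Q.2.
by move=> *; split; lra.
Qed.

Lemma area_le_rect (e Q : plane R) u w s t (E : set (plane R)) : dot e e = 1 ->
  tame E -> u <= w -> s <= t ->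
  (forall z, E z -> u <= dot e (z - Q) <= w /\ s <= cross e (z - Q) <= t) ->
  area E <= (w - u) * (t - s).
Proof.
move=> e1 tE uw st H; rewrite -area_box // -[leRHS](area_frame Q e1); last by case: (tame_box u w s t).
by apply: area_le => //; apply: tame_frame => //; exact: tame_box.
Qed.

(** The right triangle of base [M] and slope [k], the shape swept by a turning side; [otri] leaves
    out its edges. *)
Definition tri (M k : R) : set (plane R) := [set z | 0 <= z.1 <= M /\ 0 <= z.2 <= k * z.1].
Definition otri (M k : R) : set (plane R) := [set z | 0 < z.1 < M /\ 0 < z.2 < k * z.1].

Lemma measurable_lt_plane (f g : plane R -> R) : measurable_fun setT (f : R * R -> R) ->
  measurable_fun setT (g : R * R -> R) -> measurable [set z : R * R | f z < g z].
Proof.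
move=> mf mg; have := measurable_fun_ltr mf mg.
move=> /(_ measurableT [set true]); rewrite setTI => H.
have -> : [set z : R * R | f z < g z] = (fun z => f z < g z) @^-1` [set true].
  by apply/seteqP; split => z /=.
exact: H.
Qed.

Lemma measurable_le_plane (f g : plane R -> R) : measurable_fun setT (f : R * R -> R) ->
  measurable_fun setT (g : R * R -> R) -> measurable [set z : R * R | f z <= g z].
Proof.
move=> mf mg; have := measurable_fun_ler mf mg.
move=> /(_ measurableT [set true]); rewrite setTI => H.
have -> : [set z : R * R | f z <= g z] = (fun z => f z <= g z) @^-1` [set true].
  by apply/seteqP; split => z /=.
exact: H.
Qed.

Lemma tame_tri M k : tame (tri M k).
Proof.
apply: (@tameS _ (box 0 M (- `|k| * M) (`|k| * M))); last exact: tame_box.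
  have -> : tri M k = [set z : R * R | 0 <= z.1] `&` [set z : R * R | z.1 <= M]
      `&` ([set z : R * R | 0 <= z.2] `&` [set z : R * R | z.2 <= k * z.1]).
    apply/seteqP; split => z /=; rewrite /tri /=.
      by move=> [/andP[-> ->] /andP[-> ->]].
    by move=> [[-> ->] [-> ->]].
  by apply: measurableI; apply: measurableI; apply: measurable_le_plane => //; exact: measurable_funM.
move=> z [/andP[h1 h2] /andP[h3 h4]]; split; first lra.
by have := normr_ge0 k; have := ler_norm k; nra.
Qed.

Lemma tame_otri M k : tame (otri M k).
Proof.
apply: tameS (tame_tri M k); last first.
  by move=> z [/andP[h1 h2] /andP[h3 h4]]; split; lra.
have -> : otri M k = [set z : R * R | 0 < z.1] `&` [set z : R * R | z.1 < M]
    `&` ([set z : R * R | 0 < z.2] `&` [set z : R * R | z.2 < k * z.1]).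
  apply/seteqP; split => z /=; rewrite /otri /=.
    by move=> [/andP[-> ->] /andP[-> ->]].
  by move=> [[-> ->] [-> ->]].
by apply: measurableI; apply: measurableI; apply: measurable_lt_plane => //; exact: measurable_funM.
Qed.

Lemma unit_left_vector : dot (-1, 0) (-1, 0) = 1 :> R.
Proof. by rewrite /dot /=; ring. Qed.

(* Two copies of the triangle, exchanged by a half-turn, are disjoint in the rectangle. *)
Lemma area_otri_le M k : 0 <= M -> 0 <= k -> 2 * area (otri M k) <= k * M ^+ 2.
Proof.
move=> M0 k0; pose Q : plane R := (M, k * M).
have kM : 0 <= k * M by nra.
have := @area_disj (otri M k) (box 0 M 0 (k * M)) (frame (-1, 0) Q @^-1` otri M k).
rewrite area_box // (area_frame Q unit_left_vector); last by case: (tame_otri M k).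
have tf := tame_frame Q unit_left_vector (tame_otri M k).
move=> /(_ (tame_otri _ _) (tame_box _ _ _ _) tf) H.
suff : area (otri M k) + area (otri M k) <= (M - 0) * (k * M - 0) by nra.
apply: H.
- by move=> z [/andP[h1 h2] /andP[h3 h4]]; split; nra.
- move=> z; rewrite /frame /otri /box /dot /cross /= => -[/andP[h1 h2] /andP[h3 h4]].
  by split; nra.
- apply/seteqP; split => // z [[/andP[h1 h2] /andP[h3 h4]]].
  by rewrite /frame /otri /box /dot /cross /= => -[/andP[h5 h6] /andP[h7 h8]]; nra.
Qed.

(** Half-turned copies of a closed triangle overlap, so it is enclosed in slightly larger open
    triangles, whose areas converge. *)
Lemma area_tri_le M k : 0 <= M -> 0 <= k -> 2 * area (tri M k) <= k * M ^+ 2.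
Proof.
move=> M0 k0.
have H d : 0 < d -> d <= 1 -> 2 * area (tri M k) <= (k + d) * (M + 2 * d) ^+ 2.
  move=> d0 d1; have kd : 0 <= k + d by lra.
  have Md : 0 <= M + 2 * d by lra.
  apply: le_trans (area_otri_le Md kd); rewrite ler_pM2l //.
  (* This translation leaves a positive margin along all three edges of the larger triangle. *)
  pose Q : plane R := (- d, - (k * d / 2 + d ^+ 2 / 2)).
  have i1 : dot (1, 0) (1, 0) = 1 :> R by rewrite /dot /=; ring.
  rewrite -[leRHS](area_frame Q i1); last by case: (tame_otri (M + 2 * d) (k + d)).
  apply: area_le; [exact: tame_tri|exact: tame_frame (tame_otri _ _)|].
  move=> z [/andP[h1 h2] /andP[h3 h4]].
  by rewrite /frame /otri /dot /cross /=; split; nra.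
apply/ler_addgt0Pr => e e0.
(* For [d <= 1] the excess of the bound over [k * M ^+ 2] is at most [d * C]. *)
pose C := 4 * k * M + 4 * k + (M + 2) ^+ 2 + 1.
have C0 : 0 < C by rewrite /C; nra.
pose d := Num.min 1 (e / C).
have d0 : 0 < d by rewrite lt_min ltr01 divr_gt0.
have d1 : d <= 1 by rewrite ge_min lexx.
have dC : d * C <= e by rewrite -ler_pdivlMr // ge_min lexx orbT.
apply: le_trans (H d d0 d1) _.
have h1 : d * (M + 2 * d) ^+ 2 <= d * (M + 2) ^+ 2.
  by apply: ler_wpM2l; [lra|rewrite ler_sqr ?nnegrE; lra].
have h2 : k * d ^+ 2 <= k * d by apply: ler_wpM2l => //; rewrite expr2; nra.
have -> : (k + d) * (M + 2 * d) ^+ 2 =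
  k * M ^+ 2 + 4 * (k * M * d) + 4 * (k * d ^+ 2) + d * (M + 2 * d) ^+ 2 by ring.
have : d * C = 4 * (k * M * d) + 4 * (k * d) + d * (M + 2) ^+ 2 + d by rewrite /C; ring.
lra.
Qed.

(** The open triangle and the half-turned closed one cover the rectangle, so the upper bound for the
    latter is a lower bound for the former. *)
Lemma area_otri_ge M k : 0 <= M -> 0 <= k -> k * M ^+ 2 <= 2 * area (otri M k).
Proof.
move=> M0 k0; pose Q : plane R := (M, k * M).
have kM : 0 <= k * M by nra.
have := @area_subU (obox 0 M 0 (k * M)) (otri M k) (frame (-1, 0) Q @^-1` tri M k).
rewrite area_obox // (area_frame Q unit_left_vector); last by case: (tame_tri M k).
have tf := tame_frame Q unit_left_vector (tame_tri M k).
move=> /(_ (tame_obox _ _ _ _) (tame_otri _ _) tf) H.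
have := area_tri_le M0 k0.
suff : (M - 0) * (k * M - 0) <= area (otri M k) + area (tri M k).
  by move: (area (otri M k)) (area (tri M k)) => x y; clear; nra.
apply: H => z [/andP[h1 h2] /andP[h3 h4]].
rewrite /frame /otri /tri /dot /cross /=.
have [h|h] := ltP z.2 (k * z.1); [left|right]; split; nra.
Qed.

Lemma area_le_tri (e Q : plane R) M k (E : set (plane R)) : dot e e = 1 ->
  tame E -> 0 <= M -> 0 <= k ->
  (forall z, E z -> 0 <= dot e (z - Q) <= M /\ 0 <= cross e (z - Q) <= k * dot e (z - Q)) ->
  2 * area E <= k * M ^+ 2.
Proof.
move=> e1 tE M0 k0 H; apply: le_trans (area_tri_le M0 k0); rewrite ler_pM2l //.
rewrite -[leRHS](area_frame Q e1); last by case: (tame_tri M k).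
by apply: area_le => //; apply: tame_frame => //; exact: tame_tri.
Qed.

(** A trapezoid is the difference of two triangles with a common vertex; the large one is bounded
    from below, the small one from above. *)
Lemma area_ge_trap (e Q : plane R) u w k (E : set (plane R)) : dot e e = 1 ->
  tame E -> 0 <= u -> u <= w -> 0 <= k ->
  (forall z, u < dot e (z - Q) < w -> 0 < cross e (z - Q) < k * dot e (z - Q) -> E z) ->
  k * (w ^+ 2 - u ^+ 2) <= 2 * area E.
Proof.
move=> e1 tE u0 uw k0 H; have w0 : 0 <= w by lra.
have := area_tri_le u0 k0; have := area_otri_ge w0 k0.
rewrite -[area (otri w k)](area_frame Q e1); last by case: (tame_otri w k).
rewrite -[area (tri u k)](area_frame Q e1); last by case: (tame_tri u k).
have := @area_subU (frame e Q @^-1` otri w k) E (frame e Q @^-1` tri u k).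
move=> /(_ (tame_frame _ e1 (tame_otri _ _)) tE (tame_frame _ e1 (tame_tri _ _))) H1.
suff : area (frame e Q @^-1` otri w k) <= area E + area (frame e Q @^-1` tri u k).
  by move: (area (frame e Q @^-1` otri w k)) (area E) (area (frame e Q @^-1` tri u k)) => x y z; clear; lra.
apply: H1 => z [/andP[h1 h2] /andP[h3 h4]].
have [h|h] := lerP (frame e Q z).1 u; first by right; split; lra.
by left; apply: H; [rewrite -[dot _ _]/((frame e Q z).1); lra|apply/andP].
Qed.

(** Suppose the areas stayed lower along a sequence tending to [t0]. The points of [E t0] that
    belong to all members from rank [n] on form sets increasing to [E t0], so their areas converge
    to its area, although they stay below it by [d]. *)
Lemma area_lsc (T : pseudoMetricType R) (E : T -> set (plane R)) (t0 : T) :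
  (forall t, tame (E t)) -> (forall z, E t0 z -> \forall t \near t0, E t z) ->
  forall d, 0 < d -> \forall t \near t0, area (E t0) - d < area (E t).
Proof.
move=> tE Et d d0; apply: contrapT => nt.
have /choice[t_ t_P] n : exists t, ball t0 n.+1%:R^-1 t /\ area (E t) <= area (E t0) - d.
  apply: contrapT => no; apply: nt; apply/nbhs_ballP; exists n.+1%:R^-1; rewrite /= ?invr_gt0 //.
  by move=> t bt; rewrite ltNge; apply/negP => h; apply: no; exists t.
pose F n := E t0 `&` \bigcap_(m in [set m | (n <= m)%N]) E (t_ m).
have mE t : measurable (E t : set (R * R)) by case: (tE t).
have mF n : measurable (F n : set (R * R)).
  by apply: measurableI => //; apply: bigcap_measurable => //; exists n => /=.
have UF : \bigcup_n F n = E t0.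
  apply/seteqP; split => [z [n _ []]//|z Ez].
  have /nbhs_ballP[e /= e0 eE] := Et z Ez.
  have [n ne] : exists n, n.+1%:R^-1 < e.
    have := @near_infty_natSinv_lt R (PosNum e0) => -[N _ NP].
    by exists N; exact: (NP N (leqnn N)).
  exists n => //; split => // m /= nm; apply: eE.
  apply: le_ball (t_P m).1; apply: le_trans (ltW ne).
  by rewrite lef_pV2 ?posrE // ler_nat.
have := @nondecreasing_cvg_mu _ _ _ mu2 F mF.
rewrite UF => /(_ (mE t0)).
have ndF : nondecreasing_seq F.
  apply/nondecreasing_seqP => n; apply/subsetPset => z [Ez zF]; split => // m /= nm.
  by apply: zF => /=; exact: ltnW.
move=> /(_ ndF) Fc.
have tF n : tame (F n) by apply: tameS (tE t0) => // z [].
have : (mu2 (E t0) <= (area (E t0) - d)%:E)%E.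
  rewrite -(cvg_lim _ Fc) //; apply: lime_le; first by apply/cvg_ex; exists (mu2 (E t0)).
  apply: nearW => n /=; rewrite areaE // lee_fin; apply: le_trans (t_P n).2.
  by apply: area_le => // z [_ zF]; apply: zF => /=.
by rewrite areaE // lee_fin; lra.
Qed.

End Area.

(** * Minima and uniform estimates on compact sets *)

Section Compactness.
Variable R : realType.

Lemma continuous_crossB (e Y : plane R) : continuous (fun z : plane R => cross e (z - Y) : R).
Proof.
move=> z; apply: cvgB; (apply: cvgM; first exact: cvg_cst); apply: cvgB; try exact: cvg_cst.
exact: cvg_snd.
exact: cvg_fst.
Qed.

(** If the infimum [m] were not attained, each point would have a neighbourhood on which [J] exceeds
    some [i > m]. Compactness makes one such [i] serve all of [D], against the definition of [m]. *)
Lemma compact_lsc_min (T : pseudoMetricType R) (D : set T) (J : T -> R) :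
  compact D -> D !=set0 -> (forall t, D t -> 0 <= J t) ->
  (forall t, D t -> forall d, 0 < d -> \forall u \near t, D u -> J t - d < J u) ->
  exists2 t, D t & forall u, D u -> J t <= J u.
Proof.
move=> cD [t0 Dt0] J0 lJ.
have infJ : has_inf (J @` D) by split; [exists (J t0), t0|exists 0 => _ [t Dt <-]; exact: J0].
set m := inf (J @` D); apply: contrapT => no.
have mJ t : D t -> m < J t.
  move=> Dt; rewrite ltNge; apply/negP => Jm; apply: no; exists t => // u Du.
  by apply: le_trans Jm _; apply: ge_inf; [case: infJ|exists u].
have /compact_near_coveringP /(_ R (m^'+) (fun i x => D x -> i < J x)) := cD.
have H x : D x -> \forall x' \near x & i \near m^'+, D x' -> i < J x'.
  move=> Dx; have d0 : 0 < (J x - m) / 2 by have := mJ x Dx; lra.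
  have h1 := lJ x Dx _ d0.
  have h2 : \forall i \near m^'+, i < J x - (J x - m) / 2 by apply: nbhs_right_lt; lra.
  exists ([set x' | D x' -> J x - (J x - m) / 2 < J x'], [set i | i < J x - (J x - m) / 2]) => //.
  by move=> [x' i] [/= hx hi] Dx'; exact: lt_trans (hx Dx').
move=> /(_ _ H) Hi.
have : \forall i \near m^'+, False.
  near=> i.
  have iD : D `<=` (fun x => D x -> i < J x) by near: i.
  have im : m < i by near: i; exact: nbhs_right_gt.
  have im0 : 0 < i - m by rewrite subr_gt0.
  have [_ [t Dt <-]] := inf_adherent im0 infJ.
  by rewrite -/m addrC subrK; have := iD t Dt Dt => /= h1 h2; lra.
by move=> /filter_ex [].
Unshelve. all: by end_near. Qed.

(** Compactness spreads positivity from the zero set of [phi] to a neighbourhood of uniform width.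
    With [phi] the distance to a line, this stands in for regularity of the boundary of a body. *)
Lemma compact_thicken (T : topologicalType) (K : set T) (phi psi : T -> R) :
  compact K -> continuous phi -> continuous psi ->
  (forall z, K z -> phi z = 0 -> 0 < psi z) ->
  exists2 k, 0 < k & forall z, K z -> `|phi z| <= k -> 0 < psi z.
Proof.
move=> cK cphi cpsi H.
have /compact_near_coveringP /(_ R (0^'+) (fun i x => `|phi x| <= i -> 0 < psi x)) := cK.
have HH x : K x -> \forall x' \near x & i \near 0^'+, `|phi x'| <= i -> 0 < psi x'.
  move=> Kx; have [p0|p0] := eqVneq (phi x) 0.
    exists ([set x' | 0 < psi x'], setT); last by move=> [x' i] [/= hx _ _].
    by split => /=; [apply: (cvgr_gt _ (cpsi x)); exact: H|exact: filterT].
  have np : 0 < `|phi x| / 2 by rewrite divr_gt0 // normr_gt0.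
  exists ([set x' | `|phi x| / 2 < `|phi x'|], [set i | i < `|phi x| / 2]).
    split => /=; last exact: nbhs_right_lt.
    have cx := cvg_norm (cphi x).
    have lt2 : `|phi x| / 2 < `|phi x| by lra.
    exact: (cvgr_gt _ (cx (nbhs_filter x)) _ lt2).
  by move=> [x' i] [/= hx hi] h; exfalso; lra.
move=> /(_ _ HH) Hi.
have : \forall i \near 0^'+, (K `<=` (fun x => `|phi x| <= i -> 0 < psi x)) /\ 0 < i.
  near=> i; split; near: i; first exact: Hi.
  exact: nbhs_right_gt.
move=> /filter_ex[i [iK i0]]; exists i => // z Kz; exact: iK.
Unshelve. all: by end_near. Qed.

End Compactness.

(** * Plane geometry *)

Section Plane.
Variable R : realType.
Implicit Types (e Y z k : plane R) (K : set (plane R)).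

Lemma continuous_dotB e Y : continuous (fun z : plane R => dot e (z - Y) : R).
Proof.
move=> z; apply: cvgD; (apply: cvgM; first exact: cvg_cst); apply: cvgB; try exact: cvg_cst.
exact: cvg_fst.
exact: cvg_snd.
Qed.

Lemma plane_eq (x y : plane R) : x.1 = y.1 -> x.2 = y.2 -> x = y.
Proof. by case: x y => [x1 x2] [y1 y2] /= -> ->. Qed.

Lemma unit_eq e z w : dot e e = 1 -> dot e z = dot e w -> cross e z = cross e w -> z = w.
Proof.
move=> e1 d c; have h (v : plane R) : v = (e.1 * dot e v - e.2 * cross e v,
    e.2 * dot e v + e.1 * cross e v) :> plane R.
  apply: plane_eq => /=.
    by transitivity (dot e e * v.1); [rewrite e1 mul1r|rewrite /dot /cross; ring].
  by transitivity (dot e e * v.2); [rewrite e1 mul1r|rewrite /dot /cross; ring].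
by rewrite (h z) (h w) d c.
Qed.

Lemma dot0 (u : plane R) : dot u 0 = 0.
Proof. by rewrite /dot /= !mulr0 addr0. Qed.
Lemma cross0 (u : plane R) : cross u 0 = 0.
Proof. by rewrite /cross /= !mulr0 subrr. Qed.
Lemma dotDr (u v w : plane R) : dot u (v + w) = dot u v + dot u w.
Proof. by rewrite /dot /=; ring. Qed.
Lemma crossDr (u v w : plane R) : cross u (v + w) = cross u v + cross u w.
Proof. by rewrite /cross /=; ring. Qed.
Lemma dotBr (u v w : plane R) : dot u (v - w) = dot u v - dot u w.
Proof. by rewrite /dot /=; ring. Qed.

Lemma dotZr (a : R) (u v : plane R) : dot u (a *: v) = a * dot u v.
Proof. by rewrite /dot /= /GRing.scale /=; ring. Qed.
Lemma crossZr (a : R) (u v : plane R) : cross u (a *: v) = a * cross u v.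
Proof. by rewrite /cross /= /GRing.scale /=; ring. Qed.
Lemma dotDl (u v w : plane R) : dot (v + w) u = dot v u + dot w u.
Proof. by rewrite /dot /=; ring. Qed.
Lemma crossDl (u v w : plane R) : cross (v + w) u = cross v u + cross w u.
Proof. by rewrite /cross /=; ring. Qed.

Lemma dotZl (a : R) (u v : plane R) : dot (a *: v) u = a * dot v u.
Proof. by rewrite /dot /= /GRing.scale /=; ring. Qed.
Lemma crossZl (a : R) (u v : plane R) : cross (a *: v) u = a * cross v u.
Proof. by rewrite /cross /= /GRing.scale /=; ring. Qed.
Lemma crossxx (u : plane R) : cross u u = 0.
Proof. by rewrite /cross; ring. Qed.
Lemma crossC (u v : plane R) : cross v u = - cross u v.
Proof. by rewrite /cross; ring. Qed.
Lemma dotC (u v : plane R) : dot v u = dot u v.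
Proof. by rewrite /dot; ring. Qed.

Lemma dot_ge0 (u : plane R) : 0 <= dot u u.
Proof. by rewrite /dot -!expr2 addr_ge0 // sqr_ge0. Qed.
Lemma dot_eq0 (u : plane R) : dot u u = 0 -> u = 0.
Proof.
rewrite /dot -!expr2 => /eqP; rewrite paddr_eq0 ?sqr_ge0 // !sqrf_eq0.
by move=> /andP[/eqP ? /eqP ?]; exact: plane_eq.
Qed.

Lemma dotNr (u v : plane R) : dot u (- v) = - dot u v.
Proof. by rewrite /dot /=; ring. Qed.
Lemma crossNr (u v : plane R) : cross u (- v) = - cross u v.
Proof. by rewrite /cross /=; ring. Qed.
Lemma dotNl (u v : plane R) : dot (- v) u = - dot v u.
Proof. by rewrite /dot /=; ring. Qed.
Lemma crossNl (u v : plane R) : cross (- v) u = - cross v u.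
Proof. by rewrite /cross /=; ring. Qed.

Definition vecE := (dotDr, crossDr, dotNr, crossNr, dotZr, crossZr, dotDl, crossDl,
  dotNl, crossNl, dotZl, crossZl, crossxx, dot0, cross0).

Definition convexK K := forall x y (t : R), K x -> K y -> 0 <= t -> t <= 1 ->
  K (t *: x + (1 - t) *: y).

Lemma convex2 K x y z (t : R) : convexK K -> K x -> K y -> 0 <= t -> t <= 1 ->
  z = t *: x + (1 - t) *: y -> K z.
Proof. by move=> cK Kx Ky t0 t1 ->; exact: cK. Qed.

Lemma convex3 K x y w z (a b c : R) : convexK K -> K x -> K y -> K w ->
  0 <= a -> 0 <= b -> 0 <= c -> a + b + c = 1 ->
  z = a *: x + b *: y + c *: w -> K z.
Proof.
move=> cK Kx Ky Kw a0 b0 c0 abc ->; have [ab0|ab] := eqVneq (a + b) 0.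
  have a0' : a = 0 by lra. have b0' : b = 0 by lra. have c1 : c = 1 by lra.
  by rewrite a0' b0' c1 !scale0r add0r add0r scale1r.
have abp : 0 < a + b by rewrite lt_neqAle eq_sym ab /=; lra.
apply: (@convex2 K (a / (a + b) *: x + (1 - a / (a + b)) *: y) w _ (a + b) cK) => //; last 3 first.
- lra.
- lra.
- have -> : c = 1 - (a + b) by lra.
  by apply: plane_eq; rewrite /= /GRing.scale /=; field; rewrite gt_eqF.
  apply: cK => //; first by rewrite divr_ge0 //; lra.
  by rewrite ler_pdivrMr // mul1r; lra.
Qed.

(* [Y + r1 e] and [Y + r2 e] are the end points of [K] on the line [Y + R e]. *)
Definition chord K Y e (r1 r2 : R) := [/\ K (Y + r1 *: e), K (Y + r2 *: e), r1 <= r2 &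
  forall z, K z -> cross e (z - Y) = 0 -> r1 <= dot e (z - Y) <= r2].

Lemma plane_hausdorff : hausdorff_space (plane R).
Proof. exact: norm_hausdorff. Qed.

Lemma compact_closed2 K : compact K -> closed K.
Proof. exact: compact_closed plane_hausdorff. Qed.

Lemma plane_open_lt (f : plane R -> R) (a : R) : continuous f -> open [set z | f z < a].
Proof.
move=> cf; have := @open_comp _ _ f [set x | x < a] (fun z _ => cf z) (@open_lt _ a).
by [].
Qed.

Lemma plane_open_gt (f : plane R -> R) (a : R) : continuous f -> open [set z | a < f z].
Proof.
move=> cf; have := @open_comp _ _ f [set x | a < x] (fun z _ => cf z) (@open_gt _ a).
by [].
Qed.

Lemma plane_closed_eq (f : plane R -> R) (a : R) : continuous f -> closed [set z | f z = a].
Proof.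
move=> cf; have := @closed_comp _ _ f [set a] (fun z _ => cf z) (@closed_eq _ a).
by [].
Qed.

Lemma chord_ex K Y e k : compact K -> dot e e = 1 -> K k -> cross e (k - Y) = 0 ->
  exists r1 r2, chord K Y e r1 r2.
Proof.
move=> cK e1 Kk ck.
pose A := K `&` [set z | cross e (z - Y) = 0].
have cA : compact A.
  apply: subclosed_compact (cK) _; last by move=> z [].
  apply: closedI; first exact: compact_closed2.
  exact: plane_closed_eq (@continuous_crossB _ e Y).
have A0 : A !=set0 by exists k.
have cd : {within A, continuous (fun z => dot e (z - Y) : R)}.
  by apply: continuous_subspaceT; exact: continuous_dotB.
have [z1 /set_mem[K1 c1] m1] := compact_EVT_min A0 cA cd.
have [z2 /set_mem[K2 c2] m2] := compact_EVT_max A0 cA cd.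
have E z : cross e (z - Y) = 0 -> Y + dot e (z - Y) *: e = z.
  move=> cz; rewrite -[RHS](addrNK Y) [RHS]addrC; congr (_ + _).
  by apply: (unit_eq e1); rewrite (dotZr, crossZr) ?e1 ?mulr1 // crossxx mulr0 cz.
exists (dot e (z1 - Y)), (dot e (z2 - Y)); split; rewrite ?E //.
  by apply: m2; rewrite inE.
by move=> z Kz cz; rewrite m1 ?m2 // inE.
Qed.

(** A thin strip along the line meets [K] in a region barely longer than the chord: the source of
    the upper bounds for what a moving line adds to a cap. *)
Lemma chord_thicken K Y e r1 r2 (h : R) : compact K -> chord K Y e r1 r2 -> 0 < h ->
  exists2 k, 0 < k & forall z, K z -> `|cross e (z - Y)| <= k ->
    r1 - h < dot e (z - Y) < r2 + h.
Proof.
move=> cK [_ _ _ H] h0.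
have [k1 k10 H1] : exists2 k, 0 < k & forall z, K z -> `|cross e (z - Y)| <= k ->
    0 < dot e (z - Y) - (r1 - h).
  apply: (compact_thicken cK (@continuous_crossB _ e Y)).
    by move=> z; apply: cvgB; [exact: continuous_dotB|exact: cvg_cst].
  by move=> z Kz /(H z Kz)/andP[? ?]; lra.
have [k2 k20 H2] : exists2 k, 0 < k & forall z, K z -> `|cross e (z - Y)| <= k ->
    0 < (r2 + h) - dot e (z - Y).
  apply: (compact_thicken cK (@continuous_crossB _ e Y)).
    by move=> z; apply: cvgB; [exact: cvg_cst|exact: continuous_dotB].
  by move=> z Kz /(H z Kz)/andP[? ?]; lra.
exists (Num.min k1 k2); first by rewrite lt_min k10.
by move=> z Kz; rewrite le_min => /andP[/(H1 z Kz) ? /(H2 z Kz) ?]; apply/andP; split; lra.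
Qed.

Lemma compact_bound K : compact K -> exists2 M : R, 0 < M &
  forall z, K z -> `|z.1| <= M /\ `|z.2| <= M.
Proof.
move=> cK; have := @compact_bounded R (plane R) K cK.
move=> /ex_strict_bound_gt0[M M0 H]; exists M => // z Kz.
have := H z Kz; rewrite /= prod_normE gt_max => /andP[h1 h2].
by split; exact: ltW.
Qed.

Lemma compact_tame K : compact K -> tame K.
Proof.
move=> cK; split.
  by rewrite -(setCK K); apply: measurableC; apply: open_measurable2; apply: closed_openC; exact: compact_closed2.
by have [M _ H] := compact_bound cK; exists M.
Qed.

Definition right_part K Y e : set (plane R) := K `&` [set z | cross e (z - Y) < 0].

Lemma tame_right K Y e : compact K -> tame (right_part K Y e).
Proof.
move=> cK; have tK := compact_tame cK; apply: tameS tK; last by move=> z [].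
apply: measurableI; first by case: (compact_tame cK).
apply: open_measurable2; exact: plane_open_lt (@continuous_crossB _ e Y).
Qed.

(** The direction from [Y] to the nearest point [k0] of [K] is such a normal: otherwise a small step
    from [k0] towards some [k] would come nearer to [Y]. *)
Lemma separation K Y : compact K -> convexK K -> K !=set0 -> ~ K Y ->
  exists2 n : plane R, dot n n = 1 & forall k, K k -> 0 < dot n (k - Y).
Proof.
move=> cK vK K0 nKY.
have cd : {within K, continuous (fun z => dot (z - Y) (z - Y) : R)}.
  apply: continuous_subspaceT => z; apply: cvgD; apply: cvgM; apply: cvgB; try exact: cvg_cst.
  - exact: cvg_fst.
  - exact: cvg_fst.
  - exact: cvg_snd.
  - exact: cvg_snd.
have [k0 Kk0 m0] : exists2 k0 : plane R, K k0 & forall t : plane R, K t ->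
    dot (k0 - Y) (k0 - Y) <= dot (t - Y) (t - Y).
  have [k0 /set_mem Kk0 m0] := compact_EVT_min K0 cK cd.
  by exists k0 => // t Kt; apply: m0; rewrite inE.
have [v vE] : exists v : plane R, v = k0 - Y by exists (k0 - Y).
have v0 : 0 < dot v v.
  rewrite lt_neqAle; apply/andP; split; last exact: dot_ge0.
  apply/eqP => /esym /dot_eq0 vv; apply: nKY.
  by move/eqP: vv; rewrite vE subr_eq0 => /eqP <-.
have H k : K k -> dot v v <= dot v (k - Y).
  move=> Kk; rewrite leNgt; apply/negP => lt1.
  have [w wE] : exists w : plane R, w = k - k0 by exists (k - k0).
  have vw : dot v w < 0.
    by move: lt1; rewrite wE vE !vecE; lra.
  have ww := dot_ge0 w.
  (* After this step the squared distance has changed by [2 * t * dot v w + t ^+ 2 * dot w w], which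
     is negative. *)
  pose t := Num.min 1 (- dot v w / (1 + dot w w)).
  have t0 : 0 < t by rewrite lt_min ltr01 divr_gt0 //; lra.
  have t1 : t <= 1 by rewrite ge_min lexx.
  have tw : t * (1 + dot w w) <= - dot v w.
    by rewrite -ler_pdivlMr ?ge_min ?lexx ?orbT //; lra.
  have Kt : K (t *: k + (1 - t) *: k0) by apply: vK => //; lra.
  have := m0 _ Kt.
  have -> : t *: k + (1 - t) *: k0 - Y = v + t *: w.
    by apply: plane_eq; rewrite vE wE /= /GRing.scale /=; ring.
  rewrite -vE !vecE [dot w v]dotC; nra.
pose s := Num.sqrt (dot v v); have s0 : 0 < s by rewrite sqrtr_gt0.
have ss : s * s = dot v v by rewrite -expr2 sqr_sqrtr // ltW.
exists (s^-1 *: v).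
  by rewrite !vecE -ss mulrA mulrACA; rewrite mulVf ?gt_eqF // mul1r.
by move=> k /H h; rewrite !vecE -mulrBr pmulr_rgt0 ?invr_gt0 // -dotBr; lra.
Qed.

End Plane.

(** * Areas cut from a convex body by a moving line *)

Section Caps.
Variable R : realType.
Implicit Types (e f Y Q k z : plane R) (K : set (plane R)).

Lemma cross_rot e f v : dot e e = 1 -> cross f v = dot e f * cross e v - cross e f * dot e v.
Proof. by move=> e1; rewrite -[LHS]mul1r -e1 /dot /cross; ring. Qed.

Lemma dot_rot e f v : dot e e = 1 -> dot f v = dot e f * dot e v + cross e f * cross e v.
Proof. by move=> e1; rewrite -[LHS]mul1r -e1 /dot /cross; ring. Qed.

Lemma chord_convex K Y e r1 r2 r : convexK K -> chord K Y e r1 r2 -> r1 <= r -> r <= r2 ->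
  K (Y + r *: e).
Proof.
move=> vK [K1 K2 r12 _] h1 h2; have [->//|r1r] := eqVneq r r1.
have r21 : 0 < r2 - r1 by rewrite subr_gt0; apply: lt_le_trans h2; rewrite lt_neqAle eq_sym r1r.
apply: (@convex2 _ _ _ _ _ ((r2 - r) / (r2 - r1)) vK K1 K2).
- by rewrite divr_ge0 //; lra.
- by rewrite ler_pdivrMr //; lra.
- by apply: plane_eq; rewrite /= /GRing.scale /=; field; rewrite gt_eqF.
Qed.

Lemma dotB_bound K e Q : compact K -> exists2 M : R, 0 < M &
  forall z, K z -> `|dot e (z - Q)| <= M /\ `|cross e (z - Q)| <= M.
Proof.
move=> cK; have [M M0 H] := compact_bound cK.
exists ((`|e.1| + `|e.2| + 1) * (M + `|Q.1| + `|Q.2|)).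
  have := normr_ge0 e.1; have := normr_ge0 e.2; have := normr_ge0 Q.1.
  by have := normr_ge0 Q.2; nra.
move=> z /H[h1 h2].
have d1 : `|z.1 - Q.1| <= M + `|Q.1| by apply: le_trans (ler_normB _ _) _; lra.
have d2 : `|z.2 - Q.2| <= M + `|Q.2| by apply: le_trans (ler_normB _ _) _; lra.
have n1 := normr_ge0 e.1; have n2 := normr_ge0 e.2.
have m1 := normr_ge0 Q.1; have m2 := normr_ge0 Q.2.
have p1 : `|e.1| * `|z.1 - Q.1| <= `|e.1| * (M + `|Q.1|) by rewrite ler_wpM2l.
have p2 : `|e.2| * `|z.2 - Q.2| <= `|e.2| * (M + `|Q.2|) by rewrite ler_wpM2l.
have p3 : `|e.1| * `|z.2 - Q.2| <= `|e.1| * (M + `|Q.2|) by rewrite ler_wpM2l.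
have p4 : `|e.2| * `|z.1 - Q.1| <= `|e.2| * (M + `|Q.1|) by rewrite ler_wpM2l.
split; rewrite /dot /cross /=.
  by apply: le_trans (ler_normD _ _) _; rewrite !normrM; nra.
by apply: le_trans (ler_normB _ _) _; rewrite !normrM; nra.
Qed.

(** What the cap gains lies in a rectangle of height [d] over the slightly lengthened chord. *)
Lemma right_shift_up K Y e r1 r2 (h : R) : compact K -> dot e e = 1 ->
  chord K Y e r1 r2 -> 0 < h -> exists2 d0 : R, 0 < d0 &
  forall d Y', 0 <= d -> d <= d0 -> cross e (Y' - Y) = d ->
  area (right_part K Y' e) <= area (right_part K Y e) + d * (r2 - r1 + 2 * h).
Proof.
move=> cK e1 cY h0; have [k k0 H] := chord_thicken cK cY h0.
exists k => // d Y' d0 dk cd; have r12 : r1 <= r2 by case: cY.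
have cE z : cross e (z - Y') = cross e (z - Y) - d by rewrite -cd !vecE; ring.
have tC : tame (right_part K Y' e `\` right_part K Y e).
  by apply: tameD; [exact: tame_right|case: (tame_right Y e cK)].
apply: le_trans (area_subU (tame_right Y' e cK) (tame_right Y e cK) tC _) _.
  by move=> z hz; have [|] := pselect (right_part K Y e z); [left|right].
rewrite lerD2l.
have := @area_le_rect R e Y (r1 - h) (r2 + h) 0 d _ e1 tC.
have -> : d * (r2 - r1 + 2 * h) = (r2 + h - (r1 - h)) * (d - 0) by ring.
apply; [lra|lra|move=> z [[Kz /=]]].
rewrite cE => c1 c2; have c3 : 0 <= cross e (z - Y).
  by rewrite leNgt; apply/negP => c3; exact: c2.
have /andP[h1 h2] : r1 - h < dot e (z - Y) < r2 + h by apply: H; rewrite // ger0_norm //; lra.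
by split; apply/andP; split; lra.
Qed.

Lemma right_mono K Y Y' e : compact K -> cross e (Y' - Y) <= 0 ->
  area (right_part K Y' e) <= area (right_part K Y e).
Proof.
move=> cK c0; apply: area_le; try exact: tame_right.
by move=> z [Kz /= hz]; split => //=; move: c0 hz; rewrite !vecE; lra.
Qed.

(** [K] contains the triangle spanned by the chord and [k], hence a thin rectangle under all of the
    chord except its ends. *)
Lemma chord_below K Y e r1 r2 k (h : R) : convexK K -> dot e e = 1 ->
  chord K Y e r1 r2 -> K k -> cross e (k - Y) < 0 -> 0 < h ->
  exists2 d0 : R, 0 < d0 & forall z, r1 + h <= dot e (z - Y) <= r2 - h ->
    - d0 <= cross e (z - Y) <= 0 -> K z.
Proof.
move=> vK e1 cY Kk ck h0.
have [d dE] : exists d, d = - cross e (k - Y) by exists (- cross e (k - Y)).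
have [x0 xE] : exists x0, x0 = dot e (k - Y) by exists (dot e (k - Y)).
have d_gt0 : 0 < d by lra.
pose N := `|x0 - r1| + `|x0 - r2| + 2 * h.
have N0 : 0 < N.
  by rewrite /N; have := normr_ge0 (x0 - r1); have := normr_ge0 (x0 - r2); lra.
have dN : 0 < h * d / N by rewrite divr_gt0 // mulr_gt0.
exists (h * d / N) => // z /andP[z1 z2] /andP[z3 z4].
have [x zx] : exists x, x = dot e (z - Y) by exists (dot e (z - Y)).
have [y zy] : exists y, y = - cross e (z - Y) by exists (- cross e (z - Y)).
(* [z] is sought on the segment from [k] to the point of the line with coordinate [r]; [t] is the
   ratio of the depths of [z] and [k]. *)
have [t tE] : exists t, t = y / d by exists (y / d).
have td : t * d = y by rewrite tE divfK // gt_eqF.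
have t0 : 0 <= t by rewrite tE divr_ge0 //; lra.
have tN : t * N <= h.
  rewrite tE mulrAC ler_pdivrMr //.
  have : y <= h * d / N by lra.
  by rewrite ler_pdivlMr.
have t1 : t <= 1 / 2.
  have : t * (2 * h) <= t * N.
    by rewrite ler_wpM2l // /N; have := normr_ge0 (x0 - r1); have := normr_ge0 (x0 - r2); lra.
  by nra.
have n1 : t * (x0 - r1) <= h.
  apply: le_trans tN; rewrite ler_wpM2l // /N; have := ler_norm (x0 - r1).
  by have := normr_ge0 (x0 - r2); lra.
have n2 : t * (r2 - x0) <= h.
  apply: le_trans tN; rewrite ler_wpM2l // /N; have := ler_norm (r2 - x0).
  by have := normr_ge0 (x0 - r1); rewrite (distrC r2); lra.
have [r rE] : exists r, r = (x - t * x0) / (1 - t) by exists ((x - t * x0) / (1 - t)).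
have rt : r * (1 - t) = x - t * x0 by rewrite rE divfK // gt_eqF //; lra.
have t1' : 0 < 1 - t by lra.
have Kr : K (Y + r *: e).
  apply: (chord_convex vK cY).
    by rewrite -(ler_pM2r t1') rt; lra.
  by rewrite -(ler_pM2r t1') rt; lra.
apply: (@convex2 _ _ _ _ z t vK Kk Kr t0); first lra.
have kx : dot e k = x0 + dot e Y by move: xE; rewrite !vecE; lra.
have ky : cross e k = - d + cross e Y by move: dE; rewrite !vecE; lra.
have zx' : dot e z = x + dot e Y by move: zx; rewrite !vecE; lra.
have zy' : cross e z = - y + cross e Y by move: zy; rewrite !vecE; lra.
apply: (unit_eq e1); rewrite !vecE ?e1 ?zx' ?kx ?zy' ?ky.
  have -> : x = r * (1 - t) + t * x0 by rewrite rt; ring.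
  by ring.
by rewrite -td; ring.
Qed.

(** Lowering the line removes from the cap a rectangle under the chord. That this rectangle lies in
    [K] is due to the point [k] strictly below the line. *)
Lemma right_shift_down K Y e r1 r2 k (h : R) : compact K -> convexK K -> dot e e = 1 ->
  chord K Y e r1 r2 -> K k -> cross e (k - Y) < 0 -> 0 < h -> exists2 d0 : R, 0 < d0 &
  forall d Y', 0 <= d -> d <= d0 -> cross e (Y' - Y) = - d ->
  area (right_part K Y' e) + d * (r2 - r1 - 2 * h) <= area (right_part K Y e).
Proof.
move=> cK vK e1 cY Kk ck h0; have [k0 k00 H] := chord_below vK e1 cY Kk ck h0.
exists k0 => // d Y' d0 dk cd.
have cE z : cross e (z - Y') = cross e (z - Y) + d by move: cd; rewrite !vecE; lra.
(* When the shortened chord has no length, monotonicity of the cap is enough. *)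
have [rh|rh] := lerP (r2 - r1 - 2 * h) 0.
  apply: (@le_trans _ _ (area (right_part K Y' e))); first by nra.
  by apply: right_mono => //; lra.
pose D := frame e Y @^-1` obox (r1 + h) (r2 - h) (- d) 0.
have tD : tame D by apply: tame_frame => //; exact: tame_obox.
have -> : d * (r2 - r1 - 2 * h) = area D.
  by rewrite area_frame ?area_obox //; [ring|lra|lra|case: (tame_obox (r1 + h) (r2 - h) (-d) 0)].
apply: area_disj => //; try exact: tame_right.
- by move=> z [Kz /= hz]; split => //=; move: hz; rewrite cE; lra.
- move=> z [/= /andP[h1 h2] /andP[h3 h4]]; split => //=.
  by apply: H; apply/andP; split; lra.
- apply/seteqP; split => // z [[_ /=]]; rewrite cE => h1 [_ /= /andP[h2 h3]]; lra.
Qed.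

(** Turning the line counterclockwise about [Y + q *: e], by the angle of tangent [k], adds to the
    cap only a sector beyond the pivot, of length about [r2 - q]. What is lost on the other side of
    the pivot is dropped, as [K] may have nothing below the line. *)
Lemma right_rot K Y e r1 r2 (q h : R) : compact K -> dot e e = 1 ->
  chord K Y e r1 r2 -> q <= r2 -> 0 < h -> exists2 k0 : R, 0 < k0 &
  forall e' (k : R), 0 < dot e e' -> 0 <= k -> k <= k0 -> cross e e' = k * dot e e' ->
  2 * area (right_part K (Y + q *: e) e') <=
  2 * area (right_part K Y e) + k * (r2 - q + h) ^+ 2.
Proof.
move=> cK e1 cY qr h0; have [k k0 H] := chord_thicken cK cY h0.
pose Q : plane R := Y + q *: e.
have [M M0 HM] := dotB_bound e Q cK.
(* Over all of [K] the turned line then rises above the old one by at most [k]. *)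
exists (k / M); first exact: divr_gt0.
move=> e' m c0 m0 mk se.
have dQ z : dot e (z - Q) = dot e (z - Y) - q by rewrite /Q !vecE e1; ring.
have cQ z : cross e (z - Q) = cross e (z - Y) by rewrite /Q !vecE; ring.
have tC : tame (right_part K Q e' `\` right_part K Y e).
  by apply: tameD; [exact: tame_right|case: (tame_right Y e cK)].
have h1 : area (right_part K Q e') <= area (right_part K Y e) +
    area (right_part K Q e' `\` right_part K Y e).
  apply: (area_subU (tame_right Q e' cK) (tame_right Y e cK) tC).
  by move=> z hz; have [|] := pselect (right_part K Y e z); [left|right].
suff : 2 * area (right_part K Q e' `\` right_part K Y e) <= m * (r2 - q + h) ^+ 2.
  by move: h1; rewrite -/Q; move: (area _) (area _) (area _) => x y z; clear; lra.
apply: (@area_le_tri R e Q) => //; first by clear -qr h0; lra.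
move=> z [[Kz /=]]; rewrite (cross_rot _ _ e1) se => c1 c2.
have c3 : 0 <= cross e (z - Y).
  by rewrite leNgt; apply/negP => c3; exact: c2.
have c4 : cross e (z - Q) < m * dot e (z - Q).
  by rewrite -(ltr_pM2l c0); clear -c1; lra.
have [HM1 _] := HM z Kz.
have c5 : cross e (z - Y) <= k.
  rewrite -cQ; apply: le_trans (ltW c4) _.
  apply: (@le_trans _ _ (m * M)); last by rewrite -ler_pdivlMr.
  by rewrite ler_wpM2l //; apply: le_trans (ler_norm _) _.
have /andP[h3 h2] : r1 - h < dot e (z - Y) < r2 + h by apply: H; rewrite // ger0_norm.
have d0 : 0 <= dot e (z - Q) by rewrite leNgt; apply/negP => dl; rewrite cQ in c4; clear -c3 c4 m0 dl; nra.
by rewrite cQ in c4 *; split; apply/andP; split => //; [rewrite dQ; clear -h2; lra|exact: ltW].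
Qed.

End Caps.

(** * Lower semicontinuous functionals *)

Section Lsc.
Variable R : realType.

Definition lsc_on (T : topologicalType) (D : set T) (J : T -> R) :=
  forall t, D t -> forall d, 0 < d -> \forall u \near t, D u -> J t - d < J u.

Lemma lsc_onD (T : topologicalType) (D : set T) (J L : T -> R) :
  lsc_on D J -> lsc_on D L -> lsc_on D (fun u => J u + L u).
Proof.
move=> lJ lL t Dt d d0; have d2 : 0 < d / 2 by lra.
have := lJ t Dt _ d2; have := lL t Dt _ d2; apply: filterS2 => u h1 h2 Du /=.
by have := h1 Du; have := h2 Du; lra.
Qed.

Lemma lsc_onZ (T : topologicalType) (D : set T) (J : T -> R) (a : R) : 0 < a ->
  lsc_on D J -> lsc_on D (fun u => a * J u).
Proof.
move=> a0 lJ t Dt d d0; have := lJ t Dt (d / a) (divr_gt0 d0 a0); apply: filterS => u h Du /=.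
by have := h Du; rewrite -(ltr_pM2l a0) mulrBr mulrCA divff ?gt_eqF // mulr1.
Qed.

Lemma near_gt (T : topologicalType) (f : T -> R) t (a : R) : continuous f -> a < f t ->
  \forall u \near t, a < f u.
Proof. by move=> cf h; apply: (cvgr_gt _ (cf t)). Qed.

Lemma near_lt (T : topologicalType) (f : T -> R) t (a : R) : continuous f -> f t < a ->
  \forall u \near t, f u < a.
Proof. by move=> cf h; apply: (cvgr_lt _ (cf t)). Qed.

Lemma lsc_on_continuous (T : topologicalType) (D : set T) (J : T -> R) :
  continuous J -> lsc_on D J.
Proof.
move=> cJ t _ d d0; have h : J t - d < J t by lra.
by apply: filterS (near_gt cJ h) => u hu _.
Qed.

Lemma area_lsc_on (T : pseudoMetricType R) (D : set T) (E : T -> set (plane R)) :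
  (forall t, D t -> tame (E t)) ->
  (forall t z, D t -> E t z -> \forall u \near t, E u z) ->
  lsc_on D (fun t => area (E t)).
Proof.
move=> tE nE t Dt d d0.
(* Outside [D] the sets need not be tame, so they are replaced there by the set at the base
   point. *)
pose E' u := if `[< D u >] then E u else E t.
have tE' u : tame (E' u) by rewrite /E'; case: asboolP => [/tE|_] //; exact: tE.
have Et : E' t = E t by rewrite /E'; case: asboolP.
have := @area_lsc R T E' t tE' _ d d0; rewrite Et => H.
have : \forall u \near t, area (E t) - d < area (E' u).
  apply: H => z Ez; have := nE t z Dt Ez; apply: filterS => u Eu.
  by rewrite /E'; case: asboolP.
by apply: filterS => u h Du; move: h; rewrite /E' asboolT.
Qed.

Lemma continuous_dot (T : topologicalType) (f g : T -> plane R) :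
  continuous f -> continuous g -> continuous (fun t => dot (f t) (g t) : R).
Proof.
move=> cf cg t; apply: cvgD; apply: cvgM.
- exact: (cvg_comp _ _ (cf t) cvg_fst).
- exact: (cvg_comp _ _ (cg t) cvg_fst).
- exact: (cvg_comp _ _ (cf t) cvg_snd).
- exact: (cvg_comp _ _ (cg t) cvg_snd).
Qed.

Lemma continuous_cross (T : topologicalType) (f g : T -> plane R) :
  continuous f -> continuous g -> continuous (fun t => cross (f t) (g t) : R).
Proof.
move=> cf cg t; apply: cvgB; apply: cvgM.
- exact: (cvg_comp _ _ (cf t) cvg_fst).
- exact: (cvg_comp _ _ (cg t) cvg_snd).
- exact: (cvg_comp _ _ (cf t) cvg_snd).
- exact: (cvg_comp _ _ (cg t) cvg_fst).
Qed.

Lemma closed_le2 (T : topologicalType) (f g : T -> R) :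
  continuous f -> continuous g -> closed [set t | f t <= g t].
Proof.
move=> cf cg; have cfg : continuous (fun t => g t - f t) by move=> t; apply: cvgB; [exact: cg|exact: cf].
have -> : [set t | f t <= g t] = (fun t => g t - f t) @^-1` [set x | 0 <= x].
  by apply/seteqP; split => t /=; rewrite subr_ge0.
by apply: (closed_comp _ (@closed_ge _ 0)) => t _; exact: cfg.
Qed.

Lemma closed_eq2 (T : topologicalType) (f : T -> R) (a : R) :
  continuous f -> closed [set t | f t = a].
Proof.
move=> cf; have := @closed_comp _ _ f [set a] (fun z _ => cf z) (@closed_eq _ a).
by [].
Qed.

Lemma compact_square (M : R) : compact [set z : plane R | `|z.1| <= M /\ `|z.2| <= M].
Proof.
have := compact_setX (@segment_compact R (- M) M) (@segment_compact R (- M) M).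
congr compact; apply/seteqP; split => z /=; rewrite !in_itv /= -!ler_norml; first by case.
by move=> [-> ->].
Qed.

Lemma unit_bound (e : plane R) : dot e e = 1 -> `|e.1| <= 1 /\ `|e.2| <= 1.
Proof.
rewrite /dot => e1; rewrite !ler_norml; split; nra.
Qed.

End Lsc.

(** * Wedges *)

Section Wedge.
Variable R : realType.
Implicit Types (e f n Y Q k z : plane R) (K : set (plane R)).
Variables (K : set (plane R)) (al be c s : R).

(** For [0 < cross e f] and positive [q1], [q2], the open triangle with vertices [Y], [Y + q1 *: e],
    [Y + q2 *: f]. Strict inequalities between continuous functions let each of its points persist
    under small changes of the parameters, as semicontinuity requires. *)
Definition wtri Y e f (q1 q2 : R) : set (plane R) := [set z | [/\ 0 < cross e (z - Y),
  cross f (z - Y) < 0 & q1 * cross e (z - Y) - q2 * cross f (z - Y) < q1 * q2 * cross e f]].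

(* [be] weights the part of [K] on the left of [f], hence the [- f]. *)
Definition wedge_energy Y e f (q1 q2 : R) : R := al * area (right_part K Y e)
  + be * area (right_part K Y (- f)) + area (wtri Y e f q1 q2 `\` K).

(* The normal [n] supports [K] at [Y]: it keeps the configurations compact, and
   it exists for free when [Y] is outside [K]. *)
Definition wedge_config Y e f n (q1 q2 : R) :=
  [/\ dot e e = 1, dot f f = 1, dot e f = c & cross e f = s] /\
  [/\ 0 <= q1, 0 <= q2, K (Y + q1 *: e) & K (Y + q2 *: f)] /\
  [/\ dot n n = 1, 0 <= dot n e, 0 <= dot n f & forall k, K k -> 0 <= dot n (k - Y)].

End Wedge.

(** * Existence of a minimal wedge *)

Section WedgeExistence.
Variable R : realType.
Implicit Types (e f n Y Q k z : plane R) (K : set (plane R)).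

Lemma wtri_coords Y e f (q1 q2 : R) z : 0 < cross e f -> 0 <= q1 -> 0 <= q2 -> wtri Y e f q1 q2 z ->
  exists x y : R, z = Y + x *: e + y *: f /\
    [/\ 0 < x, 0 < y, x < q1, y < q2 & q2 * x + q1 * y < q1 * q2].
Proof.
move=> ef q10 q20 [h1 h2 h3].
have [x xE] : exists x : R, x = - cross f (z - Y) / cross e f by eexists.
have [y yE] : exists y : R, y = cross e (z - Y) / cross e f by eexists.
have x0 : 0 < x by rewrite xE divr_gt0 //; lra.
have y0 : 0 < y by rewrite yE divr_gt0.
have xs : - cross f (z - Y) = x * cross e f by rewrite xE divfK // gt_eqF.
have ys : cross e (z - Y) = y * cross e f by rewrite yE divfK // gt_eqF.
have h4 : q2 * x + q1 * y < q1 * q2.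
  rewrite -(ltr_pM2r ef); apply: le_lt_trans h3; rewrite ys.
  have -> : cross f (z - Y) = - (x * cross e f) by lra.
  by lra.
exists x, y; split; last first.
  have q1y : 0 <= q1 * y by rewrite mulr_ge0 // ltW.
  have q2x : 0 <= q2 * x by rewrite mulr_ge0 // ltW.
  split => //.
    have q0 : 0 < q2 by rewrite lt_neqAle q20 andbT; apply/eqP => q0; move: h4; rewrite -q0 !mul0r mulr0; lra.
    by rewrite -(ltr_pM2l q0); lra.
  have q0 : 0 < q1 by rewrite lt_neqAle q10 andbT; apply/eqP => q0; move: h4; rewrite -q0 !mul0r; lra.
  by rewrite -(ltr_pM2l q0); lra.
apply: plane_eq; apply: (mulIf (lt0r_neq0 ef)).
  transitivity (Y.1 * cross e f + e.1 * (x * cross e f) + f.1 * (y * cross e f)); last first.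
    by rewrite /= /GRing.scale /=; ring.
  by rewrite -xs -ys /cross /=; ring.
transitivity (Y.2 * cross e f + e.2 * (x * cross e f) + f.2 * (y * cross e f)); last first.
  by rewrite /= /GRing.scale /=; ring.
by rewrite -xs -ys /cross /=; ring.
Qed.

Lemma open_wtri Y e f (q1 q2 : R) : open (wtri Y e f q1 q2).
Proof.
have -> : wtri Y e f q1 q2 = [set z | 0 < cross e (z - Y)] `&` ([set z | cross f (z - Y) < 0]
   `&` [set z | q1 * cross e (z - Y) - q2 * cross f (z - Y) < q1 * q2 * cross e f]).
  by apply/seteqP; split => z; [move=> []|move=> [? []]].
have c1 := @continuous_crossB R e Y; have c2 := @continuous_crossB R f Y.
apply: openI; first exact: plane_open_gt.
apply: openI; first exact: plane_open_lt.
apply: (@plane_open_lt R (fun z => q1 * cross e (z - Y) - q2 * cross f (z - Y))) => z.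
by apply: cvgB; apply: cvgM; try exact: cvg_cst; [exact: c1|exact: c2].
Qed.

Lemma tame_wtriK K Y e f (q1 q2 : R) : compact K -> 0 < cross e f -> 0 <= q1 -> 0 <= q2 ->
  tame (wtri Y e f q1 q2 `\` K).
Proof.
move=> cK ef q10 q20; apply: tameD; last by case: (compact_tame cK).
split; first by apply: open_measurable2; exact: open_wtri.
exists (`|Y.1| + `|Y.2| + q1 * (`|e.1| + `|e.2|) + q2 * (`|f.1| + `|f.2|)).
move=> z /(wtri_coords ef q10 q20)[x [y [-> [x0 y0 xq yq _]]]].
have h (a b u : R) : 0 < a -> a < b -> `|a * u| <= b * `|u|.
  by move=> a0 ab; rewrite normrM gtr0_norm // ler_wpM2r //; exact: ltW.
have := h _ _ e.1 x0 xq; have := h _ _ e.2 x0 xq.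
have := h _ _ f.1 y0 yq; have := h _ _ f.2 y0 yq.
have := normr_ge0 Y.1; have := normr_ge0 Y.2.
have g (u : R) q : 0 <= q -> 0 <= q * `|u| by move=> q0; rewrite mulr_ge0.
have := g e.1 _ q10; have := g e.2 _ q10; have := g f.1 _ q20; have := g f.2 _ q20.
move=> *; rewrite /= /GRing.scale /=; split.
  apply: le_trans (ler_normD _ _) _; apply: le_trans (lerD (ler_normD _ _) (lexx _)) _; lra.
apply: le_trans (ler_normD _ _) _; apply: le_trans (lerD (ler_normD _ _) (lexx _)) _; lra.
Qed.

(** The apex cannot run away because [0 < s]: the point [Y + q1 *: e] of [K] is at distance [s * q1]
    from the line of the other side, which also contains a point of [K], so the diameter of [K]
    bounds [q1], and likewise [q2]. *)
Lemma wedge_minimizer K (al be c s : R) : compact K -> c ^+ 2 + s ^+ 2 = 1 -> 0 < s ->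
  0 < al -> 0 < be -> (exists Y e f n q1 q2, wedge_config K c s Y e f n q1 q2) ->
  exists Y e f n q1 q2, wedge_config K c s Y e f n q1 q2 /\
    forall Y' e' f' n' q1' q2', wedge_config K c s Y' e' f' n' q1' q2' ->
      wedge_energy K al be Y e f q1 q2 <= wedge_energy K al be Y' e' f' q1' q2'.
Proof.
move=> cK cs1 s0 al0 be0 [Y0 [e0 [f0 [n0 [q10 [q20 cfg0]]]]]].
pose T := ((plane R * plane R) * (plane R * plane R) * plane R)%type.
pose pY (t : T) : plane R := t.1.1.1. pose pe (t : T) : plane R := t.1.1.2.
pose pf (t : T) : plane R := t.1.2.1. pose pn (t : T) : plane R := t.1.2.2.
pose p1 (t : T) : R := t.2.1. pose p2 (t : T) : R := t.2.2.
have cY : continuous pY.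
  by move=> t; apply: (cvg_comp _ _ (cvg_comp _ _ (@cvg_fst _ _ _ _ _) (@cvg_fst _ _ _ _ _)) cvg_fst).
have ce : continuous pe.
  by move=> t; apply: (cvg_comp _ _ (cvg_comp _ _ (@cvg_fst _ _ _ _ _) (@cvg_fst _ _ _ _ _)) cvg_snd).
have cf : continuous pf.
  by move=> t; apply: (cvg_comp _ _ (cvg_comp _ _ (@cvg_fst _ _ _ _ _) (@cvg_snd _ _ _ _ _)) cvg_fst).
have cn : continuous pn.
  by move=> t; apply: (cvg_comp _ _ (cvg_comp _ _ (@cvg_fst _ _ _ _ _) (@cvg_snd _ _ _ _ _)) cvg_snd).
have c1 : continuous p1 by move=> t; apply: (cvg_comp _ _ (@cvg_snd _ _ _ _ _) cvg_fst).
have c2 : continuous p2 by move=> t; apply: (cvg_comp _ _ (@cvg_snd _ _ _ _ _) cvg_snd).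
have cc (a : R) : continuous (fun _ : T => a) by move=> t; exact: cvg_cst.
pose D : set T := [set t | wedge_config K c s (pY t) (pe t) (pf t) (pn t) (p1 t) (p2 t)].
pose J (t : T) := wedge_energy K al be (pY t) (pe t) (pf t) (p1 t) (p2 t).
have [M M0 HM] := compact_bound cK.
have K0 : K !=set0 by case: cfg0 => [_ [[_ _ k0 _] _]]; eexists; exact: k0.
have clK := compact_closed2 cK.
have cD : compact D.
  pose B := M + 3 * M / s + 1.
  have Ms : 0 < 3 * M / s by rewrite divr_gt0 //; lra.
  pose open_square := [set z : plane R | `|z.1| <= B /\ `|z.2| <= B].
  have csq : compact open_square := @compact_square R B.
  apply: (@subclosed_compact _ _ ((open_square `*` open_square) `*` (open_square `*` open_square) `*` open_square)); last first.
  - move=> t; case: t => [[[Y e] [f n]] q] [[e1 f1 ef1 ef2] [[/= q1 q2 K1 K2] [n1 _ _ _]]].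
    rewrite /pe /pf /pY /pn /p1 /p2 /= in e1 f1 ef1 ef2 q1 q2 K1 K2 n1.
    have [ea eb] := unit_bound e1; have [fa fb] := unit_bound f1.
    have [na nb] := unit_bound n1; have [a1 a2] := HM _ K1; have [b1 b2] := HM _ K2.
    have B1 : 1 <= B by rewrite /B; lra.
    (* Each coordinate differs by at most [2 * M]; the resulting [8 * M ^+ 2] is rounded up to a
       square. *)
    have key : dot ((Y + q.2 *: f) - (Y + q.1 *: e)) ((Y + q.2 *: f) - (Y + q.1 *: e)) <= (3 * M) ^+ 2.
      move: a1 a2 b1 b2; set U := Y + q.2 *: f; set V := Y + q.1 *: e; rewrite !ler_norml.
      move=> /andP[? ?] /andP[? ?] /andP[? ?] /andP[? ?].
      have h (u v : R) : - M <= u <= M -> - M <= v <= M -> (u - v) * (u - v) <= 4 * M ^+ 2.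
        by move=> /andP[? ?] /andP[? ?]; nra.
      have h1 : (U.1 - V.1) * (U.1 - V.1) <= 4 * M ^+ 2 by apply: h; apply/andP.
      have h2 : (U.2 - V.2) * (U.2 - V.2) <= 4 * M ^+ 2 by apply: h; apply/andP.
      by apply: le_trans (lerD h1 h2) _; have := sqr_ge0 M; rewrite exprMn; lra.
    have kE : dot ((Y + q.2 *: f) - (Y + q.1 *: e)) ((Y + q.2 *: f) - (Y + q.1 *: e)) =
        q.1 ^+ 2 + q.2 ^+ 2 - 2 * c * q.1 * q.2.
      by rewrite !vecE [dot f e]dotC e1 f1 ef1 [dot e Y]dotC [dot f Y]dotC; ring.
    have sq1 : (s * q.1) ^+ 2 <= (3 * M) ^+ 2.
      apply: le_trans key; rewrite kE -subr_ge0.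
      have -> : q.1 ^+ 2 + q.2 ^+ 2 - 2 * c * q.1 * q.2 - (s * q.1) ^+ 2 =
        (q.2 - c * q.1) ^+ 2 + (1 - (c ^+ 2 + s ^+ 2)) * q.1 ^+ 2 by ring.
      by rewrite cs1 subrr mul0r addr0 sqr_ge0.
    have sq2 : (s * q.2) ^+ 2 <= (3 * M) ^+ 2.
      apply: le_trans key; rewrite kE -subr_ge0.
      have -> : q.1 ^+ 2 + q.2 ^+ 2 - 2 * c * q.1 * q.2 - (s * q.2) ^+ 2 =
        (q.1 - c * q.2) ^+ 2 + (1 - (c ^+ 2 + s ^+ 2)) * q.2 ^+ 2 by ring.
      by rewrite cs1 subrr mul0r addr0 sqr_ge0.
    have g (u : R) : 0 <= u -> (s * u) ^+ 2 <= (3 * M) ^+ 2 -> u <= 3 * M / s.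
      move=> u0; have su : 0 <= s * u by rewrite mulr_ge0 // ltW.
      have m0 : 0 <= 3 * M by lra.
      by rewrite ler_sqr ?nnegrE // ler_pdivlMr // mulrC.
    have g1 := g _ q1 sq1; have g2 := g _ q2 sq2.
    have Yb (u v : R) : `|u + q.1 * v| <= M -> `|v| <= 1 -> `|u| <= B.
      move=> h1 h2; have -> : u = u + q.1 * v - q.1 * v by ring.
      apply: le_trans (ler_normB _ _) _.
      have : `|q.1 * v| <= 3 * M / s.
        rewrite normrM ger0_norm //; apply: le_trans g1; have := normr_ge0 v; nra.
      by move: h1; rewrite /B; clear; lra.
    split; last by rewrite /open_square /= !ger0_norm // /B; split; clear -g1 g2 M0; lra.
    split; split; rewrite /open_square /=.
    - by split; [apply: (Yb _ e.1)|apply: (Yb _ e.2)].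
    - by split; [exact: le_trans ea B1|exact: le_trans eb B1].
    - by split; [exact: le_trans fa B1|exact: le_trans fb B1].
    - by split; [exact: le_trans na B1|exact: le_trans nb B1].
  - by apply: compact_setX => //; apply: compact_setX; exact: compact_setX.
  have -> : D = [set t | dot (pe t) (pe t) = 1] `&` [set t | dot (pf t) (pf t) = 1]
     `&` [set t | dot (pe t) (pf t) = c] `&` [set t | cross (pe t) (pf t) = s]
     `&` [set t | 0 <= p1 t] `&` [set t | 0 <= p2 t]
     `&` [set t | K (pY t + p1 t *: pe t)] `&` [set t | K (pY t + p2 t *: pf t)]
     `&` [set t | dot (pn t) (pn t) = 1]
     `&` [set t | 0 <= dot (pn t) (pe t)] `&` [set t | 0 <= dot (pn t) (pf t)]
     `&` \bigcap_(k in K) [set t | 0 <= dot (pn t) (k - pY t)].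
    apply/seteqP; split => t.
      by move=> [[? ? ? ?] [[? ? ? ?] [? ? ? ?]]]; do !split.
    by move=> [[[[[[[[[[[? ?] ?] ?] ?] ?] ?] ?] ?] ?] ?] ?]; do !split.
  have cKp (p : T -> R) (g : T -> plane R) : continuous p -> continuous g ->
      closed [set t | K (pY t + p t *: g t)].
    move=> cp cg; apply: (@closed_comp _ _ (fun t => pY t + p t *: g t) K) => // t _.
    by apply: cvgD; [exact: cY|apply: cvgZ; [exact: cp|exact: cg]].
  do 11 ?[apply: closedI].
  - by apply: closed_eq2; exact: continuous_dot.
  - by apply: closed_eq2; exact: continuous_dot.
  - by apply: closed_eq2; exact: continuous_dot.
  - by apply: closed_eq2; exact: continuous_cross.
  - exact: closed_le2.
  - exact: closed_le2.
  - exact: cKp.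
  - exact: cKp.
  - by apply: closed_eq2; exact: continuous_dot.
  - by apply: closed_le2 => //; exact: continuous_dot.
  - by apply: closed_le2 => //; exact: continuous_dot.
  apply: closed_bigI => k Kk; apply: closed_le2 => //; apply: continuous_dot => // t.
  by apply: cvgB; [exact: cvg_cst|exact: cY].
have lJ : lsc_on D J.
  have ct (p : T -> R) t (a : R) : continuous p -> p t < a -> \forall u \near t, p u < a.
    exact: near_lt.
  have cgt (p : T -> R) t (a : R) : continuous p -> a < p t -> \forall u \near t, a < p u.
    exact: near_gt.
  have cz (z : plane R) : continuous (fun t => z - pY t).
    by move=> t; apply: cvgB; [exact: cvg_cst|exact: cY].
  apply: lsc_onD; first apply: lsc_onD.
  - apply: lsc_onZ => //; apply: area_lsc_on => [t Dt|t z Dt [Kz /= hz]]; first exact: tame_right.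
    have := ct (fun u => cross (pe u) (z - pY u)) t 0 (continuous_cross ce (cz z)) hz.
    by apply: filterS => u hu; split.
  - apply: lsc_onZ => //; apply: area_lsc_on => [t Dt|t z Dt [Kz /= hz]]; first exact: tame_right.
    have cfN : continuous (fun t => - pf t) by move=> u; apply: cvgN; exact: cf.
    have := ct (fun u => cross (- pf u) (z - pY u)) t 0 (continuous_cross cfN (cz z)) hz.
    by apply: filterS => u hu; split.
  - apply: area_lsc_on => [t [[_ _ _ es] [[q1 q2 _ _] _]]|t z Dt [[h1 h2 h3] nKz]].
      by apply: tame_wtriK => //; rewrite es.
    have ce1 := continuous_cross ce (cz z); have cf1 := continuous_cross cf (cz z).
    have := cgt _ t 0 ce1 h1; have := ct _ t 0 cf1 h2.
    have c3 : continuous (fun u => p1 u * cross (pe u) (z - pY u) - p2 u * cross (pf u) (z - pY u)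
      - p1 u * p2 u * cross (pe u) (pf u)).
      move=> u; apply: cvgB; first apply: cvgB; apply: cvgM; try exact: c1; try exact: c2.
      + exact: ce1.
      + exact: cf1.
      + by apply: cvgM; [exact: c1|exact: c2].
      + exact: (continuous_cross ce cf).
    have := ct _ t 0 c3 (_ : _ < 0); rewrite subr_lt0 => /(_ h3).
    by apply: filterS3 => u a1 a2 a3; split => //; split => //; rewrite -subr_lt0.
have D0 : D !=set0 by exists (((Y0, e0), (f0, n0)), (q10, q20)).
have J0 t : D t -> 0 <= J t.
  move=> _; rewrite /J /wedge_energy; apply: addr_ge0; last exact: area_ge0.
  by apply: addr_ge0; apply: mulr_ge0; rewrite ?area_ge0 //; exact: ltW.
have [t Dt mt] := @compact_lsc_min R T D J cD D0 J0 lJ.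
exists (pY t), (pe t), (pf t), (pn t), (p1 t), (p2 t); split; first exact: Dt.
move=> Y e f n q1 q2 cfg.
exact: (mt (((Y, e), (f, n)), (q1, q2)) cfg).
Qed.
End WedgeExistence.

(** * The triangle outside the body *)

Section FirstOrder.
Variable R : realType.
Implicit Types (e f n Y Q k z : plane R) (K : set (plane R)).

Lemma common_lower_bound2 (a b : R) : 0 < a -> 0 < b -> exists2 d : R, 0 < d & d <= a /\ d <= b.
Proof.
move=> a0 b0; exists (Num.min a b); first by rewrite lt_min a0.
by rewrite !ge_min !lexx orbT.
Qed.

Lemma area_diff (A B : set (plane R)) : tame A -> tame B ->
  area A + area (B `\` A) <= area B + area (A `\` B).
Proof.
move=> tA tB; apply: area_exchange => //.
- by apply: tameD => //; case: tB.
- by apply: tameD => //; case: tA.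
- by move=> z Az; have [Bz|Bz] := pselect (B z); [left|right].
- by apply/seteqP; split => // z [Az [_ /(_ Az)]].
Qed.

Lemma right_eq K Y Y' e : cross e (Y' - Y) = 0 -> right_part K Y' e = right_part K Y e.
Proof.
move=> c0; apply/seteqP; split => z [Kz /= h]; split => //=; move: c0 h; rewrite !vecE; lra.
Qed.

(** In this form the third edge depends only on the points [Y + q1 *: e] and [Y + q2 *: f], so
    turning each side about its point leaves that edge in place. *)
Lemma wtri_side Y e f (q1 q2 : R) z : wtri Y e f q1 q2 z <->
  [/\ 0 < cross e (z - (Y + q1 *: e)), cross f (z - (Y + q2 *: f)) < 0 &
      0 < cross ((Y + q2 *: f) - (Y + q1 *: e)) (z - (Y + q1 *: e))].
Proof.
have -> : cross e (z - (Y + q1 *: e)) = cross e (z - Y) by rewrite !vecE; ring.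
have -> : cross f (z - (Y + q2 *: f)) = cross f (z - Y) by rewrite !vecE; ring.
have -> : cross ((Y + q2 *: f) - (Y + q1 *: e)) (z - (Y + q1 *: e)) =
  q1 * q2 * cross e f - (q1 * cross e (z - Y) - q2 * cross f (z - Y)).
  by rewrite !vecE [cross f e]crossC; rewrite /cross; ring.
split => - [h1 h2 h3]; split => //; lra.
Qed.

Lemma compl_compact_ball K Y : compact K -> ~ K Y -> exists2 d : R, 0 < d &
  forall v, `|v.1| < d -> `|v.2| < d -> ~ K (Y + v).
Proof.
move=> cK nKY; have oK : open (~` K) by apply: closed_openC; exact: compact_closed2.
have /nbhs_ballP[d /= d0 dK] := open_nbhs_nbhs (conj oK nKY).
exists d => // v v1 v2; apply: dK; split => /=; rewrite /ball /=.
  have -> : Y.1 - (Y.1 + v.1) = - v.1 by ring.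
  by rewrite normrN.
have -> : Y.2 - (Y.2 + v.2) = - v.2 by ring.
by rewrite normrN.
Qed.

Lemma compl_compact_line K Y e : compact K -> dot e e = 1 -> ~ K Y -> exists2 d : R, 0 < d &
  forall t : R, `|t| < d -> ~ K (Y + t *: e).
Proof.
move=> cK e1 nKY; have [d d0 H] := compl_compact_ball cK nKY; exists d => // t td.
have [e1b e2b] := unit_bound e1.
apply: H; rewrite /= /GRing.scale /= normrM.
  by have := normr_ge0 t; have := normr_ge0 e.1; nra.
by have := normr_ge0 t; have := normr_ge0 e.2; nra.
Qed.

(** The ray from [Y] through [z] meets the segment joining each pair of points in a point of [K]. If
    [z] were in the first triangle but not in the second, it would lie between these two points of
    [K]. *)
Lemma wtri_indep K Y e f (q1 q2 p1 p2 : R) : convexK K -> 0 < cross e f ->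
  0 <= q1 -> 0 <= q2 -> 0 <= p1 -> 0 <= p2 ->
  K (Y + q1 *: e) -> K (Y + q2 *: f) -> K (Y + p1 *: e) -> K (Y + p2 *: f) ->
  wtri Y e f q1 q2 `\` K `<=` wtri Y e f p1 p2 `\` K.
Proof.
move=> vK ef q10 q20 p10 p20 Kq1 Kq2 Kp1 Kp2 z [tz nKz]; split => //.
have [x [y [zE [x0 y0 xq yq xy]]]] := wtri_coords ef q10 q20 tz.
case: tz => h1 h2 _; split => //; rewrite ltNge; apply/negP => h3; apply: nKz.
have h4 : p1 * p2 <= p2 * x + p1 * y.
  rewrite -(ler_pM2r ef); apply: le_trans h3 _; rewrite zE !vecE [cross f e]crossC.
  by rewrite le_eqVlt; apply/orP; left; apply/eqP; ring.
have q1p : 0 < q1 by lra.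
have q2p : 0 < q2 by lra.
have mE : x / q1 + y / q2 < 1.
  rewrite -(ltr_pM2r (mulr_gt0 q1p q2p)).
  have -> : (x / q1 + y / q2) * (q1 * q2) = q2 * x + q1 * y by field; rewrite !gt_eqF.
  by lra.
have xq0 : 0 < x / q1 by rewrite divr_gt0.
have yq0 : 0 < y / q2 by rewrite divr_gt0.
(* A vanishing [p1] or [p2] puts the apex in [K], and with it the whole first triangle. *)
have KY_z : K Y -> K z.
  move=> KY; apply: (convex3 (a := x / q1) (b := y / q2) (c := 1 - (x / q1 + y / q2)) vK Kq1 Kq2 KY).
  - lra.
  - lra.
  - lra.
  - lra.
  by apply: plane_eq; rewrite zE /= /GRing.scale /=; field; rewrite !gt_eqF.
have [p1z|p1n] := eqVneq p1 0; first by apply: KY_z; rewrite -(addr0 Y) -(scale0r e) -p1z.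
have [p2z|p2n] := eqVneq p2 0; first by apply: KY_z; rewrite -(addr0 Y) -(scale0r f) -p2z.
have p1p : 0 < p1 by rewrite lt_neqAle eq_sym p1n.
have p2p : 0 < p2 by rewrite lt_neqAle eq_sym p2n.
(* The two segments are met at [z - Y] divided by [m] and by [m'], and [m < 1 <= m']. *)
have [m mD] : exists m, m = x / q1 + y / q2 by eexists.
have [m' mD'] : exists m, m = x / p1 + y / p2 by eexists.
have m0 : 0 < m by lra.
have m1 : m < 1 by lra.
have m'1 : 1 <= m'.
  rewrite mD' -(ler_pM2r (mulr_gt0 p1p p2p)).
  have -> : (x / p1 + y / p2) * (p1 * p2) = p2 * x + p1 * y by field; rewrite !gt_eqF.
  by lra.
have Kp : K (Y + (x / m) *: e + (y / m) *: f).
  apply: (convex2 (t := x / q1 / m) vK Kq1 Kq2).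
  - by rewrite divr_ge0 // ltW.
  - by rewrite ler_pdivrMr // mul1r mD; lra.
  - have -> : 1 - x / q1 / m = y / q2 / m.
      by rewrite -[1](divff (lt0r_neq0 m0)) -mulrBl {1}mD; congr (_ / _); ring.
    apply: plane_eq; rewrite /= /GRing.scale /=.
      transitivity ((x / q1 / m + y / q2 / m) * Y.1 + x / m * e.1 + y / m * f.1); last first.
        by field; rewrite !gt_eqF.
      by rewrite -mulrDl -mD divff ?gt_eqF // mul1r.
    transitivity ((x / q1 / m + y / q2 / m) * Y.2 + x / m * e.2 + y / m * f.2); last first.
      by field; rewrite !gt_eqF.
    by rewrite -mulrDl -mD divff ?gt_eqF // mul1r.
have m'0 : 0 < m' by lra.
have Kp' : K (Y + (x / m') *: e + (y / m') *: f).
  apply: (convex2 (t := x / p1 / m') vK Kp1 Kp2).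
  - by rewrite !divr_ge0 // ltW.
  - by have := divr_gt0 y0 p2p; rewrite ler_pdivrMr // mul1r mD'; lra.
  - have -> : 1 - x / p1 / m' = y / p2 / m'.
      by rewrite -[1](divff (lt0r_neq0 m'0)) -mulrBl {1}mD'; congr (_ / _); ring.
    apply: plane_eq; rewrite /= /GRing.scale /=.
      transitivity ((x / p1 / m' + y / p2 / m') * Y.1 + x / m' * e.1 + y / m' * f.1); last first.
        by field; rewrite !gt_eqF.
      by rewrite -mulrDl -mD' divff ?gt_eqF // mul1r.
    transitivity ((x / p1 / m' + y / p2 / m') * Y.2 + x / m' * e.2 + y / m' * f.2); last first.
      by field; rewrite !gt_eqF.
    by rewrite -mulrDl -mD' divff ?gt_eqF // mul1r.
have mm : 0 < m' - m by lra.
apply: (convex2 (t := m * (m' - 1) / (m' - m)) vK Kp Kp').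
- by rewrite divr_ge0 ?mulr_ge0 //; lra.
- by rewrite ler_pdivrMr // mul1r; nra.
- by rewrite zE; apply: plane_eq; rewrite /= /GRing.scale /=; field; rewrite !gt_eqF.
Qed.

Lemma wedge_energy_indep K (al be : R) Y e f (q1 q2 p1 p2 : R) : convexK K -> 0 < cross e f ->
  0 <= q1 -> 0 <= q2 -> 0 <= p1 -> 0 <= p2 ->
  K (Y + q1 *: e) -> K (Y + q2 *: f) -> K (Y + p1 *: e) -> K (Y + p2 *: f) ->
  wedge_energy K al be Y e f q1 q2 = wedge_energy K al be Y e f p1 p2.
Proof.
move=> *; rewrite /wedge_energy; congr (_ + area _).
by apply/seteqP; split; exact: wtri_indep.
Qed.

End FirstOrder.

(** * Parallel shifts of a side *)

Section WedgeMin.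
Variable R : realType.
Implicit Types (e f n Y Q k z : plane R) (K : set (plane R)).
Variables (K : set (plane R)) (al be c s : R).

Definition outer_config Y e f (q1 q2 : R) :=
  [/\ dot e e = 1, dot f f = 1, dot e f = c & cross e f = s] /\
  [/\ 0 <= q1, 0 <= q2, K (Y + q1 *: e) & K (Y + q2 *: f)] /\ ~ K Y.

(** Competitors are only asked to have their apex outside [K], so the variations below have no
    supporting normal to carry along. *)
Definition outer_min Y e f (q1 q2 : R) := outer_config Y e f q1 q2 /\
  forall Y' e' f' p1 p2, outer_config Y' e' f' p1 p2 ->
    wedge_energy K al be Y e f q1 q2 <= wedge_energy K al be Y' e' f' p1 p2.

End WedgeMin.

Section WedgeMin1.
Variable R : realType.
Implicit Types (e f n Y Q k z : plane R) (K : set (plane R)).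

Lemma circle_snd_le1 (c s : R) : c ^+ 2 + s ^+ 2 = 1 -> 0 < s -> s <= 1.
Proof.
move=> cs1 s0.
by rewrite -(@ler_sqr _ s 1) ?nnegrE ?ler01 ?expr1n ?(ltW s0) // -cs1 lerDr sqr_ge0.
Qed.

Lemma circle_fst_le1 (c s : R) : c ^+ 2 + s ^+ 2 = 1 -> `|c| <= 1.
Proof.
move=> cs1.
by rewrite -(@ler_sqr _ `|c| 1) ?nnegrE ?ler01 ?expr1n // real_normK ?num_real // -cs1 lerDl sqr_ge0.
Qed.

Lemma outer_config_pos K (c s : R) Y e f (q1 q2 r1 r2 : R) : convexK K -> outer_config K c s Y e f q1 q2 -> chord K Y e r1 r2 ->
  [/\ 0 < q1, 0 < q2 & 0 < r1].
Proof.
move=> vK [[e1 _ _ _] [[q10 q20 K1 K2] nKY]] cY.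
have g (q : R) (v : plane R) : 0 <= q -> K (Y + q *: v) -> 0 < q.
  move=> q0 Kq; rewrite lt_neqAle q0 andbT; apply/eqP => q0'; apply: nKY.
  by rewrite -q0' scale0r addr0 in Kq.
split; [exact: g K1|exact: g K2|].
rewrite ltNge; apply/negP => r10; apply: nKY; rewrite -(addr0 Y) -(scale0r e).
apply: (chord_convex vK cY r10); apply: le_trans q10 _.
case: cY => _ _ _ H; have := H _ K1.
by rewrite !vecE e1 mulr0 !addr0 addrC => /(_ (addNr _)); lra.
Qed.

(** The apex moves along [f], which pushes the first side inwards by [t * s] and fixes the line of
    the second. The first cap gains at most about [t * s * (r2 - r1)] and the triangle outside [K]
    loses about [t * s * r1]. *)
Lemma wedge_shift_up K (al be c s : R) Y e f (q1 q2 r1 r2 : R) : compact K -> convexK K ->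
  c ^+ 2 + s ^+ 2 = 1 -> 0 < s -> 0 < al -> outer_min K al be c s Y e f q1 q2 -> chord K Y e r1 r2 ->
  r1 <= al * (r2 - r1).
Proof.
move=> cK vK cs1 s0 al0 [base wm] cY; have s1 := circle_snd_le1 cs1 s0; have c1 := circle_fst_le1 cs1.
 have [q1p q2p r1p] := outer_config_pos vK base cY.
have [[e1 f1 ef1 ef2] [[q10 q20 K1 K2] nKY]] := base.
have [Kr1 Kr2 r12 _] := cY.
rewrite leNgt; apply/negP => lt1.
(* With this margin [al * (r2 - r1 + 2 * h) - (r1 - 3 * h)], the bound for the change of energy per
   unit of shift, equals [- 3 * h]. *)
have [h hE] : exists h : R, h = (r1 - al * (r2 - r1)) / (2 * al + 6) by eexists.
have al6 : 0 < 2 * al + 6 by lra.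
have h0 : 0 < h by rewrite hE divr_gt0 // subr_gt0.
have hh : 2 * al * h + 6 * h = r1 - al * (r2 - r1).
  by rewrite -mulrDl mulrC hE divfK // gt_eqF.
have aL : 0 <= al * (r2 - r1) by rewrite mulr_ge0 ?subr_ge0 // ltW.
have ah : 0 < al * h by rewrite mulr_gt0.
have [d1 d10 H1] := right_shift_up cK e1 cY h0.
have [k k0 H2] := chord_thicken cK cY h0.
have [d2 d20 H3] := compl_compact_line cK f1 nKY.
have qh : 0 < q2 * h / r1 by rewrite divr_gt0 // mulr_gt0.
have [t1 t10 [a1 a2]] := common_lower_bound2 d10 k0.
have d22 : 0 < d2 / 2 by rewrite divr_gt0. have q22 : 0 < q2 / 2 by rewrite divr_gt0.
have [t2 t20 [a3 a4]] := common_lower_bound2 d22 q22.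
have [t3 t30 [a5 a6]] := common_lower_bound2 h0 qh.
have [t4 t40 [a7 a8]] := common_lower_bound2 t10 t20.
have [t t0 [a9 a10]] := common_lower_bound2 t40 t30.
have ts : t * s <= t by rewrite ler_piMr // ltW.
have tr : t * r1 <= q2 * h.
  rewrite -ler_pdivlMr //; clear -a6 a10; lra.
have ts0 : 0 < t * s by rewrite mulr_gt0.
pose Y' := Y + t *: f.
have u0 : 0 < t / q2 by rewrite divr_gt0.
have u1 : t / q2 <= 1 / 2.
  by rewrite ler_pdivrMr //; clear -a4 a8 a9; lra.
(* The shifted side meets the segment from [Y + r1 *: e] to [Y + q2 *: f] at the fraction [u]; this
   is its point of [K] in the new configuration. *)
have [u uE] : exists u : R, u = t / q2 by eexists.
have uq : u * q2 = t by rewrite uE divfK // gt_eqF.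
rewrite -uE in u0 u1.
have base' : outer_config K c s Y' e f ((1 - u) * r1) (q2 - t).
  split => //; split; last by apply: H3; rewrite gtr0_norm //; clear -a3 a8 a9 d20; lra.
  have u1' : 0 <= 1 - u by clear -u1; lra.
  split; [by rewrite mulr_ge0 // ltW|by clear -a4 a8 a9 q2p; lra| |].
    apply: (convex2 (t := u) vK K2 Kr1); [exact: ltW|by clear -u1; lra|].
    by apply: plane_eq; rewrite /Y' -uq /= /GRing.scale /=; ring.
  suff -> : Y' + (q2 - t) *: f = Y + q2 *: f by [].
  by apply: plane_eq; rewrite /Y' /= /GRing.scale /=; ring.
have := wm _ _ _ _ _ base'.
have ef0 : 0 < cross e f by rewrite ef2.
rewrite (wedge_energy_indep al be vK ef0 q10 q20 (ltW r1p) q20 K1 K2 Kr1 K2).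
rewrite /wedge_energy.
have -> : right_part K Y' (- f) = right_part K Y (- f).
  by apply: right_eq; rewrite /Y' !vecE; ring.
have G1 : area (right_part K Y' e) <= area (right_part K Y e) + t * s * (r2 - r1 + 2 * h).
  by apply: H1; [exact: ltW|by clear -ts a1 a7 a9; lra|rewrite /Y' !vecE ef2; ring].
set A := wtri Y' _ _ _ _ `\` K; set B := wtri Y e f r1 q2 `\` K.
(* The part that the triangle is sure to lose: a rectangle along the side in the gap between [Y] and
   [K], kept clear of both by the margin. *)
pose D := frame e Y @^-1` obox h (r1 - 2 * h) 0 (t * s).
have tD : tame D by apply: tame_frame => //; exact: tame_obox.
have aD : area D = (r1 - 3 * h) * (t * s).
  rewrite area_frame ?area_obox //; [ring|by clear -hh aL ah h0; lra|exact: ltW|].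
  by case: (tame_obox h (r1 - 2 * h) 0 (t * s)).
have tB : tame B by apply: tame_wtriK => //; exact: ltW.
have tA : tame A.
  apply: tame_wtriK => //; [by rewrite mulr_ge0 //; [clear -u1; lra|exact: ltW]|by clear -a4 a8 a9 q2p; lra].
have ceE z : cross e (z - Y') = cross e (z - Y) - t * s by rewrite /Y' !vecE ef2; ring.
have cfE z : cross f (z - Y') = cross f (z - Y) by rewrite /Y' !vecE; ring.
have G2 : area A + area D <= area B + area set0.
  apply: area_exchange => //; first exact: tame0.
  - move=> z [[z1 z2 z3] nKz]; left; split => //.
    rewrite ceE in z1 z3; rewrite cfE in z2 z3; rewrite ef2 in z3.
    split => //; first by clear -z1 ts0; lra.
    rewrite ef2 -(@ltr_pM2l _ (1 - u)); last by clear -u1; lra.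
    have -> : (1 - u) * (r1 * q2 * s) = (1 - u) * r1 * (q2 - t) * s + (1 - u) * r1 * (t * s) by ring.
    have : q2 - t = (1 - u) * q2 by rewrite -uq; ring.
    by move=> qt; rewrite qt in z3 *; clear -z3; lra.
  - move=> z [/= /andP[z1 z2] /andP[z3 z4]].
    have [x xE] : exists x : R, x = dot e (z - Y) by eexists.
    have [y yE] : exists y : R, y = cross e (z - Y) by eexists.
    rewrite -xE -yE in z1 z2 z3 z4.
    have cf : cross f (z - Y) = c * y - s * x by rewrite (cross_rot f (z - Y) e1) ef1 ef2 xE yE.
    have cy : `|c * y| <= t * s.
      by rewrite normrM (gtr0_norm z3); apply: le_trans (ltW z4); rewrite ler_piMl // ltW.
    move: cy; rewrite ler_norml => /andP[cy1 cy2].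
    have sx : s * h < s * x by rewrite ltr_pM2l.
    have th : t * s <= s * h by rewrite mulrC ler_pM2l //; clear -a5 a10; lra.
    split.
      split; rewrite -?yE ?cf //; first by clear -cy2 th sx; lra.
      rewrite ef2.
      have x2 : s * x < s * (r1 - 2 * h) by rewrite ltr_pM2l.
      have p1 : q2 * (s * x) < q2 * (s * (r1 - 2 * h)) by rewrite ltr_pM2l.
      have p2 : r1 * y < r1 * (t * s) by rewrite ltr_pM2l.
      have p3 : t * r1 * s <= q2 * h * s by rewrite ler_pM2r.
      have p4 : q2 * - (t * s) <= q2 * (c * y) by rewrite ler_pM2l.
      have p5 : q2 * (t * s) <= q2 * (s * h) by rewrite ler_pM2l.
      by clear -p1 p2 p3 p4 p5; lra.
    move=> Kz; have := H2 z Kz; rewrite -yE -xE gtr0_norm // => /(_ _)/andP[]; first by clear -z4 ts a2 a7 a9; lra.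
    by move=> h1 _; clear -h1 z2 h0; lra.
  - by apply/seteqP; split => // z [[[z1 _ _] _] [/= _ /andP[_ z4]]]; rewrite ceE in z1; clear -z1 z4; lra.
have a0 : area (set0 : set (plane R)) = 0 by rewrite /area measure0.
rewrite a0 aD in G2.
have G1' : al * area (right_part K Y' e) <= al * (area (right_part K Y e) + t * s * (r2 - r1 + 2 * h)).
  by rewrite ler_pM2l.
have key : t * s * (al * (r2 - r1 + 2 * h) - (r1 - 3 * h)) < 0.
  by rewrite pmulr_rlt0 //; clear -hh h0; lra.
have fin (x x' y b a : R) : al * x + y + b <= al * x' + y + a ->
    al * x' <= al * (x + t * s * (r2 - r1 + 2 * h)) ->
    a + (r1 - 3 * h) * (t * s) <= b + 0 -> False.
  by clear -key => h1 h2 h3; lra.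
by move=> Hm; exact: fin Hm G1' G2.
Qed.

End WedgeMin1.

Section WedgeMin2.
Variable R : realType.
Implicit Types (e f n Y Q k z : plane R) (K : set (plane R)).

Lemma common_lower_bound (l : seq R) : all (fun x => 0 < x) l ->
  exists2 m : R, 0 < m & all (fun x => m <= x) l.
Proof.
elim: l => [_|x l IH /= /andP[x0 /IH[m m0 ml]]]; first by exists 1.
exists (Num.min x m); first by rewrite lt_min x0.
rewrite /= ge_min lexx /=; apply: sub_all ml => y /= my.
by rewrite ge_min my orbT.
Qed.

(** The reverse move: the first side recedes by [t * s], its cap loses about that times the chord,
    and the triangle outside [K] gains at most about [t * s * r1]. The point [k] is what forces the
    cap to lose area. *)
Lemma wedge_shift_down K (al be c s : R) Y e f (q1 q2 r1 r2 : R) k :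
  compact K -> convexK K -> c ^+ 2 + s ^+ 2 = 1 -> 0 < s -> 0 < al ->
  outer_min K al be c s Y e f q1 q2 ->
  chord K Y e r1 r2 -> K k -> cross e (k - Y) < 0 -> al * (r2 - r1) <= r1.
Proof.
move=> cK vK cs1 s0 al0 [base wm] cY Kk ck.
have s1 := circle_snd_le1 cs1 s0; have c1 := circle_fst_le1 cs1.
have [q1p q2p r1p] := outer_config_pos vK base cY.
have [[e1 f1 ef1 ef2] [[q10 q20 K1 K2] nKY]] := base.
have [Kr1 Kr2 r12 _] := cY.
rewrite leNgt; apply/negP => lt1.
have L0 : 0 < r2 - r1 by rewrite -(pmulr_rgt0 _ al0); clear -lt1 r1p; lra.
have al6 : 0 < 2 * al + 6 by clear -al0; lra.
have hh0 : 0 < (al * (r2 - r1) - r1) / (2 * al + 6) by rewrite divr_gt0 // subr_gt0.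
have [h h0 [hL hh]] := common_lower_bound2 L0 hh0.
rewrite ler_pdivlMr // in hh.
have [d dE] : exists d : R, d = - cross e (k - Y) by eexists.
have [x0 xE] : exists x0 : R, x0 = dot e (k - Y) by eexists.
have d0 : 0 < d by clear -dE ck; lra.
have [r rE] : exists r : R, r = r1 + h by eexists.
have Kr : K (Y + r *: e) by apply: (chord_convex vK cY); clear -rE h0 hL; lra.
have [d1 d10 H1] := right_shift_down cK vK e1 cY Kk ck h0.
have [d2 d20 H3] := compl_compact_line cK f1 nKY.
have [N NE] : exists N : R, N = `|x0 - r| * s / d + 1 by eexists.
have N1 : 1 <= N by rewrite NE lerDr divr_ge0 // ?mulr_ge0 // ltW.
have N2 : 0 < 2 * N by clear -N1; lra.
have r14 : 0 < 4 * r1 by clear -r1p; lra.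
have /common_lower_bound[t t0] : all (fun x => 0 < x)
    [:: d1; d2 / 2; d; h; h / (2 * N); q2 * h / (4 * r1)].
  have qh : 0 < q2 * h by rewrite mulr_gt0.
  by rewrite /= d10 h0 d0 !divr_gt0.
rewrite /= => /andP[t1 /andP[t2 /andP[t3 /andP[t4 /andP[t5 /andP[t6 _]]]]]].
rewrite ler_pdivlMr // in t5; rewrite ler_pdivlMr // in t6.
have ts : t * s <= t by rewrite ler_piMr // ltW.
have ts0 : 0 < t * s by rewrite mulr_gt0.
pose Y' := Y + (- t) *: f.
have [u uE] : exists u : R, u = t * s / d by eexists.
have ud : u * d = t * s by rewrite uE divfK // gt_eqF.
have u0 : 0 < u by rewrite uE divr_gt0.
have u1 : u <= 1 by rewrite uE ler_pdivrMr // mul1r; clear -ts t3; lra.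
have [p1 p1E] : exists p1 : R, p1 = r + u * (x0 - r) + t * c by eexists.
have p1r : `|p1 - r| <= t * N.
  rewrite p1E NE.
  have -> : t * (`|x0 - r| * s / d + 1) = t * (`|x0 - r| * s / d) + t by ring.
  have -> : r + u * (x0 - r) + t * c - r = u * (x0 - r) + t * c by ring.
  apply: le_trans (ler_normD _ _) _; apply: lerD.
    rewrite normrM (gtr0_norm u0) uE.
    by rewrite le_eqVlt; apply/orP; left; apply/eqP; field; rewrite gt_eqF.
  by rewrite normrM (gtr0_norm t0) ler_piMr // ltW.
move: p1r; rewrite ler_norml => /andP[p1a p1b].
have p1lo : r1 + h / 2 <= p1 by clear -p1a t5 rE; lra.
have p1hi : p1 <= r1 + 2 * h by clear -p1b t5 rE h0; lra.
have p1p : 0 < p1 by clear -p1lo h0 r1p; lra.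
have KQ : K (Y' + p1 *: e).
  apply: (convex2 (t := u) vK Kk Kr); [exact: ltW|exact: u1|].
  have kx : dot e k = x0 + dot e Y by move: xE; rewrite !vecE; clear; lra.
  have ky : cross e k = - d + cross e Y by move: dE; rewrite !vecE; clear; lra.
  apply: (unit_eq e1); rewrite /Y' !vecE ?e1 ?kx ?ky ?ef1 ?ef2.
    by rewrite p1E; ring.
  by transitivity (cross e Y - u * d); [rewrite ud|]; ring.
have base' : outer_config K c s Y' e f p1 (q2 + t).
  split => //; split; last by apply: H3; rewrite normrN gtr0_norm //; clear -t2 d20; lra.
  split; [exact: ltW|by clear -q20 t0; lra|exact: KQ|].
  suff -> : Y' + (q2 + t) *: f = Y + q2 *: f by [].
  by apply: plane_eq; rewrite /Y' /= /GRing.scale /=; ring.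
have := wm _ _ _ _ _ base'.
have ef0 : 0 < cross e f by rewrite ef2.
rewrite (wedge_energy_indep al be vK ef0 q10 q20 (ltW r1p) q20 K1 K2 Kr1 K2) /wedge_energy.
have -> : right_part K Y' (- f) = right_part K Y (- f).
  by apply: right_eq; rewrite /Y' !vecE; ring.
have G1 : area (right_part K Y' e) + t * s * (r2 - r1 - 2 * h) <= area (right_part K Y e).
  by apply: H1; [exact: ltW|by clear -ts t1; lra|rewrite /Y' !vecE ef2; ring].
set A := wtri Y' _ _ _ _ `\` K; set B := wtri Y e f r1 q2 `\` K.
have tB : tame B by apply: tame_wtriK => //; exact: ltW.
have q2t : 0 <= q2 + t by clear -q20 t0; lra.
have tA : tame A by apply: tame_wtriK => //; exact: ltW.
have cfE z : cross f (z - Y') = cross f (z - Y) by rewrite /Y' !vecE; ring.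
have tC : tame (A `\` B) by apply: tameD => //; case: tB.
have G2 : area A <= area B + area (A `\` B).
  apply: area_subU => // z Az.
  by have [Bz|Bz] := pselect (B z); [left|right].
have G3 : area (A `\` B) <= (r1 + 3 * h - (- h)) * (0 - (- (t * s))).
  apply: (@area_le_rect R e Y) => //.
  - by clear -r1p h0; lra.
  - by clear -ts0; lra.
  move=> z [[tz nKz] nBz].
  have [x [y' [zE [xp yp xq yq xy]]]] := wtri_coords ef0 (ltW p1p) q2t tz.
  have ce : cross e (z - Y) = (y' - t) * s by rewrite zE /Y' !vecE ef2; ring.
  have cf : cross f (z - Y) = - (x * s).
    by rewrite zE /Y' !vecE [cross f e]crossC ef2; ring.
  have de : dot e (z - Y) = x + (y' - t) * c by rewrite zE /Y' !vecE ef1 e1; ring.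
  have [yt|yt] := lerP y' t.
    have yt1 : `|(y' - t) * c| <= t.
      rewrite normrM; apply: (@le_trans _ _ `|y' - t|); first by rewrite ler_piMr.
      by rewrite ler_norml; clear -yp yt t0; apply/andP; split; lra.
    move: yt1; rewrite ler_norml => /andP[yt1 yt2].
    have ce1 : (y' - t) * s <= 0 by rewrite pmulr_lle0 // subr_le0.
    have ce2 : 0 <= y' * s by rewrite mulr_ge0 // ltW.
    rewrite de ce; split; apply/andP; split.
    - by clear -yt1 xp t4; lra.
    - by clear -yt2 xq t4 p1hi; lra.
    - by clear -ce2; lra.
    - exact: ce1.
  (* Inside the old side, a point of the new triangle that the old one misses lies in the triangle
     of the three points of [K] at [r1], [q2] and [p1], hence in [K]. *)
  exfalso; apply: nBz; split => //.
  have [y yE] : exists y, y = y' - t by eexists.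
  have y0 : 0 < y by rewrite yE subr_gt0.
  rewrite -yE in ce.
  split.
  - by rewrite ce mulr_gt0.
  - by rewrite cf oppr_lt0 mulr_gt0.
  rewrite ltNge; apply/negP => h3; apply: nKz.
  have h4 : r1 * q2 <= r1 * y + q2 * x.
    rewrite -(ler_pM2r s0); move: h3; rewrite ce cf ef2; clear; lra.
  have h5 : (q2 + t) * x + p1 * (y + t) < p1 * (q2 + t).
    by rewrite yE; clear -xy; lra.
  (* [g] and [g1] measure how far [z] and the point at [p1] are beyond the line through the other
     two points; the ratio [w] is the barycentric weight of the point at [p1]. *)
  have [g gE] : exists g, g = x / r1 + y / q2 - 1 by eexists.
  have [g1 g1E] : exists g, g = p1 / r1 - t / q2 - 1 by eexists.
  have g0 : 0 <= g.
    rewrite gE subr_ge0 -(ler_pM2r (mulr_gt0 r1p q2p)) mul1r.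
    have -> : (x / r1 + y / q2) * (r1 * q2) = r1 * y + q2 * x by field; rewrite !gt_eqF.
    exact: h4.
  have g10 : 0 < g1.
    rewrite g1E -(pmulr_lgt0 _ (mulr_gt0 r1p q2p)).
    have -> : (p1 / r1 - t / q2 - 1) * (r1 * q2) = p1 * q2 - t * r1 - r1 * q2.
      by field; rewrite !gt_eqF.
    have p1q : (r1 + h / 2) * q2 <= p1 * q2 by rewrite ler_pM2r.
    have hq : 0 < h * q2 by rewrite mulr_gt0.
    by clear -p1q hq t6; lra.
  have [w wE] : exists w, w = g / g1 by eexists.
  have wg : w * g1 = g by rewrite wE divfK // gt_eqF.
  have w0 : 0 <= w by rewrite wE divr_ge0 // ltW.
  have [b bE] : exists b, b = (y + w * t) / q2 by eexists.
  have bq : b * q2 = y + w * t by rewrite bE divfK // gt_eqF.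
  have b0 : 0 <= b.
    by rewrite bE divr_ge0 // ?(ltW q2p) // addr_ge0 ?(ltW y0) // mulr_ge0 // ltW.
  have aE : (1 - b - w) * r1 = x - w * p1.
    have e1' : w * (p1 / r1 - t / q2 - 1) = x / r1 + y / q2 - 1 by rewrite -g1E -gE.
    have e2' : w * p1 = (w * (p1 / r1 - t / q2 - 1) + w * (t / q2) + w) * r1.
      by field; rewrite !gt_eqF.
    rewrite e2' e1' bE; field; by rewrite !gt_eqF.
  have a0 : 0 <= 1 - b - w.
    rewrite -(pmulr_lge0 _ r1p) aE subr_ge0 -(ler_pM2r g10).
    have -> : w * p1 * g1 = g * p1 by rewrite -wg; ring.
    rewrite gE g1E -(ler_pM2r (mulr_gt0 r1p q2p)).
    have -> : (x / r1 + y / q2 - 1) * p1 * (r1 * q2) = p1 * (q2 * x + r1 * y - r1 * q2).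
      by field; rewrite !gt_eqF.
    have -> : x * (p1 / r1 - t / q2 - 1) * (r1 * q2) = x * (p1 * q2 - t * r1 - r1 * q2).
      by field; rewrite !gt_eqF.
    have h6 : r1 * ((q2 + t) * x + p1 * (y + t)) <= r1 * (p1 * (q2 + t)).
      by rewrite ler_pM2l // ltW.
    by clear -h6; lra.
  apply: (convex3 (a := 1 - b - w) (b := b) (c := w) vK Kr1 K2 KQ a0 b0 w0); first by ring.
  rewrite zE /Y'; apply: plane_eq; rewrite /= /GRing.scale /=.
    transitivity (Y.1 + ((1 - b - w) * r1 + w * p1) * e.1 + (b * q2 - w * t) * f.1); last by ring.
    by rewrite aE bq yE; ring.
  transitivity (Y.2 + ((1 - b - w) * r1 + w * p1) * e.2 + (b * q2 - w * t) * f.2); last by ring.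
  by rewrite aE bq yE; ring.
have key : 0 < t * s * (al * (r2 - r1 - 2 * h) - (r1 + 4 * h)).
  by rewrite pmulr_rgt0 //; clear -hh h0; lra.
have G1' : al * (area (right_part K Y' e) + t * s * (r2 - r1 - 2 * h)) <= al * area (right_part K Y e).
  by rewrite ler_pM2l.
have fin (x x' y b a d3 : R) : al * x + y + b <= al * x' + y + a ->
    al * (x' + t * s * (r2 - r1 - 2 * h)) <= al * x ->
    a <= b + d3 -> d3 <= (r1 + 3 * h - (- h)) * (0 - (- (t * s))) -> False.
  by clear -key => h1 h2 h3 h4; lra.
by move=> Hm; exact: fin Hm G1' G2 G3.
Qed.

End WedgeMin2.

(** * Rotation of both sides *)

Section WedgeRot.
Variable R : realType.
Implicit Types (e f n Y Q k z : plane R) (K : set (plane R)).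

Definition quarter (v : plane R) : plane R := (- v.2, v.1).

Lemma chord_opp K Y e (r1 r2 : R) : chord K Y e r1 r2 -> chord K Y (- e) (- r2) (- r1).
Proof.
move=> [K1 K2 r12 H]; split; rewrite ?scaleNr ?scalerN ?opprK //; first by rewrite lerN2.
by move=> z Kz; rewrite crossNl dotNl => c0; have := H z Kz; clear -c0; lra.
Qed.

(** [C] is the cosine of the angle of tangent [m]; parametrising turns by the tangent keeps them
    algebraic. *)
Lemma turn_exists (m : R) : exists2 C : R, 0 < C & C ^+ 2 * (1 + m ^+ 2) = 1.
Proof.
have h : 0 < 1 + m ^+ 2 by rewrite ltr_pwDl // sqr_ge0.
exists (Num.sqrt (1 + m ^+ 2))^-1; first by rewrite invr_gt0 sqrtr_gt0.
by rewrite exprVn sqr_sqrtr ?(ltW h) // mulVf // gt_eqF.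
Qed.

(** Both sides turn counterclockwise by the same small angle, the first about [Y + q *: e], the
    second about [Y + q' *: f], so the wedge keeps its angle. Per unit of angle, twice the first cap
    grows by at most [(r2 - q) ^+ 2] and twice the second by [(q' - r4) ^+ 2]. Twice the triangle
    outside [K] gains at most [q ^+ 2] and loses at least [q' ^+ 2 - (q' - r4) ^+ 2]. The weighted
    sum is the expression that minimality makes nonnegative. *)
Lemma wedge_rot_bound K (al be c s : R) Y e f (q1 q2 r1 r2 r3 r4 q q' : R) :
  compact K -> convexK K -> c ^+ 2 + s ^+ 2 = 1 -> 0 < s -> 0 < al -> 0 < be ->
  outer_min K al be c s Y e f q1 q2 ->
  chord K Y e r1 r2 -> chord K Y f r4 r3 ->
  r1 <= q -> q <= r2 -> r4 <= q' -> q' <= r3 ->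
  0 <= al * (r2 - q) ^+ 2 + q ^+ 2 + (be + 1) * (q' - r4) ^+ 2 - q' ^+ 2.
Proof.
move=> cK vK cs1 s0 al0 be0 [base wm] cY cY2 rq1 rq2 rq3 rq4.
have s1 := circle_snd_le1 cs1 s0; have c1 := circle_fst_le1 cs1.
have [q1p q2p r1p] := outer_config_pos vK base cY.
have [[e1 f1 ef1 ef2] [[q10 q20 K1 K2] nKY]] := base.
have r4p : 0 < r4.
  rewrite ltNge; apply/negP => r40; apply: nKY; rewrite -(addr0 Y) -(scale0r f).
  apply: (chord_convex vK cY2 r40); apply: le_trans q20 _.
  case: cY2 => _ _ _ H; have := H _ K2.
  by rewrite !vecE f1 mulr0 !addr0 addrC => /(_ (addNr _)); clear; lra.
have q0 : 0 < q by clear -r1p rq1; lra.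
have q'0 : 0 < q' by clear -r4p rq3; lra.
have Kq : K (Y + q *: e) by exact: (chord_convex vK cY).
have Kq' : K (Y + q' *: f) by exact: (chord_convex vK cY2).
rewrite leNgt; apply/negP; set X := (X in X < 0) => X0.
(* For [h <= 1] the margins add at most [h * W] to [X], so the choice [2 * h * W <= - X] keeps the
   sum negative. *)
have [W WE] : exists W : R, W = 2 * (al * (r2 - q) + be * (q' - r4) + q + q' + (q' - r4))
    + al + be + 1 by eexists.
have W0 : 0 < W.
  have a1 : 0 <= al * (r2 - q) by rewrite mulr_ge0 ?subr_ge0 // ltW.
  have a2 : 0 <= be * (q' - r4) by rewrite mulr_ge0 ?subr_ge0 // ltW.
  by rewrite WE; clear -a1 a2 q0 q'0 rq3 al0 be0; lra.
have W2 : 0 < 2 * W by clear -W0; lra.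
have /common_lower_bound[h h0] : all (fun x => 0 < x) [:: 1; - X / (2 * W); r4 / 2].
  by rewrite /= ltr01 !divr_gt0 // oppr_gt0.
rewrite /= => /andP[h1 /andP[h2 /andP[h3 _]]].
rewrite ler_pdivlMr // in h2.
have Ph : al * (r2 - q + h) ^+ 2 + be * (q' - r4 + h) ^+ 2 + (q + h) ^+ 2
    - ((q' - h) ^+ 2 - (q' - r4 + h) ^+ 2) < 0.
  have hh : h ^+ 2 <= h by rewrite expr2 ler_piMr // ltW.
  have ab : (al + be + 1) * h ^+ 2 <= (al + be + 1) * h.
    by rewrite ler_wpM2l //; clear -al0 be0; lra.
  have -> : al * (r2 - q + h) ^+ 2 + be * (q' - r4 + h) ^+ 2 + (q + h) ^+ 2
    - ((q' - h) ^+ 2 - (q' - r4 + h) ^+ 2) =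
    X + h * (2 * (al * (r2 - q) + be * (q' - r4) + q + q' + (q' - r4))) + (al + be + 1) * h ^+ 2.
    by rewrite /X; ring.
  have hW : h * W = h * (2 * (al * (r2 - q) + be * (q' - r4) + q + q' + (q' - r4)))
    + (al + be + 1) * h by rewrite WE; ring.
  by move: X0 h2; clearbody X; clear -ab hW; lra.
have cN := chord_opp cY2.
have fN1 : dot (- f) (- f) = 1 by rewrite !vecE opprK.
have rq3' : - q' <= - r4 by rewrite lerN2.
have [k1 k10 H1] := right_rot cK e1 cY rq2 h0.
have [k2 k20 H2] := right_rot cK fN1 cN rq3' h0.
have [k3 k30 H3] := chord_thicken cK cY2 h0.
have [rho rho0 H4] := compl_compact_ball cK nKY.
have [N NE] : exists N : R, N = (q + q') / s by eexists.
have N0 : 0 < N by rewrite NE divr_gt0 // addr_gt0.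
have Ns : N * s = q + q' by rewrite NE divfK // gt_eqF.
have N2 : 0 < 2 * N by clear -N0; lra.
have qN4 : 0 < 4 * (q + N) by clear -q0 N0; lra.
have q16 : 0 < 16 * q by clear -q0; lra.
have hs : 0 < h * s by rewrite mulr_gt0.
have sh : 0 < s * h by rewrite mulr_gt0.
have /common_lower_bound[m m0] : all (fun x => 0 < x) [:: 1; k1; k2; k3 / q'; rho / (4 * (q + N));
   q / (2 * N); q' / (2 * N); h / (2 * N); h * s / (16 * q); s / 2; s * h / q'].
  by rewrite /= ltr01 k10 k20 !divr_gt0.
rewrite /= => /andP[m1 /andP[mk1 /andP[mk2 /andP[mk3 /andP[mrho /andP[mq /andP[mq']]]]]]].
move=> /andP[mh /andP[mhs /andP[ms /andP[msh _]]]].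
rewrite ler_pdivlMr // in mk3; rewrite ler_pdivlMr // in mrho; rewrite ler_pdivlMr // in mq.
rewrite ler_pdivlMr // in mq'; rewrite ler_pdivlMr // in mh; rewrite ler_pdivlMr // in mhs.
rewrite ler_pdivlMr // in msh.
have [C C0 C1] := turn_exists m.
have Cle : C <= 1.
  rewrite -(@ler_sqr _ C 1) ?nnegrE ?ler01 ?expr1n ?(ltW C0) // -C1 ler_peMr ?sqr_ge0 //.
  by rewrite lerDl sqr_ge0.
(* The distances [p] and [p'] from the new apex to the pivots have derivatives [- nu] and [nu'] in
   [m] at 0. *)
have [nu nuE] : exists nu : R, nu = (q' - q * c) / s by eexists.
have [nu' nuE'] : exists nu : R, nu = (q - q' * c) / s by eexists.
have nus : nu * s = q' - q * c by rewrite nuE divfK // gt_eqF.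
have nus' : nu' * s = q - q' * c by rewrite nuE' divfK // gt_eqF.
move: (c1); rewrite ler_norml => /andP[ca cb].
have qc1 : - q <= q * c by rewrite -mulrN1 ler_pM2l.
have qc2 : q * c <= q by rewrite ler_piMr // ltW.
have qc3 : - q' <= q' * c by rewrite -mulrN1 ler_pM2l.
have qc4 : q' * c <= q' by rewrite ler_piMr // ltW.
have nuN : `|nu| <= N.
  by rewrite ler_norml; apply/andP; split; rewrite -(ler_pM2r s0) ?mulNr nus Ns;
    clear -qc1 qc2 qc3 qc4 q0 q'0; lra.
have nuN' : `|nu'| <= N.
  by rewrite ler_norml; apply/andP; split; rewrite -(ler_pM2r s0) ?mulNr nus' Ns;
    clear -qc1 qc2 qc3 qc4 q0 q'0; lra.
have mnu : `|m * nu| <= m * N by rewrite normrM (gtr0_norm m0) ler_pM2l.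
have mnu' : `|m * nu'| <= m * N by rewrite normrM (gtr0_norm m0) ler_pM2l.
move: mnu mnu'; rewrite !ler_norml => /andP[mnu1 mnu2] /andP[mnu3 mnu4].
have [p pE] : exists p : R, p = C * (q - m * nu) by eexists.
have [p' pE'] : exists p : R, p = C * (q' + m * nu') by eexists.
have p0 : 0 < p by rewrite pE mulr_gt0 //; clear -mq mnu2 q0; lra.
have p'0 : 0 < p' by rewrite pE' mulr_gt0 //; clear -mq' mnu3 q'0; lra.
have [e' eE] : exists e', e' = C *: e + (m * C) *: quarter e by eexists.
have [f' fE] : exists f', f' = C *: f + (m * C) *: quarter f by eexists.
have rotd u v : dot (C *: u + (m * C) *: quarter u) (C *: v + (m * C) *: quarter v) = dot u v.
  rewrite -[RHS]mul1r -C1 /dot /quarter /= /GRing.scale /=; ring.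
have rotc u v : cross (C *: u + (m * C) *: quarter u) (C *: v + (m * C) *: quarter v) = cross u v.
  rewrite -[RHS]mul1r -C1 /cross /quarter /= /GRing.scale /=; ring.
have dee' : dot e e' = C.
  by rewrite eE -[RHS]mulr1 -e1 /dot /quarter /= /GRing.scale /=; ring.
have cee' : cross e e' = m * C.
  by rewrite eE -[RHS]mulr1 -e1 /cross /dot /quarter /= /GRing.scale /=; ring.
have dff' : dot f f' = C.
  by rewrite fE -[RHS]mulr1 -f1 /dot /quarter /= /GRing.scale /=; ring.
have cff' : cross f f' = m * C.
  by rewrite fE -[RHS]mulr1 -f1 /cross /dot /quarter /= /GRing.scale /=; ring.
have cef' : cross e f' = C * (s + m * c).
  by rewrite fE -ef1 -ef2 /cross /dot /quarter /= /GRing.scale /=; ring.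
have def' : dot e f' = C * (c - m * s).
  by rewrite fE -ef1 -ef2 /cross /dot /quarter /= /GRing.scale /=; ring.
pose Q1 := Y + q *: e. pose Q2 := Y + q' *: f.
pose Y' := Q1 - p *: e'.
have YQ2 : Y' + p' *: f' = Q2.
  apply: (unit_eq e1).
    rewrite /Y' /Q1 /Q2 !vecE dee' def' ef1 e1 pE pE'.
    transitivity (dot e Y + q * 1 + C ^+ 2 * (q' * c - q - m * (q' * s) + m * (nu + nu' * c - m * (nu' * s)))).
      by ring.
    have h7 : nu + nu' * c = q' * s.
      apply: (mulIf (lt0r_neq0 s0)); rewrite mulrDl nus -mulrA [c * s]mulrC mulrA nus'.
      transitivity (q' * (1 - c ^+ 2)); first by ring.
      by rewrite -cs1; ring.
    rewrite h7 nus'.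
    transitivity (dot e Y + q * 1 + C ^+ 2 * (1 + m ^+ 2) * (q' * c - q)); first by ring.
    by rewrite C1; ring.
  rewrite /Y' /Q1 /Q2 !vecE cee' cef' ef2 pE pE'.
  transitivity (cross e Y + C ^+ 2 * (q' * s + m * (nu' * s + q' * c - q + m * (nu + nu' * c)))).
    by ring.
  have h7 : nu + nu' * c = q' * s.
    apply: (mulIf (lt0r_neq0 s0)); rewrite mulrDl nus -mulrA [c * s]mulrC mulrA nus'.
    transitivity (q' * (1 - c ^+ 2)); first by ring.
    by rewrite -cs1; ring.
  rewrite h7 nus'.
  transitivity (cross e Y + C ^+ 2 * (1 + m ^+ 2) * (q' * s)); first by ring.
  by rewrite C1; ring.
have YQ1 : Y' + p *: e' = Q1 by rewrite /Y' subrK.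
have mNN : m * N <= N by rewrite ler_piMl // ltW.
have C2 : C ^+ 2 <= 1 by rewrite expr_le1 // ltW.
have C20 : 0 <= C ^+ 2 by rewrite sqr_ge0.
have mm : m ^+ 2 <= m by rewrite expr2 ler_piMr // ltW.
have v1 : `|q - p * C| <= m * (q + N).
  have -> : q - p * C = C ^+ 2 * (m ^+ 2 * q + m * nu).
    transitivity (C ^+ 2 * (1 + m ^+ 2) * q - p * C); first by rewrite C1 mul1r.
    by rewrite pE; ring.
  have mq2 : m ^+ 2 * q <= m * q by rewrite ler_pM2r.
  have mq20 : 0 <= m ^+ 2 * q by rewrite mulr_ge0 ?sqr_ge0 // ltW.
  rewrite normrM (ger0_norm C20); apply: (@le_trans _ _ `|m ^+ 2 * q + m * nu|).
    by rewrite ler_piMl.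
  by rewrite ler_norml; clear -mq2 mq20 mnu1 mnu2 m0 q0; apply/andP; split; lra.
have v2 : `|p * (m * C)| <= m * (q + N).
  have -> : p * (m * C) = C ^+ 2 * (m * (q - m * nu)) by rewrite pE; ring.
  rewrite normrM (ger0_norm C20); apply: (@le_trans _ _ `|m * (q - m * nu)|).
    by rewrite ler_piMl.
  rewrite normrM (gtr0_norm m0) ler_pM2l // ler_norml.
  by clear -mnu1 mnu2 mNN q0 N0; apply/andP; split; lra.
have nKY' : ~ K Y'.
  have [eb1 eb2] := unit_bound e1.
  have -> : Y' = Y + (q *: e - p *: e') by rewrite /Y' /Q1 addrA.
  have hb (a b u v : R) : `|a| <= m * (q + N) -> `|b| <= m * (q + N) -> `|u| <= 1 -> `|v| <= 1 ->
      `|a * u + b * v| < rho.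
    move=> ha hb hu hv; apply: le_lt_trans (ler_normD _ _) _; rewrite !normrM.
    have x1 : `|a| * `|u| <= m * (q + N) by apply: le_trans ha; rewrite ler_piMr.
    have x2 : `|b| * `|v| <= m * (q + N) by apply: le_trans hb; rewrite ler_piMr.
    by clear -x1 x2 mrho rho0; lra.
  apply: H4; rewrite eE /quarter /= /GRing.scale /=.
    have -> : q * e.1 - p * (C * e.1 + m * C * - e.2) = (q - p * C) * e.1 + p * (m * C) * e.2 by ring.
    exact: hb.
  have -> : q * e.2 - p * (C * e.2 + m * C * e.1) = (q - p * C) * e.2 + (- (p * (m * C))) * e.1 by ring.
  by apply: hb => //; rewrite normrN.
have base' : outer_config K c s Y' e' f' p p'.
  split; first by rewrite eE fE !rotd rotc.
  by split => //; split; [exact: ltW|exact: ltW|rewrite YQ1|rewrite YQ2].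
have := wm _ _ _ _ _ base'.
have ef0 : 0 < cross e f by rewrite ef2.
rewrite (wedge_energy_indep al be vK ef0 q10 q20 (ltW q0) (ltW q'0) K1 K2 Kq Kq') /wedge_energy.
have G1 : 2 * area (right_part K Y' e') <= 2 * area (right_part K Y e) + m * (r2 - q + h) ^+ 2.
  have -> : right_part K Y' e' = right_part K Q1 e'.
    by apply: right_eq; rewrite /Y' !vecE; ring.
  by apply: H1; rewrite ?dee' ?cee' //; exact: ltW.
have G1' : 2 * area (right_part K Y' (- f')) <= 2 * area (right_part K Y (- f)) + m * (q' - r4 + h) ^+ 2.
  have -> : right_part K Y' (- f') = right_part K (Y + (- q') *: (- f)) (- f').
    apply: right_eq; have -> : Y + (- q') *: (- f) = Y' + p' *: f'.
      by rewrite YQ2 /Q2 scaleNr scalerN opprK.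
    by rewrite !vecE; ring.
  have -> : q' - r4 + h = - r4 - - q' + h by ring.
  apply: H2; rewrite ?dotNl ?dotNr ?crossNl ?crossNr ?opprK ?dff' ?cff' //; exact: ltW.
set A := wtri Y' e' f' p p' `\` K; set B := wtri Y e f q q' `\` K.
have cef0' : 0 < cross e' f' by rewrite eE fE rotc ef2.
have tA : tame A by apply: tame_wtriK => //; exact: ltW.
have tB : tame B by apply: tame_wtriK => //; exact: ltW.
have mA : measurable (A : set (R * R)) by case: tA.
have mB : measurable (B : set (R * R)) by case: tB.
have G2 := area_diff tA tB.
have ce'E w : cross e' w = C * (cross e w - m * dot e w).
  by rewrite (cross_rot e' w e1) dee' cee'; ring.
have cf'E w : cross f' w = C * (cross f w - m * dot f w).
  by rewrite (cross_rot f' w f1) dff' cff'; ring.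
have ceF w : cross e w = c * cross f w + s * dot f w.
  by rewrite (cross_rot e w f1) [dot f e]dotC [cross f e]crossC ef1 ef2; ring.
have cD z : cross (Q2 - Q1) (z - Q1) = q' * cross f (z - Q2) - q * cross e (z - Q2).
  by rewrite /Q1 /Q2 !vecE [cross f e]crossC; ring.
have mqs : (q' + q) * m <= q * s / 2.
  have : m * (2 * N) * s <= q * s by rewrite ler_pM2r.
  by have -> : m * (2 * N) * s = 2 * m * (N * s) by [ring]; rewrite Ns; clear; lra.
have qs0 : 0 < q * s by rewrite mulr_gt0.
(* What the triangle gains lies beyond the old first side, in a thin sector at [Q1] directed towards
   the old apex. *)
have G3 : 2 * area (A `\` B) <= m * (q + h) ^+ 2.
  apply: (@area_le_tri R (- e) Q1) => //; first by rewrite !vecE opprK.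
  - exact: tameD.
  - by clear -q0 h0; lra.
  - exact: ltW.
  move=> z [[tz nKz] nBz].
  have [a1 a2 a3] : [/\ 0 < cross e' (z - Q1), cross f' (z - Q2) < 0 &
      0 < cross (Q2 - Q1) (z - Q1)] by move: tz => /wtri_side; rewrite YQ1 YQ2.
  rewrite ce'E pmulr_rgt0 // in a1; rewrite cf'E pmulr_rlt0 // in a2.
  have ce0 : cross e (z - Q1) <= 0.
    rewrite leNgt; apply/negP => ce0; apply: nBz; split => //; apply/wtri_side; split => //.
    rewrite -/Q2 ltNge; apply/negP => cf0.
    rewrite cD ceF in a3.
    have x1 : 0 < dot f (z - Q2) by rewrite -(pmulr_rgt0 _ m0); clear -a2 cf0; lra.
    have x2 : q * s * dot f (z - Q2) <= (q' + q) * cross f (z - Q2).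
      have x3 : - q * cross f (z - Q2) <= q * c * cross f (z - Q2) by rewrite ler_wpM2r.
      by clear -x3 a3; lra.
    have x4 : (q' + q) * cross f (z - Q2) <= (q' + q) * (m * dot f (z - Q2)).
      by rewrite ler_pM2l ?addr_gt0 //; clear -a2; lra.
    have x5 : (q' + q) * m * dot f (z - Q2) <= q * s / 2 * dot f (z - Q2) by rewrite ler_pM2r.
    have x6 : 0 < q * s * dot f (z - Q2) by rewrite mulr_gt0.
    by clear -x2 x4 x5 x6; lra.
  have [x [y [zE [xp yp xq yq xy]]]] := wtri_coords cef0' (ltW p0) (ltW p'0) tz.
  have zQ1 : z - Q1 = (x - p) *: e' + y *: f'.
    rewrite zE -YQ1; apply: plane_eq; rewrite /= /GRing.scale /=; ring.
  have y1 : y * (s + m * c) <= p * m.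
    have : cross e (z - Q1) <= 0 := ce0.
    rewrite zQ1 !vecE cee' cef'.
    have -> : (x - p) * (m * C) + y * (C * (s + m * c)) = C * ((x - p) * m + y * (s + m * c)) by ring.
    rewrite pmulr_rle0 // => x1; have x2 : 0 <= x * m by rewrite mulr_ge0 // ltW.
    by clear -x1 x2; lra.
  have pqN : p <= q + m * N.
    rewrite pE; apply: (@le_trans _ _ (q - m * nu)).
      by rewrite ler_piMl //; clear -mq mnu2 q0; lra.
    by clear -mnu1; lra.
  have y2 : y <= 4 * q * m / s.
    have mc : - m <= m * c by rewrite -mulrN1 ler_pM2l.
    have y3 : y * (s / 2) <= y * (s + m * c) by rewrite ler_pM2l //; clear -mc ms; lra.
    have y4 : p * m <= 2 * q * m by rewrite ler_pM2r //; clear -pqN mq q0; lra.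
    by rewrite ler_pdivlMr //; clear -y1 y3 y4; lra.
  have y5 : y <= h / 4.
    apply: le_trans y2 _; rewrite ler_pdivrMr //; clear -mhs; lra.
  have de2 : `|dot e f'| <= 2.
    rewrite def' normrM (gtr0_norm C0).
    have x1 : `|c - m * s| <= 2.
      have x1 : m * s <= 1 by rewrite mulr_ile1 // ltW.
      have x2 : 0 <= m * s by rewrite mulr_ge0 // ltW.
      by rewrite ler_norml; clear -x1 x2 ca cb; apply/andP; split; lra.
    by apply: le_trans x1; rewrite ler_piMl.
  have dey : `|y * dot e f'| <= h / 2.
    rewrite normrM (gtr0_norm yp); apply: (@le_trans _ _ (y * 2)); first by rewrite ler_pM2l.
    by clear -y5; lra.
  move: dey; rewrite ler_norml => /andP[dey1 dey2].
  have deq : - dot e (z - Q1) <= q + h.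
    rewrite zQ1 !vecE dee'.
    have x1 : (p - x) * C <= p.
      apply: (@le_trans _ _ (p - x)); first by rewrite ler_piMr // subr_ge0 ltW.
      by clear -xp; lra.
    by clear -x1 dey1 pqN mh; lra.
  have de0 : dot e (z - Q1) <= 0 by rewrite -(pmulr_rle0 _ m0); clear -a1 ce0; lra.
  rewrite dotNl crossNl; split; apply/andP; split => //.
  - by rewrite oppr_ge0.
  - by rewrite oppr_ge0.
  - by clear -a1; lra.
(* What it loses contains a piece of the thin sector at [Q2] along the second side, from the end of
   [K] almost to the old apex. *)
have G4 : m * ((q' - h) ^+ 2 - (q' - r4 + h) ^+ 2) <= 2 * area (B `\` A).
  apply: (@area_ge_trap R (- f) Q2) => //.
  - exact: tameD.
  - by clear -rq3 h0; lra.
  - by clear -h3; lra.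
  - exact: ltW.
  move=> z; rewrite dotNl crossNl => /andP[w1 w2] /andP[w3 w4].
  have [u uE] : exists u : R, u = - dot f (z - Q2) by eexists.
  have [g gE] : exists g : R, g = - cross f (z - Q2) by eexists.
  have uE' : dot f (z - Q2) = - u by rewrite uE opprK.
  have gE' : cross f (z - Q2) = - g by rewrite gE opprK.
  rewrite -uE in w1 w2; rewrite -gE -uE in w3 w4.
  have u0 : 0 < u by clear -w1 rq3 h0; lra.
  have gm : g <= m * q'.
    by apply: le_trans (ltW w4) _; rewrite ler_pM2l //; clear -w2 h0; lra.
  have cfY : cross f (z - Y) = - g by rewrite -gE' /Q2 !vecE; ring.
  have dfY : dot f (z - Y) = q' - u by move: uE'; rewrite /Q2 !vecE f1; clear; lra.
  have cg1 : c * g <= g by rewrite ler_piMl // ltW.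
  have cg2 : - g <= c * g by rewrite -mulN1r ler_pM2r.
  have nKz : ~ K z.
    move=> Kz; have := H3 z Kz; rewrite cfY normrN gtr0_norm // => /(_ _)/andP[].
      by clear -gm mk3; lra.
    by rewrite dfY => x1 _; clear -x1 w1; lra.
  split.
    split => //; apply/wtri_side; rewrite -/Q1 -/Q2; split.
    - have -> : cross e (z - Q1) = cross e (z - Y) by rewrite /Q1 !vecE; ring.
      rewrite ceF cfY dfY.
      have x1 : s * h < s * (q' - u) by rewrite ltr_pM2l //; clear -w2; lra.
      by clear -x1 cg1 gm msh; lra.
    - by rewrite gE' oppr_lt0.
    - rewrite cD ceF gE' uE'.
      have x1 : (q' + q) * g <= (q' + q) * (m * u).
        by rewrite ler_pM2l ?addr_gt0 // ltW.
      have x2 : (q' + q) * m * u <= q * s / 2 * u by rewrite ler_pM2r.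
      have x3 : 0 < q * s * u by rewrite mulr_gt0.
      have x4 : q * - g <= q * (c * g) by rewrite ler_pM2l.
      by clear -x1 x2 x3 x4; lra.
  move=> [/wtri_side[_ a2 _] _]; move: a2; rewrite YQ2 cf'E pmulr_rlt0 // gE' uE'.
  by clear -w4; lra.
have Pm : m * (al * (r2 - q + h) ^+ 2 + be * (q' - r4 + h) ^+ 2 + (q + h) ^+ 2
    - ((q' - h) ^+ 2 - (q' - r4 + h) ^+ 2)) < 0 by rewrite pmulr_rlt0.
have fin (x x' y y' b a d1 d2 : R) : al * x + be * y + b <= al * x' + be * y' + a ->
    al * (2 * x') <= al * (2 * x + m * (r2 - q + h) ^+ 2) ->
    be * (2 * y') <= be * (2 * y + m * (q' - r4 + h) ^+ 2) ->
    a + d2 <= b + d1 -> 2 * d1 <= m * (q + h) ^+ 2 ->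
    m * ((q' - h) ^+ 2 - (q' - r4 + h) ^+ 2) <= 2 * d2 -> False.
  by clear -Pm => h4 h5 h6 h7 h8 h9; lra.
move=> Hm; apply: fin Hm _ _ G2 G3 G4; by rewrite ler_pM2l.
Qed.

End WedgeRot.

Arguments conj2 {R} z.

(** * Reflection, and the four points on a minimal wedge *)

Section Mirror.
Variable R : realType.
Implicit Types (e f n u v Y Q k z : plane R) (K U : set (plane R)).

Lemma conj2K : involutive (@conj2 R).
Proof. by move=> [x y]; rewrite /conj2 /= opprK. Qed.

Lemma conj2D u v : conj2 (u + v) = conj2 u + conj2 v.
Proof. by apply: plane_eq; rewrite //= opprD. Qed.

Lemma conj2N u : conj2 (- u) = - conj2 u.
Proof. by apply: plane_eq. Qed.

Lemma conj2Z (a : R) u : conj2 (a *: u) = a *: conj2 u.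
Proof. by apply: plane_eq; rewrite /= /GRing.scale //= mulrN. Qed.

Lemma dot_conj2 u v : dot (conj2 u) (conj2 v) = dot u v.
Proof. by rewrite /dot /=; ring. Qed.

Lemma cross_conj2 u v : cross (conj2 u) (conj2 v) = - cross u v.
Proof. by rewrite /cross /=; ring. Qed.

Lemma conj2_continuous : continuous (@conj2 R).
Proof.
move=> z.
have c1 : (fun y : plane R => y.1) @ z --> z.1 by exact: cvg_fst.
have c2 : (fun y : plane R => - y.2) @ z --> - z.2 by apply: cvgN; exact: cvg_snd.
exact: (cvg_pair c1 c2).
Qed.

(** A reflection exchanges the two sides of a wedge together with their weights, so estimates for
    the first side also serve the second. *)
Definition conjK K : set (plane R) := conj2 @^-1` K.

Lemma conjK_compact K : compact K -> compact (conjK K).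
Proof.
move=> cK; have -> : conjK K = (@conj2 R) @` K.
  apply/seteqP; split => z; first by move=> Kz; exists (conj2 z) => //; exact: conj2K.
  by move=> [k Kk <-]; rewrite /conjK /= conj2K.
by apply: continuous_compact => //; apply: continuous_subspaceT; exact: conj2_continuous.
Qed.

Lemma conjK_convex K : convexK K -> convexK (conjK K).
Proof. by move=> vK x y t Kx Ky t0 t1; rewrite /conjK /= conj2D !conj2Z; exact: vK. Qed.

Lemma conjK_open U : open U -> open (conjK U).
Proof. by move=> oU; apply: open_comp => // z _; exact: conj2_continuous. Qed.

Lemma right_part_mirror K Y e :
  right_part (conjK K) (conj2 Y) (conj2 e) = conj2 @^-1` right_part K Y (- e).
Proof.
have h z : cross (conj2 e) (z - conj2 Y) = cross (- e) (conj2 z - Y).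
  by rewrite -{1}(conj2K z) -conj2N -conj2D cross_conj2 crossNl.
by apply/seteqP; split => z [Kz /= hz]; split => //=; [rewrite -h|rewrite h].
Qed.

Lemma wtri_mirror Y e f (q1 q2 : R) :
  wtri (conj2 Y) (conj2 f) (conj2 e) q2 q1 = conj2 @^-1` wtri Y e f q1 q2.
Proof.
have h v z : cross (conj2 v) (z - conj2 Y) = - cross v (conj2 z - Y).
  by rewrite -{1}(conj2K z) -conj2N -conj2D cross_conj2.
apply/seteqP; split => z; rewrite /wtri /= !h cross_conj2 [cross f e]crossC => -[h1 h2 h3].
  by split; [lra|lra|clear -h3; lra].
by split; [lra|lra|clear -h3; lra].
Qed.

Lemma wedge_energy_mirror K (al be : R) Y e f (q1 q2 : R) : compact K ->
  0 < cross e f -> 0 <= q1 -> 0 <= q2 ->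
  wedge_energy (conjK K) be al (conj2 Y) (conj2 f) (conj2 e) q2 q1 = wedge_energy K al be Y e f q1 q2.
Proof.
move=> cK ef q10 q20; rewrite /wedge_energy -conj2N !right_part_mirror opprK wtri_mirror.
have -> : conj2 @^-1` wtri Y e f q1 q2 `\` conjK K = conj2 @^-1` (wtri Y e f q1 q2 `\` K) by [].
rewrite !area_conj; first by move: (area _) (area _) (area _) => x y z; clear; ring.
- by case: (tame_wtriK Y cK ef q10 q20).
- by case: (tame_right Y e cK).
- by case: (tame_right Y (- f) cK).
Qed.

Lemma outer_config_mirror K (c s : R) Y e f (q1 q2 : R) : outer_config K c s Y e f q1 q2 ->
  outer_config (conjK K) c s (conj2 Y) (conj2 f) (conj2 e) q2 q1.
Proof.
move=> [[e1 f1 ef1 ef2] [[q10 q20 K1 K2] nKY]]; split; last split; last by rewrite /conjK /= conj2K.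
  by rewrite !dot_conj2 cross_conj2 [dot f e]dotC [cross f e]crossC opprK.
by split => //; rewrite /conjK /= conj2D conj2Z !conj2K.
Qed.

Lemma conjKK K : conjK (conjK K) = K.
Proof. by apply/seteqP; split => z; rewrite /conjK /= conj2K. Qed.

Lemma outer_min_mirror K (al be c s : R) Y e f (q1 q2 : R) : compact K -> 0 < s ->
  outer_min K al be c s Y e f q1 q2 ->
  outer_min (conjK K) be al c s (conj2 Y) (conj2 f) (conj2 e) q2 q1.
Proof.
move=> cK s0 [base wm]; split; first exact: outer_config_mirror.
move=> Y' e' f' p1 p2 base'; have := outer_config_mirror base'; rewrite conjKK => base2.
have := wm _ _ _ _ _ base2.
have [[_ _ _ ef2] [[q10 q20 _ _] _]] := base; have [[_ _ _ ef2'] [[p10 p20 _ _] _]] := base2.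
have E1 : wedge_energy (conjK K) be al (conj2 Y) (conj2 f) (conj2 e) q2 q1 = wedge_energy K al be Y e f q1 q2.
  by apply: wedge_energy_mirror => //; rewrite ef2.
have ef0 : 0 < cross (conj2 f') (conj2 e') by rewrite ef2'.
have E2 := @wedge_energy_mirror K al be (conj2 Y') (conj2 f') (conj2 e') p2 p1 cK ef0 p10 p20.
by rewrite !conj2K in E2; rewrite E1 E2.
Qed.

Lemma chord_mirror K Y e (r1 r2 : R) : chord K Y e r1 r2 ->
  chord (conjK K) (conj2 Y) (conj2 e) r1 r2.
Proof.
move=> [K1 K2 r12 H]; split => //; rewrite /conjK /= ?conj2D ?conj2Z ?conj2K //.
move=> z Kz; rewrite -{1 2 3}(conj2K z) -conj2N -conj2D cross_conj2 dot_conj2 => /eqP.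
by rewrite oppr_eq0 => /eqP; exact: H.
Qed.

(** From a point of the open set [U] one can move a little, within [K], along the line in both
    directions and off it to both sides. *)
Lemma notin_open_end U K Y e (r1 r2 r : R) : dot e e = 1 -> open U -> U `<=` K ->
  chord K Y e r1 r2 -> (r = r1 \/ r = r2) \/ (forall k, K k -> 0 <= cross e (k - Y)) ->
  ~ U (Y + r *: e).
Proof.
move=> e1 oU UK [_ _ _ H] hr Ur.
have /nbhs_ballP[d /= d0 dU] := open_nbhs_nbhs (conj oU Ur).
have [b1 b2] := unit_bound e1.
have step (a b : R) (v : plane R) : `|a| < d -> `|v.1| <= 1 -> `|v.2| <= 1 -> U (Y + r *: e + a *: v).
  move=> ad v1 v2; apply: dU; split; rewrite /ball /=.
    have -> : Y.1 + r *: e.1 - (Y.1 + r *: e.1 + a *: v.1) = - (a * v.1) by rewrite /GRing.scale /=; ring.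
    by rewrite normrN normrM; apply: le_lt_trans ad; rewrite ler_piMr.
  have -> : Y.2 + r *: e.2 - (Y.2 + r *: e.2 + a *: v.2) = - (a * v.2) by rewrite /GRing.scale /=; ring.
  by rewrite normrN normrM; apply: le_lt_trans ad; rewrite ler_piMr.
have d2 : `|d / 2| < d by rewrite gtr0_norm ?divr_gt0 //; lra.
have d2' : `|- (d / 2)| < d by rewrite normrN.
have E (a : R) : Y + r *: e + a *: e - Y = (r + a) *: e.
  by apply: plane_eq; rewrite /= /GRing.scale /=; ring.
case: hr => [[rE|rE]|hk].
- have := H _ (UK _ (step _ 0 _ d2' b1 b2)); rewrite E !vecE e1 mulr0 rE => /(_ erefl).
  by move=> /andP[? ?]; lra.
- have := H _ (UK _ (step _ 0 _ d2 b1 b2)); rewrite E !vecE e1 mulr0 rE => /(_ erefl).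
  by move=> /andP[? ?]; lra.
- have b3 : `|(quarter e).1| <= 1 by rewrite /= normrN.
  have := hk _ (UK _ (step _ 0 _ d2' b3 b1)).
  have -> : cross e (Y + r *: e + - (d / 2) *: quarter e - Y) = - (d / 2).
    by rewrite -[RHS]mulr1 -e1 /cross /dot /quarter /= /GRing.scale /=; ring.
  by lra.
Qed.

(** [x] is the prescribed product. Two distances of product [x], in the ratio [1 + al] to [al], both
    fall on the chord when the two inequalities on [x] hold. If [K] passes beyond the side, the two
    shifts together force them to be the ends of the chord; otherwise [K] lies on one side of the
    line and the whole chord avoids [U]. *)
Lemma wedge_side K U (al be c s : R) Y e f (q1 q2 r1 r2 : R) x :
  compact K -> convexK K -> open U -> U `<=` K ->
  c ^+ 2 + s ^+ 2 = 1 -> 0 < s -> 0 < al -> outer_min K al be c s Y e f q1 q2 ->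
  chord K Y e r1 r2 -> 0 < x ->
  (1 + al) * r1 ^+ 2 <= al * x -> (1 + al) * x <= al * r2 ^+ 2 ->
  exists x1 x2 : R, [/\ 0 < x1, al * (x2 - x1) = x1, x1 * x2 = x &
    [/\ K (Y + x1 *: e), ~ U (Y + x1 *: e), K (Y + x2 *: e) & ~ U (Y + x2 *: e)]].
Proof.
move=> cK vK oU UK cs1 s0 al0 wm cY x0 h1 h2.
have [base _] := wm; have [[e1 _ _ _] _] := base; have [_ _ r1p] := outer_config_pos vK base cY.
have r2p : 0 < r2 by case: cY => _ _; lra.
have al1 : 0 < 1 + al by lra.
pose x1 := Num.sqrt (x * al / (1 + al)).
have x1p : 0 < x1 by rewrite sqrtr_gt0 divr_gt0 // mulr_gt0.
have x1E : x1 ^+ 2 = x * al / (1 + al) by rewrite sqr_sqrtr // ltW // divr_gt0 // mulr_gt0.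
have [x2 x2E] : exists x2 : R, x2 = x1 * (1 + al) / al by eexists.
have x2p : 0 < x2 by rewrite x2E divr_gt0 // mulr_gt0.
have x12 : al * x2 = (1 + al) * x1 by rewrite x2E; field; rewrite gt_eqF.
have xx : x1 * x2 = x.
  rewrite x2E; transitivity (x1 ^+ 2 * (1 + al) / al); first by ring.
  by rewrite x1E; field; rewrite !gt_eqF.
have rx1 : r1 <= x1.
  rewrite -(@ler_sqr _ r1 x1) ?nnegrE ?(ltW r1p) ?(ltW x1p) // x1E ler_pdivlMr //.
  by rewrite mulrC; move: h1; rewrite [al * x]mulrC.
have rx2 : x2 <= r2.
  rewrite -(@ler_sqr _ x2 r2) ?nnegrE ?(ltW r2p) ?(ltW x2p) // -(ler_pM2l al0).
  have -> : al * x2 ^+ 2 = (al * x2) * x2 by ring.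
  by rewrite x12 -mulrA xx.
have x1x2 : x1 <= x2.
  by rewrite -(ler_pM2l al0) x12; have := mulr_gt0 al1 x1p; clear -x1p; lra.
exists x1, x2; split => //; first by rewrite mulrBr x12; ring.
have K1 : K (Y + x1 *: e) by apply: (chord_convex vK cY) => //; lra.
have K2 : K (Y + x2 *: e) by apply: (chord_convex vK cY) => //; lra.
have [[k [Kk ck]]|nk] := pselect (exists k, K k /\ cross e (k - Y) < 0); last first.
  have hk k : K k -> 0 <= cross e (k - Y).
    by move=> Kk; rewrite leNgt; apply/negP => ck; apply: nk; exists k.
  by split => //; apply: (notin_open_end e1 oU UK cY); right.
have sd := wedge_shift_down cK vK cs1 s0 al0 wm cY Kk ck.
have rr : al * r2 <= (1 + al) * r1 by lra.
have xx1 : x1 = r1.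
  apply/eqP; rewrite eq_le rx1 andbT -(ler_pM2l al1) -x12.
  by apply: le_trans rr; rewrite ler_pM2l.
have xx2 : x2 = r2.
  apply/eqP; rewrite eq_le rx2 /= -(ler_pM2l al0) x12; apply: le_trans rr _.
  by rewrite ler_pM2l.
by split => //; apply: (notin_open_end e1 oU UK cY); left; [left|right].
Qed.

(** Each side admits an interval of products. Turning the wedge, and its mirror image, shows that
    the lower end for either side is at most the upper end for the other, so the intervals meet. *)
Lemma wedge_interior K U (al be c s : R) Y e f (q1 q2 : R) :
  compact K -> convexK K -> open U -> U `<=` K ->
  c ^+ 2 + s ^+ 2 = 1 -> 0 < s -> 0 < al -> 0 < be -> outer_min K al be c s Y e f q1 q2 ->
  exists x1 x2 x3 x4 : R, [/\ 0 < x1, 0 < x4, al * (x2 - x1) = x1, be * (x3 - x4) = x4 &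
    [/\ x1 * x2 = x4 * x3, (K `\` U) (Y + x1 *: e), (K `\` U) (Y + x2 *: e),
      (K `\` U) (Y + x3 *: f) & (K `\` U) (Y + x4 *: f)]].
Proof.
move=> cK vK oU UK cs1 s0 al0 be0 wm.
have wm' := outer_min_mirror cK s0 wm.
have [base _] := wm; have [base' _] := wm'.
have [[e1 f1 ef1 ef2] [[q10 q20 K1 K2] nKY]] := base.
have [r1 [r2 cY]] : exists r1 r2, chord K Y e r1 r2.
  by apply: (chord_ex cK e1 K1); rewrite !vecE; ring.
have [r4 [r3 cY2]] : exists r4 r3, chord K Y f r4 r3.
  by apply: (chord_ex cK f1 K2); rewrite !vecE; ring.
have cY' := chord_mirror cY2. have cY2' := chord_mirror cY.
have cK' := conjK_compact cK; have vK' := conjK_convex vK; have oU' := conjK_open oU.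
have UK' : conjK U `<=` conjK K by move=> z; exact: UK.
have [_ _ r1p] := outer_config_pos vK base cY; have [_ _ r4p] := outer_config_pos vK' base' cY'.
have s1 := wedge_shift_up cK vK cs1 s0 al0 wm cY.
have s2 := wedge_shift_up cK' vK' cs1 s0 be0 wm' cY'.
have al1 : 0 < 1 + al by lra.
have be1 : 0 < 1 + be by lra.
have r2p : 0 < r2 by case: cY => _ _ ? _; lra.
have r3p : 0 < r3 by case: cY2 => _ _ ? _; lra.
(* [q] and [q'] minimise [al * (r2 - q) ^+ 2 + q ^+ 2] and [(be + 1) * (q' - r4) ^+ 2 - q' ^+ 2],
   the two halves of the rotation bound; [p] and [p'] play these roles in the mirror image. *)
have [q qE] : exists q : R, q = al * r2 / (1 + al) by eexists.
have qq : q * (1 + al) = al * r2 by rewrite qE divfK // gt_eqF.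
have [p pE] : exists q : R, q = be * r3 / (1 + be) by eexists.
have pp : p * (1 + be) = be * r3 by rewrite pE divfK // gt_eqF.
have [q' qE'] : exists q' : R, q' = (1 + be) * r4 / be by eexists.
have qq' : be * q' = (1 + be) * r4 by rewrite qE' mulrC divfK // gt_eqF.
have [p' pE'] : exists q' : R, q' = (1 + al) * r1 / al by eexists.
have pp' : al * p' = (1 + al) * r1 by rewrite pE' mulrC divfK // gt_eqF.
have q_lo : r1 <= q by rewrite -(ler_pM2r al1) qq; clear -s1; lra.
have q_hi : q <= r2 by rewrite -(ler_pM2r al1) qq; clear -r2p; lra.
have p_lo : r4 <= p by rewrite -(ler_pM2r be1) pp; clear -s2; lra.
have p_hi : p <= r3 by rewrite -(ler_pM2r be1) pp; clear -r3p; lra.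
have q'_lo : r4 <= q' by rewrite -(ler_pM2l be0) qq'; clear -r4p; lra.
have q'_hi : q' <= r3 by rewrite -(ler_pM2l be0) qq'; clear -s2; lra.
have p'_lo : r1 <= p' by rewrite -(ler_pM2l al0) pp'; clear -r1p; lra.
have p'_hi : p' <= r2 by rewrite -(ler_pM2l al0) pp'; clear -s1; lra.
have R1 := wedge_rot_bound cK vK cs1 s0 al0 be0 wm cY cY2 q_lo q_hi q'_lo q'_hi.
have R2 := wedge_rot_bound cK' vK' cs1 s0 be0 al0 wm' cY' cY2' p_lo p_hi p'_lo p'_hi.
have X1 : (1 + be) * r4 ^+ 2 / be <= al * r2 ^+ 2 / (1 + al).
  rewrite -subr_ge0; move: R1; congr (0 <= _).
  by rewrite qE qE'; field; rewrite !gt_eqF.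
have X2 : (1 + al) * r1 ^+ 2 / al <= be * r3 ^+ 2 / (1 + be).
  rewrite -subr_ge0; move: R2; congr (0 <= _).
  by rewrite pE pE'; field; rewrite !gt_eqF.
have Y1 (a x y : R) : 0 < a -> 0 < x -> 0 < y -> x <= a * (y - x) ->
    (1 + a) * x ^+ 2 / a <= a * y ^+ 2 / (1 + a).
  move=> a0 x0 y0 h; have a1 : 0 < 1 + a by lra.
  have h1 : (1 + a) * x <= a * y by lra.
  rewrite ler_pdivrMr // mulrAC ler_pdivlMr //.
  have -> : (1 + a) * x ^+ 2 * (1 + a) = ((1 + a) * x) ^+ 2 by ring.
  have -> : a * y ^+ 2 * a = (a * y) ^+ 2 by ring.
  by rewrite ler_sqr ?nnegrE //; apply: mulr_ge0; exact: ltW.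
have X3 := Y1 _ _ _ al0 r1p r2p s1. have X4 := Y1 _ _ _ be0 r4p r3p s2.
(* The least product that both sides admit. *)
pose x := Num.max ((1 + al) * r1 ^+ 2 / al) ((1 + be) * r4 ^+ 2 / be).
have x0 : 0 < x by rewrite lt_max divr_gt0 // mulr_gt0 // exprn_gt0.
have xa : (1 + al) * r1 ^+ 2 <= al * x by rewrite [al * x]mulrC -ler_pdivrMr // /x le_max lexx.
have xb : (1 + be) * r4 ^+ 2 <= be * x.
  by rewrite [be * x]mulrC -ler_pdivrMr // /x le_max lexx orbT.
have xc : (1 + al) * x <= al * r2 ^+ 2 by rewrite [_ * x]mulrC -ler_pdivlMr // /x ge_max X1 X3.
have xd : (1 + be) * x <= be * r3 ^+ 2 by rewrite [_ * x]mulrC -ler_pdivlMr // /x ge_max X2 X4.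
have [x1 [x2 [x1p x12 xx [a1 a2 a3 a4]]]] := wedge_side cK vK oU UK cs1 s0 al0 wm cY x0 xa xc.
have [x4 [x3 [x4p x34 xx' [b1 b2 b3 b4]]]] :=
  wedge_side cK' vK' oU' UK' cs1 s0 be0 wm' cY' x0 xb xd.
exists x1, x2, x3, x4; split => //; rewrite /conjK /= !conj2D !conj2Z !conj2K in b1 b2 b3 b4.
by split; [rewrite xx xx'|split|split|split|split].
Qed.

End Mirror.

(** * Wedges with apex in the body *)

Section Boundary.
Variable R : realType.
Implicit Types (e f g n u v w Y Q k z : plane R) (K U : set (plane R)).

(** The last clause makes [U] the interior of [K], in a form that applies directly to segments; the
    difference of [K] and [U] is thus the boundary. *)
Definition body K U := [/\ compact K, convexK K, open U, U `<=` K &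
  U !=set0 /\ forall k u (t : R), K k -> U u -> 0 < t -> t <= 1 -> U (t *: u + (1 - t) *: k)].

Lemma open_disc U u : open U -> U u -> exists2 d : R, 0 < d &
  forall e z, dot e e = 1 -> `|dot e (z - u)| < d -> `|cross e (z - u)| < d -> U z.
Proof.
move=> oU Uu; have /nbhs_ballP[r /= r0 rU] := open_nbhs_nbhs (conj oU Uu).
exists (r / 2); first by rewrite divr_gt0.
move=> e z e1 d1 d2; have [b1 b2] := unit_bound e1.
have h1 (a b x y : R) : `|x| <= 1 -> `|y| <= 1 -> `|a| < r / 2 -> `|b| < r / 2 -> `|x * a + y * b| < r.
  move=> x1 y1 ar br; apply: le_lt_trans (ler_normD _ _) _; rewrite !normrM.
  have p1 : `|x| * `|a| <= `|a| by rewrite ler_piMl.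
  have p2 : `|y| * `|b| <= `|b| by rewrite ler_piMl.
  by clear -p1 p2 ar br; lra.
apply: rU; split; rewrite /ball /=.
  have -> : u.1 - z.1 = (- e.1) * dot e (z - u) + e.2 * cross e (z - u).
    by rewrite -[LHS]mulr1 -e1 /dot /cross /=; ring.
  by apply: h1 => //; rewrite normrN.
have -> : u.2 - z.2 = (- e.2) * dot e (z - u) + (- e.1) * cross e (z - u).
  by rewrite -[LHS]mulr1 -e1 /dot /cross /=; ring.
by apply: h1 => //; rewrite normrN.
Qed.

Lemma support_open U K n Y u : open U -> U `<=` K -> dot n n = 1 ->
  (forall k, K k -> 0 <= dot n (k - Y)) -> U u -> 0 < dot n (u - Y).
Proof.
move=> oU UK n1 hn Uu; have [d d0 dU] := open_disc oU Uu.
have Uz : U (u - (d / 2) *: n).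
  have E : u - (d / 2) *: n - u = - (d / 2) *: n by apply: plane_eq; rewrite /= /GRing.scale /=; ring.
  apply: (dU n) => //; rewrite E !vecE.
    by rewrite n1 mulr1 normrN gtr0_norm ?divr_gt0 //; clear -d0; lra.
  by rewrite mulr0 normr0.
have := hn _ (UK _ Uz); rewrite !vecE n1; lra.
Qed.

Lemma cone_basis e f v : dot e e = 1 -> 0 < cross e f ->
  v = (- cross f v / cross e f) *: e + (cross e v / cross e f) *: f.
Proof.
move=> e1 ef; apply: (unit_eq e1); rewrite !vecE ?e1.
  rewrite (cross_rot f v e1); field; by rewrite gt_eqF.
by rewrite mulr0 add0r; field; rewrite gt_eqF.
Qed.

(** The part of [K] on the line fits in a rectangle of height 0. *)
Lemma area_line K e Y : compact K -> dot e e = 1 ->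
  area K <= area (right_part K Y e) + area (right_part K Y (- e)).
Proof.
move=> cK e1; have tK := compact_tame cK.
have tr := tame_right Y e cK; have tl := tame_right Y (- e) cK.
have tU := tameU tr tl; have mU : measurable (right_part K Y e `|` right_part K Y (- e) : set (R * R)).
  by case: tU.
have tD := tameD tK mU.
have h1 : area K <= area (right_part K Y e `|` right_part K Y (- e)) +
    area (K `\` (right_part K Y e `|` right_part K Y (- e))).
  apply: area_subU => // z Kz.
  by have [h|h] := pselect ((right_part K Y e `|` right_part K Y (- e)) z); [left|right].
have [M M0 HM] := dotB_bound e Y cK.
have h2 : area (K `\` (right_part K Y e `|` right_part K Y (- e))) <= (M - (- M)) * (0 - 0).
  apply: (@area_le_rect R e Y) => //; first by clear -M0; lra.
  move=> z [Kz nz]; have [h3 _] := HM z Kz; split; first by rewrite -ler_norml.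
  have [h4|h4|h4] := ltrgtP (cross e (z - Y)) 0.
  - by exfalso; apply: nz; left.
  - by exfalso; apply: nz; right; split => //=; rewrite crossNl oppr_lt0.
  - by rewrite ?h4 ?lexx.
rewrite subrr mulr0 in h2.
apply: le_trans h1 _; rewrite -(areaU tr tl); first by rewrite gerDl.
by apply/seteqP; split => // z [[_ /= h4] [_ /=]]; rewrite crossNl => h5; clear -h4 h5; lra.
Qed.

Lemma area_supported K e Y : compact K -> dot e e = 1 ->
  (forall k, K k -> cross e (k - Y) <= 0) -> area K <= area (right_part K Y e).
Proof.
move=> cK e1 h; apply: le_trans (area_line Y cK e1) _.
suff -> : right_part K Y (- e) = set0 by rewrite {2}/area measure0 addr0.
by apply/seteqP; split => // z [Kz /=]; have := h z Kz; rewrite crossNl; clear; lra.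
Qed.

(* The direction [e] is turned clockwise, about the corner [Y], as far as [K] allows. *)
Lemma extreme_direction K U Y e u : body K U -> dot e e = 1 -> K Y ->
  (forall k, K k -> cross e (k - Y) <= 0) -> U u -> cross e (u - Y) < 0 ->
  exists m t : R, [/\ 0 < m, 0 <= t, dot (m *: (e + t *: (u - Y))) (m *: (e + t *: (u - Y))) = 1,
    forall k, K k -> cross (m *: (e + t *: (u - Y))) (k - Y) <= 0 &
    forall x : R, 0 < x -> exists k, [/\ K k, 0 < dot (m *: (e + t *: (u - Y))) (k - Y) &
      - x * dot (m *: (e + t *: (u - Y))) (k - Y) <= cross (m *: (e + t *: (u - Y))) (k - Y)]].
Proof.
move=> [cK vK oU UK _] e1 KY he Uu hu.
have [v vE] : exists v : plane R, v = u - Y by eexists.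
rewrite -vE in hu *.
(* As [t] grows, [e + t *: v] turns towards [u]; [T] collects the [t] for which [K] stays on the
   right. *)
pose T := [set t : R | 0 <= t /\ forall k, K k -> cross e (k - Y) + t * cross v (k - Y) <= 0].
have T0 : T 0 by split => // k Kk; rewrite mul0r addr0; exact: he.
have [d d0 dU] := open_disc oU Uu.
(* This point of [K] would come to lie on the left for large [t], which bounds [T]. *)
pose k0 := u + (d / 2) *: e.
have Kk0 : K k0.
  have E : u + (d / 2) *: e - u = (d / 2) *: e by apply: plane_eq; rewrite /= /GRing.scale /=; ring.
  apply: UK; apply: (dU e) => //; rewrite /k0 E !vecE.
    by rewrite e1 mulr1 gtr0_norm ?divr_gt0 //; clear -d0; lra.
  by rewrite mulr0 normr0.
have k0Y : k0 - Y = v + (d / 2) *: e by rewrite /k0 vE; apply: plane_eq; rewrite /= /GRing.scale /=; ring.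
have vk0 : 0 < cross v (k0 - Y).
  rewrite k0Y !vecE [cross v e]crossC add0r; apply: mulr_gt0; first by rewrite divr_gt0.
  by clear -hu; lra.
have supT : has_sup T.
  split; first by exists 0.
  exists (- cross e (k0 - Y) / cross v (k0 - Y)) => t [_ /(_ _ Kk0)] h.
  by rewrite ler_pdivlMr //; clear -h; lra.
have [t tE] : exists t, t = sup T by eexists.
have t0 : 0 <= t by rewrite tE; apply: sup_upper_bound.
have Tt : T t.
  split => // k Kk; rewrite leNgt; apply/negP => h.
  have hk := he k Kk.
  have vk : 0 < cross v (k - Y).
    rewrite ltNge; apply/negP => vk.
    have : t * cross v (k - Y) <= 0 by rewrite mulr_ge0_le0.
    by clear -h hk; lra.
  have [x xE] : exists x, x = (cross e (k - Y) + t * cross v (k - Y)) / cross v (k - Y) by eexists.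
  have x0 : 0 < x by rewrite xE divr_gt0.
  have [t' [_ /(_ _ Kk) h'] tt'] := sup_adherent x0 supT.
  rewrite -tE in tt'.
  have xv : x * cross v (k - Y) = cross e (k - Y) + t * cross v (k - Y).
    by rewrite xE divfK // gt_eqF.
  have : (t - x) * cross v (k - Y) < t' * cross v (k - Y) by rewrite ltr_pM2r.
  by clear -h' xv; lra.
have [G GE] : exists G : plane R, G = e + t *: v by eexists.
have vv : 0 < cross G (- v) by rewrite GE !vecE; clear -hu; lra.
have GG : 0 < dot G G.
  rewrite lt_neqAle dot_ge0 andbT; apply/eqP => /esym /dot_eq0 G0.
  by move: vv; rewrite G0 /cross /= !mul0r subrr ltxx.
pose m : R := (Num.sqrt (dot G G))^-1.
have m0 : 0 < m by rewrite invr_gt0 sqrtr_gt0.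
have mG : dot (m *: G) (m *: G) = 1.
  by rewrite dotZl dotZr mulrA -expr2 /m exprVn sqr_sqrtr ?(ltW GG) // mulVf // gt_eqF.
have suppG k : K k -> cross (m *: G) (k - Y) <= 0.
  move=> Kk; rewrite crossZl pmulr_rle0 // GE crossDl crossZl; case: Tt => _; exact.
exists m, t; rewrite -GE; split => // x x0.
have [w wE] : exists w, w = m *: G by eexists.
rewrite -wE in mG suppG *.
have dv : 0 < - cross w v by rewrite wE crossZl -mulrN -crossNr mulr_gt0.
pose D := - cross w v. pose X0 := dot w v.
have /common_lower_bound[y y0] : all (fun i : R => 0 < i) [:: (m * (`|X0| + 1))^-1 / 2 ; x / (2 * m * D)].
  rewrite /= andbT; apply/andP; split; apply: divr_gt0 => //.
    by rewrite invr_gt0 mulr_gt0 // ltr_wpDl.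
  by rewrite !mulr_gt0.
rewrite /= => /andP[y1 /andP[y2 _]].
(* Just beyond the supremum some [k] is on the left, so [k] is within a small angle of the extreme
   direction. *)
have [k [Kk hk]] : exists k, K k /\ 0 < cross e (k - Y) + (t + y) * cross v (k - Y).
  apply: contrapT => no.
  suff : T (t + y) by move=> /(sup_upper_bound supT); rewrite -tE; clear -y0; lra.
  split; first by clear -t0 y0; lra.
  by move=> k Kk; rewrite leNgt; apply/negP => h; apply: no; exists k.
exists k.
have [a aE] : exists a, a = dot w (k - Y) by eexists.
have [b bE] : exists b, b = - cross w (k - Y) by eexists.
have b0 : 0 <= b by rewrite bE oppr_ge0; exact: suppG.
have cv : cross v (k - Y) = D * a - X0 * b.
  by rewrite (cross_rot v (k - Y) mG) aE bE /D /X0; ring.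
have cG : cross G (k - Y) = - b / m.
  by rewrite bE wE crossZl; field; rewrite gt_eqF.
have hk2 : b < y * m * (D * a - X0 * b).
  have : 0 < (cross G (k - Y) + y * cross v (k - Y)) * m.
    by rewrite pmulr_lgt0 // GE crossDl crossZl; clear -hk; lra.
  by rewrite cG cv mulrDl divfK ?gt_eqF //; clear; lra.
have mX : 0 < m * (`|X0| + 1) by rewrite mulr_gt0 // ltr_wpDl.
have ymX : y * m * `|X0| <= 1 / 2.
  have : y * (m * (`|X0| + 1)) <= 1 / 2.
    by rewrite -ler_pdivlMr // mul1r mulrC.
  by have := mulr_gt0 y0 m0; clear; lra.
have ymb : - (y * m * X0 * b) <= b / 2.
  have h1 : - (y * m * X0) <= 1 / 2.
    apply: le_trans ymX; rewrite -mulrN; apply: ler_wpM2l; first by rewrite mulr_ge0 // ltW.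
    by rewrite -normrN ler_norm.
  have : - (y * m * X0) * b <= 1 / 2 * b by rewrite ler_wpM2r.
  by clear; lra.
have hb : b / 2 < y * m * D * a by clear -hk2 ymb; lra.
have ymD : 0 < y * m * D by rewrite !mulr_gt0.
have a0 : 0 < a by rewrite -(pmulr_rgt0 _ ymD); clear -hb b0; lra.
have yx : y * (2 * m * D) <= x by rewrite -ler_pdivlMr // !mulr_gt0.
have yxa : y * (2 * m * D) * a <= x * a by rewrite ler_pM2r.
rewrite -aE; split => //.
by clear -hb yxa bE; lra.
Qed.

(* As [w] is the extreme direction at the corner [Y], the cap of height [d] is wider than any multiple of [d]. *)
Lemma corner_cap K U Y w u : body K U -> dot w w = 1 -> K Y -> U u -> cross w (u - Y) < 0 ->
  (forall k, K k -> cross w (k - Y) <= 0) ->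
  (forall x : R, 0 < x -> exists k, [/\ K k, 0 < dot w (k - Y) &
      - x * dot w (k - Y) <= cross w (k - Y)]) ->
  forall B d0 : R, 0 < B -> 0 < d0 -> exists2 d : R, 0 < d <= d0 &
    forall Y', cross w (Y' - Y) = - d -> area (right_part K Y' w) + B * d ^+ 2 <= area K.
Proof.
move=> [cK vK oU UK _] w1 KY Uu hu supp ext B d0 B0 d00.
have [d dE] : exists d, d = - cross w (u - Y) by eexists.
have [x0 xE] : exists x, x = dot w (u - Y) by eexists.
have d_gt0 : 0 < d by clear -dE hu; lra.
have [M M0 HM] := dotB_bound w Y cK.
have nx0 : 0 < 8 * (`|x0| + 1) by rewrite mulr_gt0 // ltr_wpDl.
(* The move will have height [2 * (m * X)], and the box [D] below has area [m * X ^+ 2 / 4]; the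
   bound [m <= (16 * B)^-1] makes this at least [B] times the squared height. *)
have /common_lower_bound[m m0] : all (fun i : R => 0 < i) [:: (16 * B)^-1; d / (8 * (`|x0| + 1)); d / (16 * M); d0 / (2 * M)].
  by rewrite /= invr_gt0 !(divr_gt0, mulr_gt0).
rewrite /= => /andP[m1 /andP[m2 /andP[m3 /andP[m4 _]]]].
rewrite ler_pdivlMr // in m2; rewrite ler_pdivlMr ?mulr_gt0 // in m3.
rewrite ler_pdivlMr ?mulr_gt0 // in m4.
have [k [Kk X0 hk]] := ext m m0.
have [X XE] : exists X, X = dot w (k - Y) by eexists.
have [y yE] : exists y, y = - cross w (k - Y) by eexists.
rewrite -XE in X0 hk.
have y0 : 0 <= y by rewrite yE oppr_ge0; exact: supp.
have ym : y <= m * X by clear -yE hk; lra.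
have XM : X <= M by have [h _] := HM k Kk; apply: le_trans h; rewrite XE ler_norm.
have mX : 0 < m * X by rewrite mulr_gt0.
have mXM : m * X <= m * M by rewrite ler_pM2l.
exists (2 * (m * X)); first by apply/andP; split; [|clear -mXM m4]; lra.
move=> Y' hY'.
pose D := frame w Y @^-1` obox (X / 4) (X / 2) (- (2 * (m * X))) (- (m * X)).
have tD : tame D by apply: tame_frame => //; exact: tame_obox.
have aD : area D = X / 4 * (m * X).
  rewrite area_frame ?area_obox //; [by field|by clear -X0; lra|by clear -mX; lra|].
  by case: (tame_obox (X / 4) (X / 2) (- (2 * (m * X))) (- (m * X))).
have BD : B * (2 * (m * X)) ^+ 2 <= area D.
  rewrite aD; have h1 : m * (16 * B) <= 1.
    by rewrite -ler_pdivlMr ?mulr_gt0 // mul1r.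
  have h2 : m * (16 * B) * (m * X * X) <= 1 * (m * X * X).
    by rewrite ler_pM2r // mulr_gt0.
  by clear -h2; lra.
apply: (@le_trans _ _ (area (right_part K Y' w) + area D)); first by rewrite lerD2l.
have cY' z : cross w (z - Y') = cross w (z - Y) + 2 * (m * X) by move: hY'; rewrite !vecE; clear; lra.
apply: area_disj => //; try exact: tame_right; try exact: compact_tame.
- by move=> z [].
- move=> z [/= /andP[h1 h2] /andP[h3 h4]].
  have [x zx] : exists x, x = dot w (z - Y) by eexists.
  have [h zh] : exists h, h = - cross w (z - Y) by eexists.
  rewrite -zx in h1 h2.
  have h3' : h < 2 * (m * X) by clear -h3 zh; lra.
  have h4' : m * X < h by clear -h4 zh; lra.
  have nx : `|x0| * m <= d / 8 by have := normr_ge0 x0; clear -m2 m0; lra.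
  have nxX : `|x0| * m * X <= d / 8 * X by rewrite ler_pM2r.
  have b1 : `|x0 * y| <= d / 8 * X.
    rewrite normrM (ger0_norm y0); apply: le_trans nxX; rewrite -mulrA ler_wpM2l //.
  have b2 : `|h * x0| <= d / 4 * X.
    have h0 : 0 < h by clear -h4' mX; lra.
    rewrite normrM (gtr0_norm h0); apply: (@le_trans _ _ (2 * (m * X) * `|x0|)).
      by rewrite ler_wpM2r // ltW.
    by clear -nxX; lra.
  move: b1 b2; rewrite !ler_norml => /andP[b1 b1'] /andP[b2 b2'].
  (* Twice the area of the triangle [Y], [k], [u], the denominator of the barycentric coordinates of
     [z] in it. *)
  have [De DeE] : exists De, De = X * d - x0 * y by eexists.
  have dX : 0 < d * X by rewrite mulr_gt0.
  have De0 : 0 < De by rewrite DeE; clear -b1' dX; lra.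
  have x_lo : X / 4 * d <= x * d by rewrite ler_pM2r // ltW.
  have x_hi : x * d <= X / 2 * d by rewrite ler_pM2r // ltW.
  have L2 : 0 <= x * d - h * x0 by clear -x_lo b2'; lra.
  have xp : 0 < x by clear -h1 X0; lra.
  have xy : x * y <= X / 2 * (m * X) by apply: ler_pM => //; exact: ltW.
  have Xh : X * (m * X) <= X * h by rewrite ler_pM2l // ltW.
  have XmX : 0 < X * (m * X) by rewrite mulr_gt0.
  have L3 : 0 <= X * h - x * y by clear -xy Xh XmX; lra.
  have Xh2 : X * h <= X * (2 * (m * X)) by rewrite ler_pM2l // ltW.
  have mXd : m * X <= d / 16 by clear -mXM m3; lra.
  have XmXd : X * (m * X) <= X * (d / 16) by rewrite ler_pM2l.
  have xy0 : 0 <= x * y by rewrite mulr_ge0 // ltW.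
  have L1 : 0 <= De - (x * d - h * x0) - (X * h - x * y).
    by rewrite DeE; clear -x_hi b2 Xh2 XmXd b1' dX xy0; lra.
  have kx : dot w k = X + dot w Y by move: XE; rewrite !vecE; clear; lra.
  have ky : cross w k = - y + cross w Y by move: yE; rewrite !vecE; clear; lra.
  have ux : dot w u = x0 + dot w Y by move: xE; rewrite !vecE; clear; lra.
  have uy : cross w u = - d + cross w Y by move: dE; rewrite !vecE; clear; lra.
  have zx' : dot w z = x + dot w Y by move: zx; rewrite !vecE; clear; lra.
  have zy' : cross w z = - h + cross w Y by move: zh; rewrite !vecE; clear; lra.
  have DeN : De != 0 by rewrite gt_eqF.
  apply: (convex3 (a := (De - (x * d - h * x0) - (X * h - x * y)) / De)
    (b := (x * d - h * x0) / De) (c := (X * h - x * y) / De) vK KY Kk (UK _ Uu)).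
  + by rewrite divr_ge0 // ltW.
  + by rewrite divr_ge0 // ltW.
  + by rewrite divr_ge0 // ltW.
  + by field.
  have key1 : x = ((x * d - h * x0) * X + (X * h - x * y) * x0) / De by rewrite DeE; field; rewrite -DeE.
  have key2 : h = ((x * d - h * x0) * y + (X * h - x * y) * d) / De by rewrite DeE; field; rewrite -DeE.
  apply: (unit_eq w1); rewrite !vecE ?zx' ?zy' ?kx ?ky ?ux ?uy.
    by rewrite {1}key1; field.
  by rewrite {1}key2; field.
- apply/seteqP; split => // z [[_ /=]]; rewrite cY' => h1 [_ /= /andP[h2 _]].
  by clear -h1 h2; lra.
Qed.

End Boundary.

(** * Moves that lower the energy at a corner *)

Section BoundaryMin.
Variable R : realType.
Implicit Types (e f g n u v w Y Q k z : plane R) (K U : set (plane R)).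

Definition config_min K (al be c s : R) Y e f n (q1 q2 : R) := wedge_config K c s Y e f n q1 q2 /\
  forall Y' e' f' n' p1 p2, wedge_config K c s Y' e' f' n' p1 p2 ->
    wedge_energy K al be Y e f q1 q2 <= wedge_energy K al be Y' e' f' p1 p2.

Lemma body_mirror K U : body K U -> body (conjK K) (conjK U).
Proof.
move=> [cK vK oU UK [[u Uu] int]]; split.
- exact: conjK_compact.
- exact: conjK_convex.
- exact: conjK_open.
- by move=> z; exact: UK.
- split; first by exists (conj2 u); rewrite /conjK /= conj2K.
  by move=> k v t Kk Uv t0 t1; rewrite /conjK /= conj2D !conj2Z; exact: int.
Qed.

Lemma wedge_config_mirror K (c s : R) Y e f n (q1 q2 : R) : wedge_config K c s Y e f n q1 q2 ->
  wedge_config (conjK K) c s (conj2 Y) (conj2 f) (conj2 e) (conj2 n) q2 q1.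
Proof.
move=> [[e1 f1 ef1 ef2] [[q10 q20 K1 K2] [n1 ne nf nK]]]; split; last split.
- by rewrite !dot_conj2 cross_conj2 [dot f e]dotC [cross f e]crossC opprK.
- by split => //; rewrite /conjK /= conj2D conj2Z !conj2K.
- rewrite !dot_conj2; split => // k Kk.
  by rewrite -(conj2K k) -conj2N -conj2D dot_conj2; exact: nK.
Qed.

Lemma config_min_mirror K (al be c s : R) Y e f n (q1 q2 : R) : compact K -> 0 < s ->
  config_min K al be c s Y e f n q1 q2 ->
  config_min (conjK K) be al c s (conj2 Y) (conj2 f) (conj2 e) (conj2 n) q2 q1.
Proof.
move=> cK s0 [base wm]; split; first exact: wedge_config_mirror.
move=> Y' e' f' n' p1 p2 base'; have := wedge_config_mirror base'; rewrite conjKK => base2.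
have := wm _ _ _ _ _ _ base2.
have [[_ _ _ ef2] [[q10 q20 _ _] _]] := base; have [[_ _ _ ef2'] [[p10 p20 _ _] _]] := base2.
have E1 : wedge_energy (conjK K) be al (conj2 Y) (conj2 f) (conj2 e) q2 q1 = wedge_energy K al be Y e f q1 q2.
  by apply: wedge_energy_mirror => //; rewrite ef2.
have ef0 : 0 < cross (conj2 f') (conj2 e') by rewrite ef2'.
have E2 := @wedge_energy_mirror R K al be (conj2 Y') (conj2 f') (conj2 e') p2 p1 cK ef0 p10 p20.
by rewrite !conj2K in E2; rewrite E1 E2.
Qed.

(** A crude bound by a rectangle; what counts is that it is quadratic in the size of the
    triangle. *)
Lemma area_wtri_le K Y e f (c s q1 q2 : R) : compact K ->
  [/\ dot e e = 1, dot f f = 1, dot e f = c & cross e f = s] -> c ^+ 2 + s ^+ 2 = 1 -> 0 < s ->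
  0 <= q1 -> 0 <= q2 -> area (wtri Y e f q1 q2 `\` K) <= (q1 + 2 * q2) * q2.
Proof.
move=> cK [e1 _ ec es] cs1 s0 q10 q20; have ef : 0 < cross e f by rewrite es.
have s1 : s <= 1 by clear -cs1 s0; nra.
have /andP[c1 c2] : -1 <= c <= 1 by apply/andP; split; clear -cs1; nra.
have -> : (q1 + 2 * q2) * q2 = (q1 + q2 - - q2) * (q2 - 0) by ring.
apply: (@area_le_rect R e Y) => //; [exact: tame_wtriK|by clear -q10 q20; lra|].
move=> z [/(wtri_coords ef q10 q20)[x [y [-> [x0 y0 xq yq _]]]] _].
have -> : Y + x *: e + y *: f - Y = x *: e + y *: f by apply: plane_eq; rewrite /= /GRing.scale /=; ring.
rewrite !vecE e1 ec es mulr1 mulr0 add0r.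
have h1 : y * c <= y * 1 by rewrite ler_pM2l.
have h2 : y * -1 <= y * c by rewrite ler_pM2l.
have h3 : y * s <= y * 1 by rewrite ler_pM2l.
have h4 : 0 < y * s by rewrite mulr_gt0.
by split; apply/andP; split; clear -x0 y0 xq yq h1 h2 h3 h4; lra.
Qed.

(* Linear gain in [d], to be compared with quadratic losses. *)
Lemma strip_loss K U Y w u : compact K -> open U -> U `<=` K -> dot w w = 1 ->
  U u -> cross w (u - Y) = 0 -> exists2 d0 : R, 0 < d0 & forall (d : R) Y', 0 < d -> d <= d0 ->
    cross w (Y' - Y) = - d -> area (right_part K Y' w) + d0 * d <= area (right_part K Y w).
Proof.
move=> cK oU UK w1 Uu hu; have [r r0 rU] := open_disc oU Uu; exists (r / 2); first by rewrite divr_gt0.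
move=> d Y' d0 dr hY'.
pose D := frame w u @^-1` obox (- (r / 4)) (r / 4) (- d) 0.
have tD : tame D by apply: tame_frame => //; exact: tame_obox.
have aD : area D = r / 2 * d.
  rewrite area_frame ?area_obox //; [by field|by clear -r0; lra|by clear -d0; lra|].
  by case: (tame_obox (- (r / 4)) (r / 4) (- d) 0).
have cu z : cross w (z - u) = cross w (z - Y) by move: hu; rewrite !vecE; clear; lra.
have cY' z : cross w (z - Y') = cross w (z - Y) + d by move: hY'; rewrite !vecE; clear; lra.
rewrite -aD; apply: area_disj => //; try exact: tame_right.
- by move=> z [Kz /=]; rewrite cY' => h; split => //=; clear -h d0; lra.
- move=> z [/= /andP[h1 h2] /andP[h3 h4]]; split; last by rewrite /= -cu.
  apply: UK; apply: (rU w) => //; rewrite ltr_norml; apply/andP; split.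
  + by clear -h1 r0; lra.
  + by clear -h2 r0; lra.
  + by clear -h3 dr r0; lra.
  + by clear -h4 r0; lra.
- apply/seteqP; split => // z [[_ /=]]; rewrite cY' => h1 [_ /= /andP[h2 _]].
  by rewrite cu in h2; clear -h1 h2; lra.
Qed.

(** If the second side entered [U], the apex could move back along [e] by [x]. The line of the first
    side stays, the second cap loses area of order [x], and the new triangle costs only order
    [x ^+ 2]. *)
Lemma corner_ray K U (al be c s : R) Y e f n (q1 q2 tau : R) : body K U ->
  c ^+ 2 + s ^+ 2 = 1 -> 0 < s -> 0 < be ->
  config_min K al be c s Y e f n q1 q2 -> K Y -> 0 < tau -> ~ U (Y + tau *: f).
Proof.
move=> [cK vK oU UK _] cs1 s0 be0 [[[e1 f1 ec es] [[q10 q20 K1 K2] [n1 ne nf nK]]] mi] KY t0 Uf.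
have [d d0 dU] := open_disc oU Uf.
have fN1 : dot (- f) (- f) = 1 by rewrite dotNl dotNr opprK.
have fY : cross (- f) (Y + tau *: f - Y) = 0 by rewrite !vecE; ring.
have [L L0 HL] := strip_loss cK oU UK fN1 Uf fY.
(* The moved second side meets the segment from [Y] to [Y + tau *: f - (d / 2) *: e] at distance
   [x * C] from the new apex. *)
have [C CE] : exists C : R, C = 2 * tau / d by eexists.
have C0 : 0 < C by rewrite CE !(divr_gt0, mulr_gt0).
have [C2 CE2] : exists C2 : R, C2 = (1 + 2 * C) * C by eexists.
have C20 : 0 < C2 by rewrite CE2 mulr_gt0 // addr_gt0 // mulr_gt0.
have /common_lower_bound[x x0] : all (fun i : R => 0 < i) [:: L / s; d / 2; be * L * s / (2 * C2)].
  by rewrite /= !(divr_gt0, mulr_gt0).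
rewrite /= => /andP[x1 /andP[x2 /andP[x3 _]]].
rewrite ler_pdivlMr // in x1; rewrite ler_pdivlMr ?mulr_gt0 // in x3.
have Kt : K (Y + tau *: f - (d / 2) *: e).
  apply: UK; have E : Y + tau *: f - (d / 2) *: e - (Y + tau *: f) = - ((d / 2) *: e).
    by apply: plane_eq; rewrite /= /GRing.scale /=; ring.
  apply: (dU e) => //; rewrite E !vecE.
    by rewrite e1 mulr1 normrN gtr0_norm ?divr_gt0 //; clear -d0; lra.
  by rewrite mulr0 oppr0 normr0.
have [Y' YE] : exists Y', Y' = Y - x *: e by eexists.
have KY1 : K (Y' + x *: e) by rewrite YE subrK.
have KY2 : K (Y' + (x * C) *: f).
  apply: (convex2 (t := 2 * x / d) vK Kt KY).
  - by rewrite !(divr_ge0, mulr_ge0) // ltW.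
  - by rewrite ler_pdivrMr //; clear -x2; lra.
  rewrite YE CE; apply: plane_eq; rewrite /= /GRing.scale /=; field; by rewrite gt_eqF.
have cfg : wedge_config K c s Y' e f n x (x * C).
  do 2 (split => //); first by split => //; rewrite ?mulr_ge0 // ltW.
  split => // k Kk; have := nK k Kk; rewrite YE !vecE.
  by have : 0 <= x * dot n e by [rewrite mulr_ge0 // ltW]; clear; lra.
have J1 := mi _ _ _ _ _ _ cfg.
have tr := area_wtri_le Y' cK (And4 e1 f1 ec es) cs1 s0 (ltW x0) (mulr_ge0 (ltW x0) (ltW C0)).
have re : right_part K Y' e = right_part K Y e.
  by apply: right_eq; rewrite YE !vecE; ring.
have lo : cross (- f) (Y' - Y) = - (x * s).
  by rewrite YE !vecE [cross f e]crossC es; ring.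
have := HL _ _ (mulr_gt0 x0 s0) x1 lo.
have area0 := area_ge0 (wtri Y e f q1 q2 `\` K).
move: J1 tr; rewrite /wedge_energy re => J1 tr.
have fin (a b b' t t' : R) : a + be * b + t <= a + be * b' + t' -> 0 <= t ->
    t' <= (x + 2 * (x * C)) * (x * C) -> b' + L * (x * s) <= b -> False.
  move=> h1 h2 h3 h4.
  have h5 : be * (b' + L * (x * s)) <= be * b by rewrite ler_pM2l.
  have h6 : x * (x * (2 * C2)) <= x * (be * L * s) by rewrite ler_pM2l.
  have h7 : t' <= x * (x * C2) by apply: le_trans h3 _; rewrite CE2 le_eqVlt; apply/orP; left; apply/eqP; ring.
  have h8 : 0 < x * (x * C2) by rewrite !mulr_gt0.
  by clear -h1 h2 h5 h6 h7 h8; lra.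
by move=> h; exact: (fin _ _ _ _ _ J1 area0 tr h).
Qed.

Lemma corner_ray_mirror K U (al be c s : R) Y e f n (q1 q2 tau : R) : body K U ->
  c ^+ 2 + s ^+ 2 = 1 -> 0 < s -> 0 < al ->
  config_min K al be c s Y e f n q1 q2 -> K Y -> 0 < tau -> ~ U (Y + tau *: e).
Proof.
move=> bK cs1 s0 al0 mi KY t0; have [cK _ _ _ _] := bK.
have := @corner_ray _ _ _ _ _ _ _ _ _ _ _ _ tau (body_mirror bK) cs1 s0 al0 (config_min_mirror cK s0 mi).
by rewrite /conjK /= conj2D conj2Z !conj2K; apply.
Qed.

(** A segment from a point of [U] on one side to a point of [K] on the other would cross the line in
    [U]. *)
Lemma line_misses K U Y e : body K U -> dot e e = 1 -> (forall t : R, ~ U (Y + t *: e)) ->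
  (forall k, K k -> cross e (k - Y) <= 0) /\ (forall u, U u -> cross e (u - Y) < 0) \/
  (forall k, K k -> 0 <= cross e (k - Y)) /\ (forall u, U u -> 0 < cross e (u - Y)).
Proof.
move=> [cK vK oU UK [[u0 Uu0] int]] e1 miss.
have nz u : U u -> cross e (u - Y) != 0.
  move=> Uu; apply/eqP => h; apply: (miss (dot e (u - Y))).
  have -> : Y + dot e (u - Y) *: e = u; last by [].
  by apply: (unit_eq e1); move: h; rewrite !vecE ?e1; clear; lra.
have key u k : U u -> K k -> 0 <= cross e (u - Y) * cross e (k - Y).
  move=> Uu Kk; rewrite leNgt; apply/negP => h.
  have [a aE] : exists a, a = cross e (u - Y) by eexists.
  have [b bE] : exists b, b = cross e (k - Y) by eexists.
  have a0 : a != 0 by rewrite aE nz.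
  have [x xE] : exists x, x = b / (b - a) by eexists.
  have ab0 : b - a != 0.
    apply/eqP => ba; move: h; rewrite -aE -bE (_ : b = a); last by clear -ba; lra.
    by rewrite -expr2 ltNge sqr_ge0.
  have x0 : 0 < x.
    have -> : x = (- (a * b) + b ^+ 2) / (b - a) ^+ 2 by rewrite xE; field.
    rewrite divr_gt0 ?ltr_wpDr ?sqr_ge0 ?oppr_gt0 ?aE ?bE //.
    by rewrite lt_neqAle sqr_ge0 eq_sym expf_neq0 // -aE -bE.
  have x1 : x <= 1.
    rewrite -subr_ge0; have -> : 1 - x = (- (a * b) + a ^+ 2) / (b - a) ^+ 2 by rewrite xE; field.
    rewrite divr_ge0 ?sqr_ge0 // addr_ge0 ?sqr_ge0 // oppr_ge0 aE bE; exact: ltW.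
  have Ux := int k u x Kk Uu x0 x1.
  have := nz _ Ux; apply/negP; rewrite negbK; apply/eqP.
  have -> : cross e (x *: u + (1 - x) *: k - Y) = x * a + (1 - x) * b.
    by rewrite aE bE !vecE; ring.
  by rewrite xE; field.
have := nz _ Uu0; have K0 := UK _ Uu0.
have [neg|pos|_] := ltrgtP (cross e (u0 - Y)) 0; last by [].
  move=> _; left; have h k : K k -> cross e (k - Y) <= 0.
    by move=> Kk; have := key _ _ Uu0 Kk; rewrite nmulr_rge0.
  by split => // u Uu; rewrite lt_neqAle nz // h //; exact: UK.
move=> _; right; have h k : K k -> 0 <= cross e (k - Y).
  by move=> Kk; have := key _ _ Uu0 Kk; rewrite pmulr_rge0.
by split => // u Uu; rewrite lt_neqAle eq_sym nz // h //; exact: UK.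
Qed.

End BoundaryMin.

(** * The apex of a minimal wedge lies outside the body *)

Section WedgeTheorem.
Variable R : realType.
Implicit Types (e f g n u v w Y Q k z A B : plane R) (K U : set (plane R)).

(** The first cap already has the full area of [K]. A competitor has its first side in the extreme
    direction [w], its second side along [g] at the same angle, and its apex moved back along [g] by
    [x / s]. Its first cap is smaller than [K] by any desired multiple of [x ^+ 2], its second cap
    is empty, and its triangle costs at most [C * x ^+ 2]. *)
Lemma corner_both K U (al be c s : R) Y e f n (q1 q2 : R) u : body K U ->
  c ^+ 2 + s ^+ 2 = 1 -> 0 < s -> 0 < al -> 0 <= be ->
  config_min K al be c s Y e f n q1 q2 -> K Y -> U u ->
  (forall k, K k -> cross e (k - Y) <= 0) -> (forall k, K k -> cross f (k - Y) <= 0) ->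
  cross e (u - Y) < 0 -> cross f (u - Y) < 0 -> False.
Proof.
move=> bK cs1 s0 al0 be0 [[[e1 f1 ec es] [[q10 q20 K1 K2] [n1 ne nf nK]]] mi] KY Uu Re Rf ue uf.
have [cK vK oU UK _] := bK.
have [m [t [m0 t0]]] := extreme_direction bK e1 KY Re Uu ue.
have [w wE] : exists w, w = m *: (e + t *: (u - Y)) by eexists.
rewrite -wE => w1 wK wext.
have uw : cross w (u - Y) < 0.
  rewrite wE crossZl crossDl crossZl crossxx mulr0 addr0; by rewrite pmulr_rlt0.
have [g gE] : exists g, g = c *: w + s *: quarter w by eexists.
have dq v z : dot (quarter v) z = cross v z by rewrite /dot /cross /quarter /=; ring.
have cq v z : cross (quarter v) z = - dot v z by rewrite /dot /cross /quarter /=; ring.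
have g1 : dot g g = 1.
  rewrite gE !vecE !dq !vecE [dot w (quarter w)]dotC [cross w (quarter w)]crossC dq cq w1 crossxx.
  by rewrite -[RHS]cs1; ring.
have wg : dot w g = c.
  by rewrite gE !vecE [dot w (quarter w)]dotC dq w1 crossxx; ring.
have wgs : cross w g = s.
  by rewrite gE !vecE [cross w (quarter w)]crossC cq w1; ring.
have wf : 0 < cross w f.
  rewrite wE crossZl crossDl crossZl es [cross (u - Y) f]crossC mulr_gt0 // ltr_pwDl //.
  by rewrite mulr_ge0 // oppr_ge0 ltW.
have we : 0 <= cross w e.
  rewrite wE crossZl crossDl crossZl crossxx [cross (u - Y) e]crossC add0r.
  by rewrite !mulr_ge0 // ?oppr_ge0 // ltW.
(* Both sides of the next identity are [w] turned by a fixed angle and stretched. *)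
have gk z : cross w f * cross g z = cross w e * cross w z + s * cross f z.
  rewrite (cross_rot f z w1) (cross_rot g z w1) wg wgs.
  have fw : dot w f = c * dot w e - s * cross w e.
    by rewrite dotC (dot_rot f w e1) ec es [cross e w]crossC [dot e w]dotC; ring.
  have fc : cross w f = c * cross w e + s * dot w e.
    by rewrite crossC (cross_rot f w e1) ec es [cross e w]crossC [dot e w]dotC; ring.
  rewrite fw fc; apply/eqP; rewrite -subr_eq0; apply/eqP.
  transitivity ((c ^+ 2 + s ^+ 2 - 1) * (cross w e * cross w z)); first by ring.
  by rewrite cs1 subrr mul0r.
have gK k : K k -> cross g (k - Y) <= 0.
  move=> Kk; rewrite -(pmulr_rle0 _ wf) gk.
  have h1 : cross w e * cross w (k - Y) <= 0 by rewrite mulr_ge0_le0 // wK.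
  have h2 : s * cross f (k - Y) <= 0 by rewrite mulr_ge0_le0 ?Rf // ltW.
  by clear -h1 h2; lra.
have [d dE] : exists d, d = - cross w (u - Y) by eexists.
have d0 : 0 < d by clear -dE uw; lra.
have [b bE] : exists b, b = - cross g (u - Y) / s by eexists.
have b0 : 0 <= b by rewrite bE divr_ge0 ?oppr_ge0 ?(ltW s0) // gK //; exact: UK.
(* [C * x ^+ 2] is the bound of [area_wtri_le] for the lengths [x / d * b] and [x / s]. *)
have [C CE] : exists C : R, C = (b / d + 2 / s) / s by eexists.
have C0 : 0 < C.
  by rewrite CE !(divr_gt0, ltr_wpDl, divr_ge0) // ltW.
have B0 : 0 < (C + 1) / al by rewrite divr_gt0 // addr_gt0.
have [x /andP[x0 xd] Hx] := corner_cap bK w1 KY Uu uw wK wext B0 d0.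
have [Y' YE] : exists Y', Y' = Y - (x / s) *: g by eexists.
have KY2 : K (Y' + (x / s) *: g) by rewrite YE subrK.
have KY1 : K (Y' + (x / d * b) *: w).
  apply: (convex2 (t := x / d) vK (UK _ Uu) KY).
  - by rewrite divr_ge0 // ltW.
  - by rewrite ler_pdivrMr // mul1r.
  have uY : u = Y + b *: w - (d / s) *: g.
    have wg0 : 0 < cross w g by rewrite wgs.
    have := cone_basis (u - Y) w1 wg0; rewrite wgs => E.
    rewrite -[LHS](subrK Y) E bE dE; apply: plane_eq; rewrite /= /GRing.scale /=; field; by rewrite gt_eqF.
  rewrite YE uY; apply: plane_eq; rewrite /= /GRing.scale /=; field; by rewrite !gt_eqF.
have x1 : 0 <= x / d * b by rewrite mulr_ge0 // divr_ge0 // ltW.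
have x2 : 0 <= x / s by rewrite divr_ge0 // ltW.
have cfg : wedge_config K c s Y' w g (- quarter g) (x / d * b) (x / s).
  do 2 (split => //); split.
  - by rewrite dotNl dotNr opprK dq [cross g _]crossC cq opprK.
  - by rewrite dotNl dq [cross g w]crossC wgs opprK ltW.
  - by rewrite dotNl dq crossxx oppr0.
  - move=> k Kk; rewrite dotNl dq oppr_ge0 YE.
    by have := gK k Kk; rewrite !vecE; clear; lra.
have J1 := mi _ _ _ _ _ _ cfg.
have tr := area_wtri_le Y' cK (And4 w1 g1 wg wgs) cs1 s0 x1 x2.
have lo : cross w (Y' - Y) = - x by rewrite YE !vecE wgs; field; rewrite gt_eqF.
have h1 := Hx _ lo.
have h2 := area_supported cK e1 Re.
have h3 : right_part K Y' (- g) = set0.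
  apply/seteqP; split => // z [Kz /=]; have := gK z Kz; rewrite YE !vecE; clear; lra.
have area0 := area_ge0 (wtri Y e f q1 q2 `\` K).
have area1 := area_ge0 (right_part K Y (- f)).
have a0 : area (set0 : set (plane R)) = 0 by rewrite /area measure0.
move: J1 tr; rewrite /wedge_energy h3 a0 => J1 tr.
have fin (a a' r r' t1 t' k : R) : 0 <= be * r -> 0 <= t1 -> k <= a ->
    a' + (C + 1) / al * x ^+ 2 <= k -> t' <= (x / d * b + 2 * (x / s)) * (x / s) ->
    al * a + be * r + t1 <= al * a' + be * 0 + t' -> False.
  move=> i1 i2 i3 i4.
  have : al * (a' + (C + 1) / al * x ^+ 2) <= al * a by rewrite ler_pM2l // (le_trans i4).
  have -> : al * (a' + (C + 1) / al * x ^+ 2) = al * a' + (C + 1) * x ^+ 2.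
    by field; rewrite gt_eqF.
  have -> : (x / d * b + 2 * (x / s)) * (x / s) = C * x ^+ 2 by rewrite CE; field; rewrite !gt_eqF.
  have : 0 < x ^+ 2 by rewrite exprn_gt0.
  by clear -i1 i2; lra.
exact: (fin _ _ _ _ _ _ _ (mulr_ge0 be0 area1) area0 h2 h1 tr J1).
Qed.

(** In a cone no angle exceeds that of the cone. In nonnegative coordinates along [e] and [f],
    [dot u u * dot v v] is the sum of the squares of [dot u v] and [s * (x * y' - x' * y)], so the
    claim reduces to comparing [dot u v] with [c] times the absolute value of [x * y' - x' * y]; the
    signs of [c] and [dot u v] decide how squares compare. *)
Lemma cone_dot e f (c s : R) u v : dot e e = 1 -> dot f f = 1 -> dot e f = c -> cross e f = s ->
  c ^+ 2 + s ^+ 2 = 1 -> 0 < s -> 0 <= cross e u -> cross f u <= 0 ->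
  0 <= cross e v -> cross f v <= 0 -> c * (enorm u * enorm v) <= dot u v.
Proof.
move=> e1 f1 ec es cs1 s0 eu fu ev fv; have ef : 0 < cross e f by rewrite es.
have := cone_basis u e1 ef; have := cone_basis v e1 ef; rewrite es.
have s0' := ltW s0.
have : 0 <= - cross f u / s by rewrite divr_ge0 ?oppr_ge0.
have : 0 <= cross e u / s by rewrite divr_ge0.
have : 0 <= - cross f v / s by rewrite divr_ge0 ?oppr_ge0.
have : 0 <= cross e v / s by rewrite divr_ge0.
move: (- cross f u / s) (cross e u / s) (- cross f v / s) (cross e v / s) => x y x' y' y0' x0' y0 x0 vE uE.
have [D DE] : exists D, D = dot u v by eexists.
have DE2 : D = x * x' + y * y' + c * (x * y' + x' * y).
  by rewrite DE uE vE !vecE [dot f e]dotC e1 f1 ec; ring.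
have crE : cross u v = s * (x * y' - x' * y).
  by rewrite uE vE !vecE [cross f e]crossC es; ring.
have N : dot u u * dot v v = D ^+ 2 + s ^+ 2 * (x * y' - x' * y) ^+ 2.
  by rewrite -exprMn -crE DE /dot /cross; ring.
have c1 : -1 <= c by clear -cs1; nra.
have Dd : c * `|x * y' - x' * y| <= D.
  (* The product of [a * b] and [p * q] is at least [(a * q) ^+ 2], and their arithmetic mean is at
     least their geometric mean. *)
  have amgm : forall a b p q : R, 0 <= a -> 0 <= b -> 0 <= p -> 0 <= q -> a * q <= p * b ->
      2 * (a * q) <= a * b + p * q.
    move=> a b p q a0 b0 p0 q0 h.
    rewrite -ler_sqr ?nnegrE ?addr_ge0 ?mulr_ge0 //.
    have h1 : a * q * (a * q) <= a * q * (p * b) by rewrite ler_wpM2l // mulr_ge0.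
    by have := sqr_ge0 (a * b - p * q); clear -h1; lra.
  rewrite DE2; have [h|h] := leP (x' * y) (x * y').
    rewrite ger0_norm ?subr_ge0 //.
    have := amgm x' x y' y x0' x0 y0' y0; rewrite [y' * x]mulrC => /(_ h).
    have : -1 * (2 * (x' * y)) <= c * (2 * (x' * y)) by apply: ler_wpM2r => //; rewrite !mulr_ge0.
    by clear; lra.
  rewrite ltr0_norm ?subr_lt0 //.
  have := amgm x x' y y' x0 x0' y0 y0'; rewrite [y * x']mulrC => /(_ (ltW h)).
  have : -1 * (2 * (x * y')) <= c * (2 * (x * y')) by apply: ler_wpM2r => //; rewrite !mulr_ge0.
  by clear; lra.
rewrite -DE /enorm -sqrtrM ?dot_ge0 // N.
have [d dE] : exists d, d = `|x * y' - x' * y| by eexists.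
have <- : d ^+ 2 = (x * y' - x' * y) ^+ 2 by rewrite dE real_normK // num_real.
rewrite -dE in Dd; have d0 : 0 <= d by rewrite dE.
have [r rE] : exists r : R, r = Num.sqrt (D ^+ 2 + s ^+ 2 * d ^+ 2) by eexists.
have r0 : 0 <= r by rewrite rE sqrtr_ge0.
have r2 : r ^+ 2 = D ^+ 2 + s ^+ 2 * d ^+ 2.
  by rewrite rE sqr_sqrtr // addr_ge0 ?sqr_ge0 // -exprMn sqr_ge0.
rewrite -rE.
have s2 : s ^+ 2 = 1 - c ^+ 2 by clear -cs1; lra.
have sD : D ^+ 2 - (c * r) ^+ 2 = s ^+ 2 * (D ^+ 2 - (c * d) ^+ 2).
  by rewrite exprMn r2 s2; ring.
have ss : 0 < s ^+ 2 by rewrite exprn_gt0.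
have [c0|c0] := leP 0 c.
  have cd0 : 0 <= c * d by rewrite mulr_ge0.
  have D0 : 0 <= D by apply: le_trans Dd.
  rewrite -ler_sqr ?nnegrE ?mulr_ge0 // -subr_ge0 sD mulr_ge0 ?(ltW ss) // subr_ge0.
  by rewrite ler_sqr // nnegrE.
have [D0|D0] := leP 0 D.
  by apply: le_trans D0; rewrite mulr_le0_ge0 // ltW.
rewrite -lerN2 -ler_sqr ?nnegrE ?oppr_ge0 ?(ltW D0) // ?mulr_le0_ge0 ?(ltW c0) //.
rewrite !sqrrN -subr_ge0 -opprB sD oppr_ge0 pmulr_rle0 // subr_le0.
rewrite -sqrrN -[in leRHS]sqrrN ler_sqr ?nnegrE ?oppr_ge0 ?(ltW D0) ?mulr_le0_ge0 ?(ltW c0) //.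
by rewrite lerN2.
Qed.

(** The apex is a leftmost point of [K], the second side is vertical, and both lengths are 0. *)
Lemma wedge_config_exists K (c s : R) : compact K -> K !=set0 -> c ^+ 2 + s ^+ 2 = 1 -> 0 <= s ->
  exists Y e f n (q1 q2 : R), wedge_config K c s Y e f n q1 q2.
Proof.
move=> cK K0 cs1 s0.
have cf : {within K, continuous (fun z : plane R => (z.1 : R))}.
  by apply: continuous_subspaceT => z; exact: cvg_fst.
have [P /set_mem KP HP] := compact_EVT_min K0 cK cf.
exists P, ((s, c) : plane R), ((0, 1) : plane R), ((1, 0) : plane R), 0, 0.
split; last split.
- split; rewrite /dot /cross /=.
  + by rewrite -!expr2 addrC.
  + by rewrite mulr0 add0r mulr1.
  + by rewrite mulr0 add0r mulr1.
  + by rewrite mulr0 subr0 mulr1.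
- by split => //; rewrite scale0r addr0.
- split; rewrite /dot /=.
  + by rewrite mulr1 mulr0 addr0.
  + by rewrite mul1r mul0r addr0.
  + by rewrite mul0r mulr0 addr0.
  + by move=> k Kk; rewrite mul1r mul0r addr0 subr_ge0 HP // mem_set.
Qed.

(** The condition on inner angles in terms of the cosine [c] of the wedge angle: from each boundary
    point, two points of [K] are seen under a larger angle. *)
Definition wide K U (c : R) := forall P, (K `\` U) P -> exists A B, [/\ K A, K B &
  dot (A - P) (B - P) < c * (enorm (A - P) * enorm (B - P))].

(** With the apex in [K] both lines miss [U], so [K] lies on one side of each. Being right of both
    or left of both contradicts minimality, the cone opposite to the wedge contradicts the normal
    [n], and the wedge itself contradicts [wide]. *)
Lemma config_min_outside K U (al be c s : R) Y e f n (q1 q2 : R) : body K U ->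
  c ^+ 2 + s ^+ 2 = 1 -> 0 < s -> 0 < al -> 0 < be -> wide K U c ->
  config_min K al be c s Y e f n q1 q2 -> ~ K Y.
Proof.
move=> bK cs1 s0 al0 be0 wd mi KY.
have [cK vK oU UK [[u Uu] int]] := bK.
have [[[e1 f1 ec es] [[q10 q20 K1 K2] [n1 ne nf nK]]] _] := mi.
have nU z : U z -> 0 < dot n (z - Y) by exact: (support_open oU UK n1 nK).
(* Behind the apex it is the supporting normal that keeps the line out of [U]. *)
have ray (v : plane R) : 0 <= dot n v -> (forall t : R, 0 < t -> ~ U (Y + t *: v)) ->
    forall t : R, ~ U (Y + t *: v).
  move=> nv h t Ut; have [/h//|t0] := ltP 0 t.
  have := nU _ Ut; rewrite addrC addKr dotZr.
  by have := mulr_ge0_le0 nv t0; clear; lra.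
have lU1 := ray e ne (fun t t0 => @corner_ray_mirror _ _ _ _ _ _ _ _ _ _ _ _ _ t bK cs1 s0 al0 mi KY t0).
have lU2 := ray f nf (fun t t0 => @corner_ray _ _ _ _ _ _ _ _ _ _ _ _ _ t bK cs1 s0 be0 mi KY t0).
have nUY : ~ U Y by have := lU1 0; rewrite scale0r addr0.
have [[Re Re']|[Le Le']] := line_misses bK e1 lU1;
  have [[Rf Rf']|[Lf Lf']] := line_misses bK f1 lU2.
- exact: (corner_both bK cs1 s0 al0 (ltW be0) mi KY Uu Re Rf (Re' _ Uu) (Rf' _ Uu)).
- have ef : 0 < cross e f by rewrite es.
  have := nU _ Uu; rewrite (cone_basis (u - Y) e1 ef) es dotDr !dotZr.
  have := Re' _ Uu; have := Lf' _ Uu => h1 h2.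
  have h3 : - cross f (u - Y) / s * dot n e <= 0.
    by rewrite mulr_le0_ge0 // mulr_le0_ge0 ?oppr_le0 ?invr_ge0 // ltW.
  have h4 : cross e (u - Y) / s * dot n f <= 0.
    by rewrite mulr_le0_ge0 // mulr_le0_ge0 ?invr_ge0 // ltW.
  by clear -h3 h4; lra.
- have [A [B [KA KB]]] := wd _ (conj KY nUY).
  have := cone_dot e1 f1 ec es cs1 s0 (Le _ KA) (Rf _ KA) (Le _ KB) (Rf _ KB).
  by clear; lra.
- have mi2 := config_min_mirror cK s0 mi.
  have cm (v z : plane R) : cross (conj2 v) (z - conj2 Y) = - cross v (conj2 z - Y).
    by rewrite -{1}(conj2K z) -conj2N -conj2D cross_conj2.
  have KY2 : conjK K (conj2 Y) by rewrite /conjK /= conj2K.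
  have Uu2 : conjK U (conj2 u) by rewrite /conjK /= conj2K.
  apply: (corner_both (body_mirror bK) cs1 s0 be0 (ltW al0) mi2 KY2 Uu2).
  + by move=> k Kk; rewrite cm oppr_le0; exact: Lf.
  + by move=> k Kk; rewrite cm oppr_le0; exact: Le.
  + by rewrite cm conj2K oppr_lt0; exact: Lf'.
  + by rewrite cm conj2K oppr_lt0; exact: Le'.
Qed.

(** A minimiser with apex outside [K] also beats all competitors without a normal, since separation
    supplies one to each of them. *)
Lemma wedge_points K U (al be c s : R) : body K U ->
  c ^+ 2 + s ^+ 2 = 1 -> 0 < s -> 0 < al -> 0 < be -> wide K U c ->
  exists Y e f, [/\ dot e e = 1, dot f f = 1, dot e f = c & cross e f = s] /\
  exists x1 x2 x3 x4 : R, [/\ 0 < x1, 0 < x4, al * (x2 - x1) = x1, be * (x3 - x4) = x4 &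
    [/\ x1 * x2 = x4 * x3, (K `\` U) (Y + x1 *: e), (K `\` U) (Y + x2 *: e),
      (K `\` U) (Y + x3 *: f) & (K `\` U) (Y + x4 *: f)]].
Proof.
move=> bK cs1 s0 al0 be0 wd; have [cK vK oU UK [[u Uu] int]] := bK.
have K0 : K !=set0 by exists u; exact: UK.
have [Y [e [f [n [q1 [q2 mi]]]]]] := wedge_minimizer cK cs1 s0 al0 be0 (wedge_config_exists cK K0 cs1 (ltW s0)).
have KY := config_min_outside bK cs1 s0 al0 be0 wd mi.
exists Y, e, f; have [[ef [qs _]] mi2] := mi; split => //.
apply: (wedge_interior cK vK oU UK cs1 s0 al0 be0 (q1 := q1) (q2 := q2)); split; first exact: (conj ef (conj qs KY)).
move=> Y' e' f' p1 p2 [ef' [[p10 p20 Kp1 Kp2] KY']].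
have [n' n1 nK'] := separation cK vK K0 KY'.
apply: (mi2 _ _ _ n'); split => //; split => //; split => //.
- have := nK' _ Kp1; rewrite addrC addKr dotZr => h.
  by rewrite ltW // -(pmulr_rgt0 _ (_ : 0 < p1)) // lt_neqAle p10 andbT eq_sym; apply: contraTneq h => ->; rewrite mul0r ltxx.
- have := nK' _ Kp2; rewrite addrC addKr dotZr => h.
  by rewrite ltW // -(pmulr_rgt0 _ (_ : 0 < p2)) // lt_neqAle p20 andbT eq_sym; apply: contraTneq h => ->; rewrite mul0r ltxx.
- by move=> k Kk; apply: ltW; exact: nK'.
Qed.

End WedgeTheorem.

(** * Parallel sides *)

Section Trapezoid.
Variable R : realType.
Implicit Types (e f g n u v w Y Q k z A B : plane R) (K U : set (plane R)).

(** The functional for parallel lines scaled by [2 * h], where [p = 2 * h / b1] and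
    [q = 2 * h / b2]. [Q1] and [Q2] only mark the two lines; taking them in [K] makes the
    configurations compact. *)
Definition strip_energy K (p q : R) Q1 Q2 e : R := p * area (right_part K Q1 e) +
  q * area (right_part K Q2 (- e)) + cross e (Q2 - Q1) ^+ 2.

Definition strip_config K Q1 Q2 e := [/\ dot e e = 1, K Q1, K Q2 & 0 <= cross e (Q2 - Q1)].

Definition strip_min K (p q : R) Q1 Q2 e := strip_config K Q1 Q2 e /\
  forall Q1' Q2' e', strip_config K Q1' Q2' e' -> strip_energy K p q Q1 Q2 e <= strip_energy K p q Q1' Q2' e'.

Lemma strip_minimizer K (p q : R) : compact K -> K !=set0 -> 0 < p -> 0 < q ->
  exists Q1 Q2 e, strip_min K p q Q1 Q2 e.
Proof.
move=> cK [k0 Kk0] p0 q0.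
pose T := (plane R * plane R * plane R)%type.
have c1 : continuous (fun t : T => t.1.1) by move=> t; apply: (cvg_comp _ _ (@cvg_fst _ _ _ _ _) cvg_fst).
have c2 : continuous (fun t : T => t.1.2) by move=> t; apply: (cvg_comp _ _ (@cvg_fst _ _ _ _ _) cvg_snd).
have c3 : continuous (fun t : T => t.2) by move=> t; exact: cvg_snd.
have c3N : continuous (fun t : T => - t.2) by move=> t; apply: cvgN; exact: c3.
have c21 : continuous (fun t : T => t.1.2 - t.1.1) by move=> t; apply: cvgB; [exact: c2|exact: c1].
have cz1 z : continuous (fun t : T => z - t.1.1) by move=> t; apply: cvgB; [exact: cvg_cst|exact: c1].
have cz2 z : continuous (fun t : T => z - t.1.2) by move=> t; apply: cvgB; [exact: cvg_cst|exact: c2].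
pose D : set T := [set t | strip_config K t.1.1 t.1.2 t.2].
pose J (t : T) := strip_energy K p q t.1.1 t.1.2 t.2.
have clK := compact_closed2 cK.
have cD : compact D.
  apply: (@subclosed_compact _ _ ((K `*` K) `*` [set z : plane R | `|z.1| <= 1 /\ `|z.2| <= 1])).
  - have -> : D = [set t | dot t.2 t.2 = 1] `&` [set t | K t.1.1] `&` [set t | K t.1.2]
        `&` [set t | 0 <= cross t.2 (t.1.2 - t.1.1)].
      by apply/seteqP; split => t; [move=> [? ? ? ?]; do !split|move=> [[[? ?] ?] ?]; split].
    do 3 ?[apply: closedI].
    + by apply: closed_eq2; exact: continuous_dot.
    + by apply: (@closed_comp _ _ (fun t : T => t.1.1) K) => // t _; exact: c1.
    + by apply: (@closed_comp _ _ (fun t : T => t.1.2) K) => // t _; exact: c2.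
    + apply: closed_le2 => //; first by move=> t; exact: cvg_cst.
      exact: continuous_cross.
  - by apply: compact_setX; [exact: compact_setX|exact: compact_square].
  - by move=> t [e1 K1 K2 _]; split => //=; exact: unit_bound.
have lJ : lsc_on D J.
  apply: lsc_onD; first apply: lsc_onD.
  - apply: lsc_onZ => //; apply: area_lsc_on => [t Dt|t z Dt [Kz /= hz]]; first exact: tame_right.
    have := near_lt (continuous_cross c3 (cz1 z)) hz.
    by apply: filterS => u hu; split.
  - apply: lsc_onZ => //; apply: area_lsc_on => [t Dt|t z Dt [Kz /= hz]]; first exact: tame_right.
    have := near_lt (continuous_cross c3N (cz2 z)) hz.
    by apply: filterS => u hu; split.
  - apply: lsc_on_continuous => t; apply: cvgM; exact: (continuous_cross c3 c21).
have D0 : D !=set0.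
  exists ((k0, k0), (1, 0)); split => //=; first by rewrite /dot /= mulr1 mulr0 addr0.
  by rewrite subrr cross0.
have J0 t : D t -> 0 <= J t.
  move=> _; rewrite /J /strip_energy; apply: addr_ge0; last exact: sqr_ge0.
  by apply: addr_ge0; apply: mulr_ge0; rewrite ?area_ge0 //; exact: ltW.
have [t Dt mt] := @compact_lsc_min R T D J cD D0 J0 lJ.
exists t.1.1, t.1.2, t.2; split => // Q1 Q2 e cfg.
exact: (mt ((Q1, Q2), e) cfg).
Qed.

Lemma strip_min_turn K (p q : R) Q1 Q2 e : strip_min K p q Q1 Q2 e -> strip_min K q p Q2 Q1 (- e).
Proof.
have cE v A B : cross (- v) (A - B) = cross v (B - A) by rewrite !vecE; ring.
have jE (a b : R) A B v : strip_energy K b a B A (- v) = strip_energy K a b A B v.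
  by rewrite /strip_energy opprK cE; move: (area _) (area _) (cross _ _) => x y z; ring.
move=> [[e1 K1 K2 w0] mi]; split; first by split => //; rewrite ?cE // !vecE opprK.
move=> A B v [v1 KA KB w0']; rewrite jE -[v]opprK jE; apply: mi; split => //; last by rewrite cE.
by rewrite !vecE opprK.
Qed.

Lemma strip_min_mirror K (p q : R) Q1 Q2 e : compact K -> strip_min K p q Q1 Q2 e ->
  strip_min (conjK K) p q (conj2 Q1) (conj2 Q2) (- conj2 e).
Proof.
move=> cK.
have cE v A B : cross (- conj2 v) (conj2 B - conj2 A) = cross v (B - A).
  by rewrite -conj2N -conj2N -conj2D cross_conj2 !vecE; ring.
have cfgE L A B v : strip_config L A B v -> strip_config (conjK L) (conj2 A) (conj2 B) (- conj2 v).
  move=> [v1 KA KB w0]; split; rewrite ?cE //; rewrite /conjK /= ?conj2K //.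
  by rewrite -conj2N dot_conj2 !vecE opprK.
have jE A B v : strip_energy (conjK K) p q (conj2 A) (conj2 B) (- conj2 v) = strip_energy K p q A B v.
  rewrite /strip_energy cE -!conj2N !right_part_mirror !opprK.
  rewrite !area_conj //; [by case: (tame_right B (- v) cK)|by case: (tame_right A v cK)].
move=> [cfg mi]; split; first exact: cfgE.
move=> A B v /cfgE; rewrite conjKK => cfg'.
have := mi _ _ _ cfg'; rewrite -jE -[leRHS]jE !conj2K.
by rewrite -[conj2 (- conj2 v)]/(conj2 (- conj2 v)) conj2N conj2K opprK.
Qed.

(** Raising the lower line by [d] adds at most about [d * (r2 - r1)] to its cap and lowers the
    squared width by about [2 * d] times the width. *)
Lemma strip_shift_up K (p q : R) Q1 Q2 e (r1 r2 : R) : compact K -> convexK K -> 0 < p ->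
  strip_min K p q Q1 Q2 e -> 0 < cross e (Q2 - Q1) -> chord K Q1 e r1 r2 ->
  2 * cross e (Q2 - Q1) <= p * (r2 - r1).
Proof.
move=> cK vK p0 [[e1 K1 K2 _] mi] w0 ch; rewrite leNgt; apply/negP => lt.
have [w wE] : exists w : R, w = cross e (Q2 - Q1) by eexists.
rewrite -wE in w0 lt.
have [h hE] : exists h : R, h = (2 * w - p * (r2 - r1)) / (4 * p) by eexists.
have h0 : 0 < h by rewrite hE divr_gt0 ?subr_gt0 ?mulr_gt0.
have ph : p * h * 4 = 2 * w - p * (r2 - r1) by rewrite hE; field; rewrite gt_eqF.
have [d0 d00 H] := right_shift_up cK e1 ch h0.
have /common_lower_bound[d d_gt0] : all (fun i : R => 0 < i) [:: d0; w; p * h] by rewrite /= d00 w0 mulr_gt0.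
rewrite /= => /andP[dd0 /andP[dw /andP[dp _]]].
have [Q QE] : exists Q, Q = Q1 + (d / w) *: (Q2 - Q1) by eexists.
have cQ : cross e (Q - Q1) = d.
  by rewrite QE addrC addKr crossZr -wE divfK // gt_eqF.
have cQ2 : cross e (Q2 - Q) = w - d by move: cQ; rewrite wE !vecE; clear; lra.
have cfg : strip_config K Q Q2 e.
  split => //; last by rewrite cQ2 subr_ge0.
  apply: (convex2 (t := d / w) vK K2 K1).
  - by rewrite divr_ge0 // ltW.
  - by rewrite ler_pdivrMr // mul1r.
  - by rewrite QE; apply: plane_eq; rewrite /= /GRing.scale /=; ring.
have := mi _ _ _ cfg; have := H d Q (ltW d_gt0) dd0 cQ; rewrite /strip_energy cQ2 -wE.
have fin (a a' b : R) : a' <= a + d * (r2 - r1 + 2 * h) ->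
    p * a + b + w ^+ 2 <= p * a' + b + (w - d) ^+ 2 -> False.
  move=> h1 h2; have h3 : p * a' <= p * (a + d * (r2 - r1 + 2 * h)) by rewrite ler_pM2l.
  have h4 : d * (p * (r2 - r1) + 2 * (p * h) - 2 * w + d) < 0.
    have ph0 : 0 < p * h by rewrite mulr_gt0.
    by rewrite pmulr_rlt0 //; clear -ph dp ph0; lra.
  by clear -h2 h3 h4; lra.
exact: fin.
Qed.

Lemma strip_shift_down K (p q : R) Q1 Q2 e (r1 r2 : R) k : compact K -> convexK K -> 0 < p ->
  strip_min K p q Q1 Q2 e -> chord K Q1 e r1 r2 -> K k -> cross e (k - Q1) < 0 ->
  p * (r2 - r1) <= 2 * cross e (Q2 - Q1).
Proof.
move=> cK vK p0 [[e1 K1 K2 w0] mi] ch Kk ck; rewrite leNgt; apply/negP => lt.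
have [w wE] : exists w : R, w = cross e (Q2 - Q1) by eexists.
have [D DE] : exists D : R, D = - cross e (k - Q1) by eexists.
have D0 : 0 < D by rewrite DE oppr_gt0.
rewrite -wE in w0 lt.
have [h hE] : exists h : R, h = (p * (r2 - r1) - 2 * w) / (4 * p) by eexists.
have h0 : 0 < h by rewrite hE divr_gt0 ?subr_gt0 ?mulr_gt0.
have ph : p * h * 4 = p * (r2 - r1) - 2 * w by rewrite hE; field; rewrite gt_eqF.
have [d0 d00 H] := right_shift_down cK vK e1 ch Kk ck h0.
have /common_lower_bound[d d_gt0] : all (fun i : R => 0 < i) [:: d0; D; p * h] by rewrite /= d00 D0 mulr_gt0.
rewrite /= => /andP[dd0 /andP[dw /andP[dp _]]].
have [Q QE] : exists Q, Q = Q1 + (d / D) *: (k - Q1) by eexists.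
have cQ : cross e (Q - Q1) = - d.
  by rewrite QE addrC addKr crossZr DE; field; rewrite lt_eqF.
have cQ2 : cross e (Q2 - Q) = w + d by move: cQ; rewrite wE !vecE; clear; lra.
have cfg : strip_config K Q Q2 e.
  split => //; last by rewrite cQ2 addr_ge0 // ltW.
  apply: (convex2 (t := d / D) vK Kk K1).
  - by rewrite divr_ge0 // ltW.
  - by rewrite ler_pdivrMr // mul1r.
  - by rewrite QE; apply: plane_eq; rewrite /= /GRing.scale /=; ring.
have := mi _ _ _ cfg; have := H d Q (ltW d_gt0) dd0 cQ; rewrite /strip_energy cQ2 -wE.
have fin (a a' b : R) : a' + d * (r2 - r1 - 2 * h) <= a ->
    p * a + b + w ^+ 2 <= p * a' + b + (w + d) ^+ 2 -> False.
  move=> h1 h2; have h3 : p * (a' + d * (r2 - r1 - 2 * h)) <= p * a by rewrite ler_pM2l.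
  have h4 : d * (2 * w + d - p * (r2 - r1) + 2 * (p * h)) < 0.
    have ph0 : 0 < p * h by rewrite mulr_gt0.
    by rewrite pmulr_rlt0 //; clear -ph dp ph0; lra.
  by clear -h2 h3 h4; lra.
exact: fin.
Qed.

(** Bases of lengths [2 * a] and [2 * b] can have their midpoints in [[r1 + a, r2 - a]] and
    [[r4 + b, r3 - b]]; the conclusion and its mirror image make these intervals meet. If it failed,
    turning the lines about their points at [r2 - 2 * a] and [r4 + 2 * b] would lower the squared
    width at rate [2 * w * x], while the weighted caps grow at rate at most [2 * w * (a + b)]. *)
Lemma strip_rot K (p q : R) Q1 Q2 e (w r1 r2 r3 r4 a b : R) : compact K -> convexK K ->
  0 < p -> 0 < q -> strip_min K p q Q1 Q2 e -> w = cross e (Q2 - Q1) -> 0 < w ->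
  chord K Q1 e r1 r2 -> chord K (Q1 + w *: quarter e) e r4 r3 ->
  0 <= a -> 0 <= b -> 2 * a <= r2 - r1 -> 2 * b <= r3 - r4 -> p * a = w -> q * b = w ->
  r4 + b <= r2 - a.
Proof.
move=> cK vK p0 q0 [[e1 K1 K2 _] mi] wE w0 ch1 ch2 a0 b0 La Lb pa qb.
rewrite leNgt; apply/negP => lt.
have [Y YE] : exists Y, Y = Q1 + w *: quarter e by eexists.
rewrite -YE in ch2.
have [x xE] : exists x : R, x = (r4 + 2 * b) - (r2 - 2 * a) by eexists.
have [y yE] : exists y : R, y = (r4 + b) - (r2 - a) by eexists.
have xy : x = y + (a + b) by rewrite xE yE; ring.
have y0 : 0 < y by clear -yE lt; lra.
have x0 : 0 < x by clear -xy y0 a0 b0; lra.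
(* For [h <= 1], [h * S] bounds the terms that [h] contributes to the weighted squares. *)
have [S SE] : exists S : R, S = 4 * p * a + 4 * q * b + p + q by eexists.
have S0 : 0 < S by rewrite SE -!mulrA pa qb; clear -w0 p0 q0; lra.
have wy : 0 < w * y by rewrite mulr_gt0.
have /common_lower_bound[h h0] : all (fun i : R => 0 < i) [:: 1; w * y / S].
  by rewrite /= ltr01 divr_gt0.
rewrite /= => /andP[h1 /andP[h2 _]]; rewrite ler_pdivlMr // in h2.
have cN := chord_opp ch2.
have eN1 : dot (- e) (- e) = 1 by rewrite !vecE opprK.
have pr1 : r2 - 2 * a <= r2 by clear -a0; lra.
have pr2 : - (r4 + 2 * b) <= - r4 by clear -b0; lra.
have [k1 k10 H1] := right_rot cK e1 ch1 pr1 h0.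
have [k2 k20 H2] := right_rot cK eN1 cN pr2 h0.
have /common_lower_bound[m m0] : all (fun i : R => 0 < i) [:: k1; k2; w / x; w * y / (x ^+ 2)].
  by rewrite /= k10 k20 !divr_gt0 // exprn_gt0.
rewrite /= => /andP[m1 /andP[m2 /andP[m3 /andP[m4 _]]]].
rewrite ler_pdivlMr // in m3; rewrite ler_pdivlMr ?exprn_gt0 // in m4.
have [C C0 C1] := turn_exists m.
have [e' eE] : exists e', e' = C *: (e + m *: quarter e) by eexists.
have dq (v z : plane R) : dot (quarter v) z = cross v z by rewrite /dot /cross /quarter /=; ring.
have cq (v z : plane R) : cross (quarter v) z = - dot v z by rewrite /dot /cross /quarter /=; ring.
have qd (v z : plane R) : dot z (quarter v) = cross v z by rewrite dotC dq.
have qc (v z : plane R) : cross z (quarter v) = dot v z by rewrite crossC cq opprK.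
have e1' : dot e' e' = 1.
  by rewrite eE !vecE !dq !qd ?vecE ?qc e1 -[RHS]C1; ring.
have de : dot e e' = C by rewrite eE !vecE qd crossxx e1; ring.
have ce : cross e e' = m * C by rewrite eE !vecE qc e1; ring.
have KQ1 : K (Q1 + (r2 - 2 * a) *: e).
  by apply: (chord_convex vK ch1) => //; clear -La; lra.
have KQ2 : K (Y + (r4 + 2 * b) *: e).
  by apply: (chord_convex vK ch2); [clear -b0|clear -Lb]; lra.
have ww : cross e' (Y + (r4 + 2 * b) *: e - (Q1 + (r2 - 2 * a) *: e)) = C * (w - m * x).
  have -> : Y + (r4 + 2 * b) *: e - (Q1 + (r2 - 2 * a) *: e) = w *: quarter e + x *: e.
    by rewrite YE xE; apply: plane_eq; rewrite /= /GRing.scale /=; ring.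
  by rewrite eE !vecE !(cq, qc, qd) ?e1; ring.
have mx : 0 <= w - m * x by rewrite subr_ge0.
have cfg : strip_config K (Q1 + (r2 - 2 * a) *: e) (Y + (r4 + 2 * b) *: e) e'.
  by split => //; rewrite ww mulr_ge0 // ltW.
have := mi _ _ _ cfg; rewrite /strip_energy ww -wE.
have C0' : 0 < dot e e' by rewrite de.
have G1 := H1 e' m C0' (ltW m0) m1 (_ : _ = _); rewrite ce de in G1.
have C0N : 0 < dot (- e) (- e') by rewrite dotNl dotNr opprK.
have G2 := H2 (- e') m C0N (ltW m0) m2 (_ : _ = _); rewrite !vecE !opprK ce de in G2.
have EQ : Y + (- (r4 + 2 * b)) *: (- e) = Y + (r4 + 2 * b) *: e.
  by rewrite scalerN scaleNr opprK.
rewrite EQ in G2.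
have rY : right_part K Y (- e) = right_part K Q2 (- e).
  apply: right_eq; rewrite YE; move: wE; rewrite !vecE qc e1; clear; lra.
rewrite rY in G2.
have C2 : C ^+ 2 <= 1 by rewrite -C1 ler_peMr ?sqr_ge0 // lerDl sqr_ge0.
move: (G1 erefl) (G2 erefl).
have fin (A1 A1' A2 A2' : R) : 2 * A1' <= 2 * A1 + m * (r2 - (r2 - 2 * a) + h) ^+ 2 ->
    2 * A2' <= 2 * A2 + m * (- r4 + (r4 + 2 * b) + h) ^+ 2 ->
    p * A1 + q * A2 + w ^+ 2 <= p * A1' + q * A2' + (C * (w - m * x)) ^+ 2 -> False.
  move=> g1 g2.
  have g3 : p * (2 * A1') <= p * (2 * A1 + m * (r2 - (r2 - 2 * a) + h) ^+ 2) by rewrite ler_pM2l.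
  have g4 : q * (2 * A2') <= q * (2 * A2 + m * (- r4 + (r4 + 2 * b) + h) ^+ 2) by rewrite ler_pM2l.
  have g5 : (C * (w - m * x)) ^+ 2 <= (w - m * x) ^+ 2.
    by rewrite exprMn ler_piMl // sqr_ge0.
  have g6 : p * (2 * a + h) ^+ 2 + q * (2 * b + h) ^+ 2 - 4 * w * x + 2 * m * x ^+ 2 < 0.
    have hh : h ^+ 2 <= h by rewrite expr2 ler_piMr // ltW.
    have ph : (p + q) * h ^+ 2 <= (p + q) * h by rewrite ler_wpM2l // addr_ge0 // ltW.
    have -> : p * (2 * a + h) ^+ 2 + q * (2 * b + h) ^+ 2 - 4 * w * x + 2 * m * x ^+ 2 =
      4 * ((p * a) * a + (q * b) * b - w * x) + h * (4 * p * a + 4 * q * b) + (p + q) * h ^+ 2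
       + 2 * (m * x ^+ 2) by ring.
    rewrite pa qb (_ : w * a + w * b - w * x = - (w * y)); last by rewrite xy; ring.
    have hS : h * S = h * (4 * p * a + 4 * q * b) + (p + q) * h by rewrite SE; ring.
    by clear -ph hS h2 m4 wy; lra.
  have g7 : m * (p * (2 * a + h) ^+ 2 + q * (2 * b + h) ^+ 2 - 4 * w * x + 2 * m * x ^+ 2) < 0.
    by rewrite pmulr_rlt0.
  by clear -g3 g4 g5 g7; lra.
exact: fin.
Qed.

(** All of [K] is below the first line. Two lines in the extreme direction at [Q1], at distance [d],
    do better: the upper one cuts off nothing, and the lower one spares at least [2 / p * d ^+ 2] of
    the area of [K] against a squared width of [d ^+ 2]. *)
Lemma strip_corner K U (p q : R) Q1 Q2 e u : body K U -> 0 < p -> 0 < q ->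
  strip_min K p q Q1 Q2 e -> (forall k, K k -> cross e (k - Q1) <= 0) -> U u ->
  cross e (u - Q1) < 0 -> False.
Proof.
move=> bK p0 q0 [[e1 K1 K2 w0] mi] Re Uu ue; have [cK vK oU UK _] := bK.
have [m [t [m0 t0]]] := extreme_direction bK e1 K1 Re Uu ue.
have [v vE] : exists v, v = m *: (e + t *: (u - Q1)) by eexists.
rewrite -vE => v1 vKn vext.
have uv : cross v (u - Q1) < 0.
  rewrite vE crossZl crossDl crossZl crossxx mulr0 addr0; by rewrite pmulr_rlt0.
have [D DE] : exists D : R, D = - cross v (u - Q1) by eexists.
have D0 : 0 < D by rewrite DE oppr_gt0.
have B0 : 0 < 2 / p by rewrite divr_gt0.
have [d /andP[d0 dD] Hd] := corner_cap bK v1 K1 Uu uv vKn vext B0 D0.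
have [Q QE] : exists Q, Q = Q1 + (d / D) *: (u - Q1) by eexists.
have cQ : cross v (Q - Q1) = - d.
  by rewrite QE addrC addKr crossZr DE; field; rewrite lt_eqF.
have cQ2 : cross v (Q1 - Q) = d by move: cQ; rewrite !vecE; clear; lra.
have cfg : strip_config K Q Q1 v.
  split => //; last by rewrite cQ2 ltW.
  apply: (convex2 (t := d / D) vK (UK _ Uu) K1).
  - by rewrite divr_ge0 // ltW.
  - by rewrite ler_pdivrMr // mul1r.
  - by rewrite QE; apply: plane_eq; rewrite /= /GRing.scale /=; ring.
have h3 : right_part K Q1 (- v) = set0.
  by apply/seteqP; split => // z [Kz /=]; have := vKn z Kz; rewrite crossNl; clear; lra.
have a0 : area (set0 : set (plane R)) = 0 by rewrite /area measure0.
have := mi _ _ _ cfg; have := Hd _ cQ; have := area_supported cK e1 Re.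
have := area_ge0 (right_part K Q2 (- e)).
rewrite /strip_energy cQ2 h3 a0.
have fin (A A' A2 k y : R) : 0 <= A2 -> k <= A -> A' + 2 / p * d ^+ 2 <= k ->
    p * A + q * A2 + y ^+ 2 <= p * A' + q * 0 + d ^+ 2 -> False.
  move=> i1 i2 i3.
  have : p * (A' + 2 / p * d ^+ 2) <= p * A by rewrite ler_pM2l // (le_trans i3).
  have -> : p * (A' + 2 / p * d ^+ 2) = p * A' + 2 * d ^+ 2 by field; rewrite gt_eqF.
  have : 0 <= q * A2 by rewrite mulr_ge0 // ltW.
  have : 0 < d ^+ 2 by rewrite exprn_gt0.
  by have := sqr_ge0 y; clear; lra.
exact: fin.
Qed.

(** Suppose the two lines coincide. If they meet [U], lowering the first by [d] gains area of order
    [d] and costs [d ^+ 2]; if they miss [U], one of the lines has all of [K] below it once the pair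
    is suitably oriented, and [strip_corner] applies. *)
Lemma strip_nondegenerate K U (p q : R) Q1 Q2 e : body K U -> 0 < p -> 0 < q ->
  strip_min K p q Q1 Q2 e -> 0 < cross e (Q2 - Q1).
Proof.
move=> bK p0 q0 mi; have [cK vK oU UK [[u Uu] _]] := bK.
have [[e1 K1 K2 w0] mi2] := mi; rewrite lt_neqAle w0 andbT; apply/eqP => wE.
have [[t Ut]|nU] := pselect (exists t : R, U (Q1 + t *: e)).
  have [r r0 rU] := open_disc oU Ut.
  have tQ : cross e (Q1 + t *: e - Q1) = 0 by rewrite !vecE; ring.
  have [d0 d00 H] := strip_loss cK oU UK e1 Ut tQ.
  have /common_lower_bound[d d_gt0] : all (fun i : R => 0 < i) [:: d0; r / 2; p * d0 / 2].
    by rewrite /= d00 !divr_gt0 // mulr_gt0.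
  rewrite /= => /andP[d1 /andP[d2 /andP[d3 _]]].
  have [Q QE] : exists Q, Q = Q1 + t *: e - d *: quarter e by eexists.
  have qc : cross e (quarter e) = 1 by rewrite -e1 /dot /cross /quarter /=; ring.
  have qd : dot e (quarter e) = 0 by rewrite /dot /quarter /=; ring.
  have cQ : cross e (Q - Q1) = - d by rewrite QE !vecE qc; ring.
  have cQ2 : cross e (Q2 - Q) = d by move: cQ wE; rewrite !vecE; clear; lra.
  have cfg : strip_config K Q Q2 e.
    split => //; last by rewrite cQ2 ltW.
    apply: UK; apply: (rU e) => //; rewrite QE !vecE ?qc ?qd ltr_norml; apply/andP; split;
      by clear -r0 d_gt0 d2; lra.
  have := mi2 _ _ _ cfg; have := H d Q d_gt0 d1 cQ; rewrite /strip_energy cQ2 -wE.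
  have fin (A A' A2 : R) : A' + d0 * d <= A ->
      p * A + A2 + 0 ^+ 2 <= p * A' + A2 + d ^+ 2 -> False.
    move=> i1; have : p * (A' + d0 * d) <= p * A by rewrite ler_pM2l.
    have : d * d <= d * (p * d0 / 2) by rewrite ler_pM2l.
    have : 0 < p * d0 * d by rewrite !mulr_gt0.
    by clear; lra.
  exact: fin.
have nU' (t : R) : ~ U (Q1 + t *: e) by move=> Ut; apply: nU; exists t.
have [[Re Re']|[Le Le']] := line_misses bK e1 nU'.
  exact: (strip_corner bK p0 q0 mi Re Uu (Re' _ Uu)).
apply: (strip_corner bK q0 p0 (strip_min_turn mi) _ Uu).
  by move=> k Kk; have := Le _ Kk; move: wE; rewrite !vecE; clear; lra.
by have := Le' _ Uu; move: wE; rewrite !vecE; clear; lra.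
Qed.

Lemma chord_base K Y e (r1 r2 x : R) : dot e e = 1 -> chord K Y e r1 r2 ->
  chord K (Y + x *: e) e (r1 - x) (r2 - x).
Proof.
move=> e1 [K1 K2 r12 H].
have E (r : R) : Y + x *: e + (r - x) *: e = Y + r *: e.
  by apply: plane_eq; rewrite /= /GRing.scale /=; ring.
split; rewrite ?E //; first by rewrite lerD2r.
move=> z Kz; have -> : cross e (z - (Y + x *: e)) = cross e (z - Y) by rewrite !vecE; ring.
move=> /(H z Kz); have -> : dot e (z - (Y + x *: e)) = dot e (z - Y) - x by rewrite !vecE e1; ring.
by rewrite !lerD2r.
Qed.

(** Here [s] is the width of the minimal strip over [h]. The shifts give chords of length at least
    [s * b1] and [s * b2], with equality where [K] passes beyond the line; the rotations allow both
    bases to be centred at one coordinate [m]. *)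
Lemma trapezoid_points K U (b1 b2 h : R) : body K U -> 0 < b1 -> 0 < b2 -> 0 < h ->
  exists Y e (s : R), [/\ dot e e = 1, 0 < s &
   [/\ (K `\` U) (Y - (s * b1 / 2) *: e), (K `\` U) (Y + (s * b1 / 2) *: e),
      (K `\` U) (Y + (s * h) *: quarter e - (s * b2 / 2) *: e) &
      (K `\` U) (Y + (s * h) *: quarter e + (s * b2 / 2) *: e)]].
Proof.
move=> bK b10 b20 h0; have [cK vK oU UK [[u Uu] _]] := bK.
have p0 : 0 < 2 * h / b1 by rewrite !(divr_gt0, mulr_gt0).
have q0 : 0 < 2 * h / b2 by rewrite !(divr_gt0, mulr_gt0).
have K0 : K !=set0 by exists u; exact: UK.
have [Q1 [Q2 [e mi]]] := strip_minimizer cK K0 p0 q0.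
have [w wE] : exists w : R, w = cross e (Q2 - Q1) by eexists.
have w0 : 0 < w by rewrite wE; exact: strip_nondegenerate bK p0 q0 mi.
have [[e1 K1 K2 _] _] := mi.
have eN1 : dot (- e) (- e) = 1 by rewrite !vecE opprK.
have qc : cross e (quarter e) = 1 by rewrite -e1 /dot /cross /quarter /=; ring.
have [Y2 YE] : exists Y2, Y2 = Q1 + w *: quarter e by eexists.
have c1 : cross e (Q1 - Q1) = 0 by rewrite subrr cross0.
have c2 : cross e (Q2 - Y2) = 0 by rewrite YE; move: wE; rewrite !vecE qc; clear; lra.
have [r1 [r2 ch1]] := chord_ex cK e1 K1 c1.
have [r4 [r3 ch2]] := chord_ex cK e1 K2 c2.
have [x xE] : exists x : R, Q2 = Y2 + x *: e.
  exists (dot e (Q2 - Y2)); apply: (unit_eq e1); rewrite !vecE.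
    by rewrite e1; ring.
  by move: c2; rewrite !vecE; clear; lra.
have ch2' := chord_opp ch2.
have ch3 := chord_opp (chord_base x e1 ch2); rewrite -xE in ch3.
have miT := strip_min_turn mi.
have wT : cross (- e) (Q1 - Q2) = w by rewrite wE !vecE; ring.
have wT0 : 0 < cross (- e) (Q1 - Q2) by rewrite wT.
have w0' : 0 < cross e (Q2 - Q1) by rewrite -wE.
have [s sE] : exists s : R, s = w / h by eexists.
have s0 : 0 < s by rewrite sE divr_gt0.
have [a aE] : exists a : R, a = s * b1 / 2 by eexists.
have [b bE] : exists b : R, b = s * b2 / 2 by eexists.
have a0 : 0 < a by rewrite aE !(divr_gt0, mulr_gt0).
have b0 : 0 < b by rewrite bE !(divr_gt0, mulr_gt0).
have pa : 2 * h / b1 * a = w by rewrite aE sE; field; rewrite !gt_eqF.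
have qb : 2 * h / b2 * b = w by rewrite bE sE; field; rewrite !gt_eqF.
have La : 2 * a <= r2 - r1.
  rewrite -(ler_pM2l p0) mulrCA pa; have := strip_shift_up cK vK p0 mi w0' ch1.
  by rewrite -wE.
have Lb : 2 * b <= r3 - r4.
  rewrite -(ler_pM2l q0) mulrCA qb; have := strip_shift_up cK vK q0 miT wT0 ch3.
  by rewrite wT (_ : - (r4 - x) - - (r3 - x) = r3 - r4) //; ring.
have ch2Y := ch2; rewrite YE in ch2Y.
have R1 := strip_rot cK vK p0 q0 mi wE w0 ch1 ch2Y (ltW a0) (ltW b0) La Lb pa qb.
have miM := strip_min_mirror cK mi.
have wM : w = cross (- conj2 e) (conj2 Q2 - conj2 Q1).
  by rewrite -conj2N -conj2N -conj2D cross_conj2 wE !vecE; ring.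
have ch1M := chord_opp (chord_mirror ch1).
have ch2M := chord_opp (chord_mirror ch2).
have YM : conj2 Y2 = conj2 Q1 + w *: quarter (- conj2 e).
  by rewrite YE; apply: plane_eq; rewrite /= /GRing.scale /=; ring.
rewrite YM in ch2M.
have La' : 2 * a <= - r1 - - r2 by clear -La; lra.
have Lb' : 2 * b <= - r4 - - r3 by clear -Lb; lra.
have R2 := strip_rot (conjK_compact cK) (conjK_convex vK) p0 q0 miM wM w0 ch1M ch2M (ltW a0) (ltW b0) La' Lb' pa qb.
have [m [m1 m2 m3 m4]] : exists m : R, [/\ r1 + a <= m, m <= r2 - a, r4 + b <= m & m <= r3 - b].
  have [h1|h1] := leP (r1 + a) (r4 + b).
    by exists (r4 + b); split => //; clear -Lb; lra.
  by exists (r1 + a); split; clear -La h1 R2; lra.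
have N1 r : r = m - a \/ r = m + a -> (K `\` U) (Q1 + r *: e).
  move=> rE; split.
    by apply: (chord_convex vK ch1); case: rE => ->; clear -m1 m2 a0; lra.
  apply: (notin_open_end e1 oU UK ch1).
  have [[k [Kk ck]]|no] := pselect (exists k, K k /\ cross e (k - Q1) < 0); last first.
    by right => k Kk; rewrite leNgt; apply/negP => h1; apply: no; exists k.
  left; have := strip_shift_down cK vK p0 mi ch1 Kk ck.
  rewrite -wE -pa mulrCA ler_pM2l // => L.
  by case: rE => ->; [left|right]; clear -L La m1 m2; lra.
have N2 r : r = m - b \/ r = m + b -> (K `\` U) (Y2 + r *: e).
  move=> rE; split.
    by apply: (chord_convex vK ch2); case: rE => ->; clear -m3 m4 b0; lra.
  have -> : Y2 + r *: e = Y2 + (- r) *: (- e) by rewrite scalerN scaleNr opprK.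
  apply: (notin_open_end eN1 oU UK ch2').
  have [[k [Kk ck]]|no] := pselect (exists k, K k /\ cross (- e) (k - Q2) < 0); last first.
    right => k Kk; rewrite leNgt; apply/negP => h1; apply: no; exists k; split => //.
    by move: c2 h1; rewrite !vecE; clear; lra.
  left; have := strip_shift_down cK vK q0 miT ch3 Kk ck.
  rewrite wT -qb mulrCA ler_pM2l // => L.
  by case: rE => ->; [right|left]; clear -L Lb m3 m4; lra.
exists (Q1 + m *: e), e, s; split => //; rewrite -aE -bE.
have sh : s * h = w by rewrite sE divfK // gt_eqF.
rewrite sh; split.
- have -> : Q1 + m *: e - a *: e = Q1 + (m - a) *: e by rewrite scalerBl addrA.
  by apply: N1; left.
- have -> : Q1 + m *: e + a *: e = Q1 + (m + a) *: e by rewrite scalerDl addrA.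
  by apply: N1; right.
- have -> : Q1 + m *: e + w *: quarter e - b *: e = Y2 + (m - b) *: e.
    by rewrite YE scalerBl addrA; congr (_ - _); rewrite addrAC.
  by apply: N2; left.
- have -> : Q1 + m *: e + w *: quarter e + b *: e = Y2 + (m + b) *: e.
    by rewrite YE scalerDl addrA; congr (_ + _); rewrite addrAC.
  by apply: N2; right.
Qed.

End Trapezoid.

(** * The body bounded by the curve *)

Section Topology.
Variable R : realType.
Implicit Types (e f k u v w x y z p : plane R) (A C K U : set (plane R)).

Definition open_square z (r : R) : set (plane R) := [set w | `|w.1 - z.1| < r /\ `|w.2 - z.2| < r].

Lemma open_square_convex z (r : R) : convexK (open_square z r).
Proof.
move=> x y t [x1 x2] [y1 y2] t0 t1; split.
all: have key (a b c : R) : `|a - c| < r -> `|b - c| < r -> `|t * a + (1 - t) * b - c| < r.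
1,3: move=> h1 h2; have -> : t * a + (1 - t) * b - c = t * (a - c) + (1 - t) * (b - c) by ring.
1,2: have t1' : 0 <= 1 - t by rewrite subr_ge0.
1,2: have r0 : 0 < r by apply: le_lt_trans h1.
1,2: apply: le_lt_trans (ler_normD _ _) _; rewrite !normrM (ger0_norm t0) (ger0_norm t1').
1,2: have [->|tn] := eqVneq t 0; first by rewrite mul0r add0r subr0 mul1r.
1,2: have tp : 0 < t by rewrite lt_neqAle eq_sym tn.
1,2: have g1 : t * `|a - c| < t * r by rewrite ltr_pM2l.
1,2: have g2 : (1 - t) * `|b - c| <= (1 - t) * r by rewrite ler_wpM2l // ltW.
1,2: by clear -g1 g2; lra.
all: exact: key.
Qed.

Lemma open_square_mem z (r : R) : 0 < r -> open_square z r z.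
Proof. by move=> r0; split; rewrite subrr normr0. Qed.

Lemma open_contains_square A z : open A -> A z -> exists2 r : R, 0 < r & open_square z r `<=` A.
Proof.
move=> oA Az; have /nbhs_ballP[r /= r0 rA] := open_nbhs_nbhs (conj oA Az).
exists r => // w [w1 w2]; apply: rA; split; rewrite /ball /=.
  by rewrite -normrN opprB.
by rewrite -normrN opprB.
Qed.

Lemma open_square_nbhs z (r : R) : 0 < r -> nbhs z (open_square z r).
Proof.
move=> r0; apply/nbhs_ballP; exists r => // w [w1 w2]; split.
  by rewrite -normrN opprB.
by rewrite -normrN opprB.
Qed.

Lemma closure_squareP A z : closure A z <-> forall r : R, 0 < r -> exists2 w, A w & open_square z r w.
Proof.
split => [h r r0|h B /nbhs_ballP[r /= r0 rB]].
  by have [w [Aw zw]] := h _ (open_square_nbhs z r0); exists w.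
have [w Aw [w1 w2]] := h r r0; exists w; split => //; apply: rB; split; rewrite /ball /=.
  by rewrite -normrN opprB.
by rewrite -normrN opprB.
Qed.

Lemma component_segment A p x y : connected_component A p x ->
  (forall t : R, 0 <= t -> t <= 1 -> A (t *: y + (1 - t) *: x)) -> connected_component A p y.
Proof.
move=> Ux seg; apply: (connected_component_trans Ux).
pose F (t : R) : plane R := t *: y + (1 - t) *: x.
have cF : continuous F.
  move=> t; apply: cvgD; apply: cvgZr_tmp.
    exact: cvg_id.
  by apply: cvgB; [exact: cvg_cst|exact: cvg_id].
exists (F @` `[0, 1]%classic); last first.
  by exists 1; rewrite /= ?in_itv /= ?ler01 ?lexx // /F scale1r subrr scale0r addr0.
split.
- by exists 0; rewrite /= ?in_itv /= ?ler01 ?lexx // /F scale0r add0r subr0 scale1r.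
- by move=> _ [t /=] + <-; rewrite in_itv /= => /andP[t0 t1]; exact: seg.
- apply: connected_continuous_connected; first exact: segment_connected.
  exact: continuous_subspaceT.
Qed.

Lemma convex_setE U : convex_set U -> convexK U.
Proof.
move=> cU x y t Ux Uy t0 t1.
have := cU x y (Itv01 t0 t1); rewrite !inE => /(_ Ux Uy).
by [].
Qed.

(** A point of the closure that is not on [C] has a square free of [C], and the square joins it to
    [U]; so the boundary of the component lies on [C]. *)
Lemma component_body C p U : compact C -> (~` C) p -> U = connected_component (~` C) p ->
  bounded_set U -> convexK U -> body (closure U) U /\ closure U `\` U `<=` C.
Proof.
move=> cC Cp UE bU vU.
have oC : open (~` C) by apply: closed_openC; exact: compact_closed2.
have UC : U `<=` ~` C by rewrite UE; exact: connected_component_sub.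
have Up : U p by rewrite UE; exact: connected_component_refl.
have oU : open U.
  rewrite openE => x Ux; have [r r0 rC] := open_contains_square oC (UC _ Ux).
  apply: filterS (open_square_nbhs x r0) => y xy; rewrite UE in Ux *.
  apply: (component_segment Ux) => t t0 t1; apply: rC; apply: open_square_convex => //.
  exact: open_square_mem.
have vK : convexK (closure U).
  move=> x y t /closure_squareP hx /closure_squareP hy t0 t1; apply/closure_squareP => r r0.
  have [x' Ux [x1 x2]] := hx r r0; have [y' Uy [y1 y2]] := hy r r0.
  exists (t *: x' + (1 - t) *: y'); first exact: vU.
  have S0 : open_square 0 r (t *: (x' - x) + (1 - t) *: (y' - y)).
    by apply: open_square_convex => //; split; rewrite /= subr0.
  case: S0 => /= s1 s2; split => /=.
    have -> : t *: x'.1 + (1 - t) *: y'.1 - (t *: x.1 + (1 - t) *: y.1) =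
      t *: (x'.1 - x.1) + (1 - t) *: (y'.1 - y.1) - 0 by rewrite /GRing.scale /=; ring.
    by [].
  have -> : t *: x'.2 + (1 - t) *: y'.2 - (t *: x.2 + (1 - t) *: y.2) =
    t *: (x'.2 - x.2) + (1 - t) *: (y'.2 - y.2) - 0 by rewrite /GRing.scale /=; ring.
  by [].
have cK : compact (closure U).
  have [M M0 HM] : exists2 M : R, 0 < M & forall z, U z -> `|z.1| <= M /\ `|z.2| <= M.
    move: bU => /ex_strict_bound_gt0[M M0 H]; exists M => // z Kz.
    have := H z Kz; rewrite /= prod_normE gt_max => /andP[h1 h2].
    by split; exact: ltW.
  apply: (subclosed_compact _ (@compact_square R (M + 1))); first exact: closed_closure.
  move=> z /closure_squareP /(_ 1 ltr01)[w Uw [w1 w2]]; have [h1 h2] := HM w Uw.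
  have tr (a b : R) : `|b - a| < 1 -> `|b| <= M -> `|a| <= M + 1.
    move=> i1 i2; have -> : a = b - (b - a) by ring.
    by apply: le_trans (ler_normB _ _) _; clear -i1 i2; lra.
  by split; [exact: tr w1 h1|exact: tr w2 h2].
split.
  split => //; first exact: subset_closure.
  split; first by exists p.
  move=> k u t Kk Uu t0 t1; have [r r0 rU] := open_contains_square oU Uu.
  have t1' : 0 <= 1 - t by rewrite subr_ge0.
  have tr0 : 0 < t * r by rewrite mulr_gt0.
  have [w Uw [w1 w2]] := (closure_squareP U k).1 Kk (t * r) tr0.
  have tn : t != 0 by rewrite gt_eqF.
  have key (a b c : R) : `|b - c| < t * r -> `|a + (1 - t) / t * (c - b) - a| < r.
    move=> h; have -> : a + (1 - t) / t * (c - b) - a = - ((1 - t) / t * (b - c)) by ring.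
    rewrite normrN normrM ger0_norm ?divr_ge0 ?(ltW t0) // mulrAC ltr_pdivrMr //.
    rewrite [r * t]mulrC; apply: le_lt_trans h; rewrite ler_piMl //; clear -t0; lra.
  (* [k] is only a limit of points of [U]. Replacing it by a nearby [w] in [U] shifts [u] so little
     that it stays in [U]. *)
  have Uu' : U (u + ((1 - t) / t) *: (k - w)).
    by apply: rU; split => /=; exact: key.
  have -> : t *: u + (1 - t) *: k = t *: (u + ((1 - t) / t) *: (k - w)) + (1 - t) *: w.
    by apply: plane_eq; rewrite /= /GRing.scale /=; field.
  exact: (vU _ _ _ Uu' Uw (ltW t0) t1).
move=> k [Kk nUk]; apply: contrapT => nCk; apply: nUk.
have [r r0 rC] := open_contains_square oC nCk.
have [w Uw kw] := (closure_squareP U k).1 Kk r r0.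
rewrite UE in Uw *; apply: (component_segment Uw) => t t0 t1; apply: rC; apply: open_square_convex => //.
exact: open_square_mem.
Qed.

(** * The curve stays in the closure of the region *)

Definition cis (t : R) : plane R := (cos t, sin t).

Lemma cis_unit t : dot (cis t) (cis t) = 1.
Proof. by rewrite /dot /= -!expr2 cos2Dsin2. Qed.

Lemma enorm1 e : enorm e = 1 <-> dot e e = 1.
Proof.
rewrite /enorm; split => [h|->]; last exact: sqrtr1.
by rewrite -(sqr_sqrtr (dot_ge0 e)) h expr1n.
Qed.

Lemma unit_angle e : dot e e = 1 -> exists2 t : R, - pi <= t <= pi & e = cis t.
Proof.
move=> e1; have [b1 b2] := unit_bound e1.
have e12 : -1 <= e.1 <= 1 by rewrite -ler_norml.
have s2 : 1 - e.1 ^+ 2 = e.2 ^+ 2 by rewrite -e1 /dot; ring.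
have a0 := acos_ge0 e12; have api := acos_lepi e12; have p0 := pi_gt0 R.
have ac : cos (acos e.1) = e.1 by apply: acosK; rewrite in_itv.
have as' : sin (acos e.1) = `|e.2| by rewrite sin_acos // s2 sqrtr_sqr.
have [h|h] := leP 0 e.2.
  exists (acos e.1); first by apply/andP; split; clear -a0 api p0; lra.
  by apply: plane_eq; rewrite /= ?ac // as' ger0_norm.
exists (- acos e.1); first by apply/andP; split; clear -a0 api p0; lra.
by apply: plane_eq; rewrite /= ?cosN ?ac // sinN as' ltr0_norm ?opprK.
Qed.

Lemma cis_inj (a b : R) : `|a - b| < 2 * pi -> cis a = cis b -> a = b.
Proof.
move=> ab [c1 s1].
have c0 : cos (a - b) = 1 by rewrite cosB c1 s1 -!expr2 cos2Dsin2.
have sg (x : R) : 0 < x < 2 * pi -> cos x = 1 -> False.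
  move=> /andP[x0 x1] cx; have : 0 < sin (x / 2).
    by apply: sin_gt0_pi; apply/andP; split; clear -x0 x1; lra.
  have : cos ((x / 2) *+ 2) = 1 by rewrite -mulr_natr divfK // pnatr_eq0.
  rewrite cos_mulr2n => h; have : sin (x / 2) ^+ 2 = 0 by rewrite sin2cos2; clear -h; lra.
  by move=> /eqP; rewrite sqrf_eq0 => /eqP ->; rewrite ltxx.
move: ab; rewrite ltr_norml => /andP[h1 h2].
have [h|h|h] := ltgtP a b; last by [].
  exfalso; apply: (sg (b - a)); last by rewrite -cosN opprB.
  by apply/andP; split; clear -h h1; lra.
exfalso; apply: (sg (a - b)) => //.
by apply/andP; split; clear -h h2; lra.
Qed.

Lemma cis_circle (t : R) : unit_circle R (cis t).
Proof. exact: (enorm1 _).2 (cis_unit t). Qed.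

Lemma circle_cis x : unit_circle R x -> exists2 t : R, - pi <= t <= pi & x = cis t.
Proof. by move=> h; apply: unit_angle; exact: (enorm1 _).1 h. Qed.

Lemma cisD2pi (t : R) : cis (t + 2 * pi) = cis t.
Proof. by rewrite /cis mulr_natl cosD2pi sinD2pi. Qed.

Lemma continuous_cis : continuous cis.
Proof.
move=> t; have h1 := @continuous_cos R t; have h2 := @continuous_sin R t.
exact: (cvg_pair h1 h2).
Qed.

Lemma curve_angle (g : plane R -> plane R) : {within unit_circle R, continuous g} ->
  continuous (fun t : R => g (cis t)).
Proof.
move=> /subspace_continuousP cg t.
have ct := cis_circle t.
apply: cvg_comp (cg _ ct) => A /= hA.
have h : \forall u \near t, unit_circle R (cis u) -> A (cis u) := @continuous_cis t _ hA.
have : \forall u \near t, A (cis u) by apply: filterS h => u; apply; exact: cis_circle.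
by [].
Qed.

Lemma curve_compact (g : plane R -> plane R) : {within unit_circle R, continuous g} ->
  compact (curve_image g).
Proof.
move=> cg; have -> : curve_image g = (fun t : R => g (cis t)) @` `[- pi, pi]%classic.
  apply/seteqP; split => z.
    by move=> [x /circle_cis[t tp ->] <-]; exists t; rewrite //= in_itv.
  by move=> [t _ <-]; exists (cis t) => //; exact: cis_circle.
apply: continuous_compact; last exact: segment_compact.
by apply: continuous_subspaceT; exact: curve_angle.
Qed.

(* If the curve left [K], the directions from a point of [U] would give a
   continuous injection of the circle into an open arc: comparing the arc
   parameters hit by the directions [cis tau] and [- cis tau] splits [0, pi]
   into two disjoint closed sets exchanged between its end points. *)
Lemma curve_subset K U (g : plane R -> plane R) : body K U -> jordan_curve g ->
  K `\` U `<=` curve_image g -> (forall z, U z -> ~ curve_image g z) -> curve_image g `<=` K.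
Proof.
move=> [cK vK oU UK [[p Up] int]] [cg ig] KC UC c [x0 /circle_cis[t0 /andP[t01 t02] ->]] gc.
apply: contrapT => nKc.
(* Angles are counted from a point of the curve outside [K], so the parameters of points of [K] are
   strictly between 0 and [2 * pi] and injectivity applies to them. *)
pose G (t : R) : plane R := g (cis (t0 + t)).
have cG : continuous G.
  have ca : continuous (fun t : R => t0 + t) by move=> t; apply: cvgD; [exact: cvg_cst|exact: cvg_id].
  move=> t; have h := @curve_angle g cg (t0 + t).
  exact: (cvg_comp (fun t : R => t0 + t) (fun t : R => g (cis t)) (ca t) h).
have GC t : curve_image g (G t) by exists (cis (t0 + t)) => //; exact: cis_circle.
have p0 := pi_gt0 R.
pose B := [set t : R | 0 <= t <= 2 * pi /\ K (G t)].
have G0 : G 0 = c by rewrite /G addr0.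
have G2 : G (2 * pi) = c.
  by rewrite -gc /G cisD2pi.
have Bin t : B t -> 0 < t < 2 * pi.
  move=> [/andP[h1 h2] KG]; rewrite !lt_neqAle h1 h2 !andbT; apply/andP; split; apply/eqP => E.
    by apply: nKc; rewrite -G0 E.
  by apply: nKc; rewrite -G2 -E.
have cB : compact B.
  apply: (subclosed_compact _ (@segment_compact R 0 (2 * pi))); last by move=> t [h _]; rewrite /= in_itv.
  have -> : B = `[0, 2 * pi]%classic `&` G @^-1` K.
    by apply/seteqP; split => t; rewrite /B /= in_itv.
  apply: closedI; first exact: interval_closed.
  by apply: closed_comp => [t _|]; [exact: cG|exact: compact_closed2].
(* The ray from [p] along [e] meets the curve within [K] at parameter [t]. The end of the chord
   gives such a [t]; it is unique, since of two points on the ray the nearer one would be in [U]. *)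
pose hit (e : plane R) (t : R) := [/\ B t, cross e (G t - p) = 0 & 0 <= dot e (G t - p)].
have hit_ex e : dot e e = 1 -> exists t, hit e t.
  move=> e1; have cp : cross e (p - p) = 0 by rewrite subrr cross0.
  have [r1 [r2 ch]] := chord_ex cK e1 (UK _ Up) cp.
  have [_ K2 r12 H] := ch.
  have nU : ~ U (p + r2 *: e) by apply: (notin_open_end e1 oU UK ch); left; right.
  have r20 : 0 <= r2.
    by have := H _ (UK _ Up) cp; rewrite subrr dot0 => /andP[].
  have [x /circle_cis[a /andP[a1 a2] ->] xE] := KC _ (conj K2 nU).
  have [t [ta tb]] : exists t : R, 0 <= t <= 2 * pi /\ cis a = cis (t0 + t).
    have [h|h] := leP t0 a.
      exists (a - t0); split; last by congr cis; ring.
      by apply/andP; split; clear -h a2 t01; lra.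
    exists (a - t0 + 2 * pi); split; last by rewrite addrA cisD2pi; congr cis; ring.
    by apply/andP; split; clear -h a1 t02; lra.
  have GE : G t = p + r2 *: e by rewrite /G -tb xE.
  have GE2 : G t - p = r2 *: e by rewrite GE [p + _]addrC addrK.
  exists t; split; first by split => //; rewrite GE.
    by rewrite GE2 crossZr crossxx mulr0.
  by rewrite GE2 dotZr e1 mulr1.
have hit_eq e t t' : dot e e = 1 -> hit e t -> hit e t' -> t = t'.
  move=> e1.
  have E z : cross e (z - p) = 0 -> z = p + dot e (z - p) *: e.
    by move=> cz; apply: (unit_eq e1); move: cz; rewrite !vecE ?e1; clear; lra.
  have NU s : ~ U (G s) by move=> /UC; apply.
  have key (s s' : R) : B s' -> cross e (G s - p) = 0 -> cross e (G s' - p) = 0 ->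
      0 <= dot e (G s - p) -> dot e (G s - p) < dot e (G s' - p) -> False.
    move=> [_ Ks'] c1 c2 r0 rr; apply: (NU s).
    move: (E _ c1) (E _ c2) r0 rr; move: (dot e (G s - p)) (dot e (G s' - p)) => r r' -> E2 r0 rr.
    have r'0 : 0 < r' by clear -r0 rr; lra.
    have -> : p + r *: e = (1 - r / r') *: p + (1 - (1 - r / r')) *: G s'.
      by rewrite E2; apply: plane_eq; rewrite /= /GRing.scale /=; field; rewrite gt_eqF.
    apply: int => //; first by rewrite subr_gt0 ltr_pdivrMr // mul1r.
    by rewrite lerBlDr lerDl divr_ge0 // ltW.
  move=> [Bt c1 r1] [Bt' c2 r2].
  have [h|h|h] := ltgtP (dot e (G t - p)) (dot e (G t' - p)).
  - by exfalso; exact: (key t t').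
  - by exfalso; exact: (key t' t).
  have : G t = G t' by rewrite (E _ c1) (E _ c2) h.
  move=> /ig; rewrite !inE => /(_ (cis_circle _) (cis_circle _)) /cis_inj E3.
  apply: (@addrI _ t0); apply: E3.
  have /andP[i1 i2] := Bin _ Bt; have /andP[i3 i4] := Bin _ Bt'.
  by rewrite ltr_norml; apply/andP; split; clear -i1 i2 i3 i4; lra.
pose T := (R * (R * R))%type.
have f1 : continuous (fun x : T => x.1) by move=> x; exact: cvg_fst.
have f2 : continuous (fun x : T => x.2.1) by move=> x; apply: (cvg_comp _ _ (@cvg_snd _ _ _ _ _) cvg_fst).
have f3 : continuous (fun x : T => x.2.2) by move=> x; apply: (cvg_comp _ _ (@cvg_snd _ _ _ _ _) cvg_snd).
have ce : continuous (fun x : T => cis x.1) by move=> x; exact: (cvg_comp (fun x : T => x.1) cis (f1 x) (@continuous_cis x.1)).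
have ceN : continuous (fun x : T => - cis x.1) by move=> x; apply: cvgN; exact: ce.
have cG2 : continuous (fun x : T => G x.2.1 - p).
  by move=> x; apply: cvgB; [exact: (cvg_comp (fun x : T => x.2.1) G (f2 x) (cG x.2.1))|exact: cvg_cst].
have cG3 : continuous (fun x : T => G x.2.2 - p).
  by move=> x; apply: cvgB; [exact: (cvg_comp (fun x : T => x.2.2) G (f3 x) (cG x.2.2))|exact: cvg_cst].
have c0 : continuous (fun _ : T => 0 : R) by move=> x; exact: cvg_cst.
pose H := (`[0, pi]%classic `*` (B `*` B)) `&` [set x : T | hit (cis x.1) x.2.1 /\ hit (- cis x.1) x.2.2].
have cH : compact H.
  have -> : H = (`[0, pi]%classic `*` (B `*` B)) `&` ([set x : T | cross (cis x.1) (G x.2.1 - p) = 0]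
     `&` [set x : T | 0 <= dot (cis x.1) (G x.2.1 - p)] `&` [set x : T | cross (- cis x.1) (G x.2.2 - p) = 0]
     `&` [set x : T | 0 <= dot (- cis x.1) (G x.2.2 - p)]).
    apply/seteqP; split => x.
      by move=> [h [[? ? ?] [? ? ?]]]; do !split => //; case: h => _ [].
    by move=> [[h1 [h2 h3]] [[[? ?] ?] ?]].
  apply: compact_closedI.
    by apply: compact_setX; [exact: segment_compact|exact: compact_setX].
  do 3 ?[apply: closedI].
  - by apply: closed_eq2; exact: continuous_cross.
  - by apply: closed_le2 => //; exact: continuous_dot.
  - by apply: closed_eq2; exact: continuous_cross.
  - by apply: closed_le2 => //; exact: continuous_dot.
(* The angles whose direction is hit before the opposite one; [Pm] has those hit after it. Both are
   projections of compact sets, hence closed. *)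
pose Pp := (fun x : T => x.1) @` (H `&` [set x : T | x.2.1 <= x.2.2]).
pose Pm := (fun x : T => x.1) @` (H `&` [set x : T | x.2.2 <= x.2.1]).
have clp : closed Pp.
  apply: compact_closed; first exact: norm_hausdorff.
  apply: continuous_compact; first by apply: continuous_subspaceT; exact: f1.
  by apply: compact_closedI => //; exact: closed_le2.
have clm : closed Pm.
  apply: compact_closed; first exact: norm_hausdorff.
  apply: continuous_compact; first by apply: continuous_subspaceT; exact: f1.
  by apply: compact_closedI => //; exact: closed_le2.
have eN (t : R) : dot (- cis t) (- cis t) = 1 by rewrite dotNl dotNr opprK cis_unit.
have hN (t : R) s s' : hit (cis t) s -> hit (- cis t) s' -> s <> s'.
  move=> [_ c1 d1] [_ c2 d2] E; rewrite -E in c2 d2.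
  have : G s = p.
    by apply: (unit_eq (cis_unit t)); move: c1 d1 d2; rewrite !vecE; clear; lra.
  by move=> Gp; apply: (UC p Up); rewrite -Gp.
have disj t : Pp t -> Pm t -> False.
  move=> [[t1 [s s']] [[_ [/= h1 h2]] /= le1] /= E1] [[t2 [r r']] [[_ [/= h3 h4]] /= le2] /= E2].
  rewrite E1 in h1 h2; rewrite E2 in h3 h4.
  have sr := hit_eq _ _ _ (cis_unit t) h1 h3; have sr' := hit_eq _ _ _ (eN t) h2 h4.
  by apply: (hN _ _ _ h1 h2); apply/eqP; rewrite eq_le le1 sr sr' le2.
have cisNpi : cis pi = - cis 0.
  by apply: plane_eq; rewrite /= ?cospi ?sinpi ?cos0 ?sin0 ?oppr0.
have [a [ha hNa]] : exists a, [/\ hit (cis 0) a & exists b, hit (- cis 0) b].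
  have [a ha] := hit_ex _ (cis_unit 0); have [b hb] := hit_ex _ (eN 0).
  by exists a; split => //; exists b.
have [b hb] := hNa.
have I0 : `[0, pi]%classic (0 : R) by rewrite /= in_itv /= lexx ltW.
have I1 : `[0, pi]%classic (pi : R) by rewrite /= in_itv /= lexx andbT ltW.
have memp t s s' : `[0, pi]%classic t -> hit (cis t) s -> hit (- cis t) s' -> s <= s' -> Pp t.
  by move=> It h1 h2 le; exists (t, (s, s')) => //; split => //; split => //; split => //; split; [case: h1|case: h2].
have memm t s s' : `[0, pi]%classic t -> hit (cis t) s -> hit (- cis t) s' -> s' <= s -> Pm t.
  by move=> It h1 h2 le; exists (t, (s, s')) => //; split => //; split => //; split => //; split; [case: h1|case: h2].
have hpi1 : hit (cis pi) b by rewrite cisNpi.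
have hpi2 : hit (- cis pi) a by rewrite cisNpi opprK.
have cover t : `[0, pi]%classic t -> ~ Pm t -> Pp t.
  move=> It nP; have [s hs] := hit_ex _ (cis_unit t); have [s' hs'] := hit_ex _ (eN t).
  have [le|lt] := leP s s'; first exact: memp hs hs' le.
  by exfalso; apply: nP; exact: memm hs hs' (ltW lt).
have Psub t : Pp t -> `[0, pi]%classic t by move=> [x [[[h _] _] _] <-].
have PE : Pp = `[0, pi]%classic.
  apply: (@segment_connected R 0 pi).
  - have [le|lt] := leP a b; first by exists 0; exact: memp ha hb le.
    by exists pi; exact: memp hpi1 hpi2 (ltW lt).
  - exists (~` Pm); first exact: closed_openC.
    apply/seteqP; split => t; first by move=> Pt; split; [exact: Psub|move=> Pt'; exact: disj Pt Pt'].
    by move=> [It nP]; exact: cover.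
  - exists Pp => //; apply/seteqP; split => t; first by move=> Pt; split => //; exact: Psub.
    by case.
(* [Pp] is the whole interval, but 0 and [pi] give opposite directions, so at one of the two ends
   the order is reversed. *)
have [le|lt] := leP a b.
  by apply: (disj pi); [rewrite PE|exact: memm hpi1 hpi2 le].
by apply: (disj 0); [rewrite PE|exact: memm ha hb (ltW lt)].
Qed.

End Topology.

(** * Inscribed quadrilaterals *)

Section Inscribed.
Variable R : realType.
Implicit Types (e f k u v w x y z p X Y A B : plane R) (C K U : set (plane R)).

Lemma quarter_dot u v : dot (quarter u) v = cross u v.
Proof. by rewrite /dot /cross /quarter /=; ring. Qed.

Lemma quarter_cross u v : cross (quarter u) v = - dot u v.
Proof. by rewrite /dot /cross /quarter /=; ring. Qed.

Lemma frame_similarity X Y e0 e (r : R) : dot e0 e0 = 1 -> dot e e = 1 -> 0 < r ->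
  exists2 T : plane R -> plane R, similarity T & forall a b : R,
    T (X + a *: e0 + b *: quarter e0) = Y + (r * a) *: e + (r * b) *: quarter e.
Proof.
move=> e01 e1 r0.
(* The cosine and sine of the rotation that takes [e0] to [e]. *)
have w1 : dot ((dot e0 e, cross e0 e) : plane R) (dot e0 e, cross e0 e) = 1.
  by rewrite -[RHS]mul1r -{1}e01 -e1 /dot /cross /=; ring.
have [t _ [tc ts]] := unit_angle w1.
exists ((fun z => z + Y) \o ((fun z => r *: z) \o (rotate t \o (fun z => z - X)))).
  apply: similarity_comp; first exact: similarity_translation.
  apply: similarity_comp; first exact: similarity_scaling.
  apply: similarity_comp; first exact: similarity_rotation.
  exact: similarity_translation.
move=> a b /=.
have re : rotate t e0 = e.
  by apply: plane_eq; rewrite /rotate /= -tc -ts -[RHS]mul1r -e01 /dot /cross; ring.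
have -> : rotate t (X + a *: e0 + b *: quarter e0 - X) = a *: rotate t e0 + b *: quarter (rotate t e0).
  by apply: plane_eq; rewrite /rotate /quarter /= /GRing.scale /=; ring.
by rewrite re; apply: plane_eq; rewrite /= /GRing.scale /=; ring.
Qed.

Lemma enorm_sqr u : enorm u ^+ 2 = dot u u.
Proof. by rewrite /enorm sqr_sqrtr // dot_ge0. Qed.

Lemma enorm_gt0 u : u != 0 -> 0 < enorm u.
Proof.
move=> u0; rewrite sqrtr_gt0 lt_neqAle dot_ge0 andbT eq_sym.
by apply: contraNN u0 => /eqP /dot_eq0 ->.
Qed.

Lemma lagrange u v : dot u v ^+ 2 + cross u v ^+ 2 = (enorm u * enorm v) ^+ 2.
Proof. by rewrite exprMn !enorm_sqr /dot /cross; ring. Qed.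

Lemma vangle_cos u v : u != 0 -> v != 0 ->
  -1 <= dot u v / (enorm u * enorm v) <= 1.
Proof.
move=> /enorm_gt0 u0 /enorm_gt0 v0; have uv : 0 < enorm u * enorm v by rewrite mulr_gt0.
have h : `|dot u v| <= enorm u * enorm v.
  rewrite -ler_sqr ?nnegrE ?(ltW uv) // real_normK ?num_real // -lagrange lerDl.
  exact: sqr_ge0.
by rewrite -ler_norml normrM normfV (gtr0_norm uv) ler_pdivrMr // mul1r.
Qed.

(** A supremum above [vangle u v] means that some pair of points of the curve, hence of [K], is seen
    under a larger angle; the cosine reverses the inequality. *)
Lemma wide_of_angle K U C u v : K `\` U `<=` C -> C `<=` K -> u != 0 -> v != 0 ->
  (forall P, C P -> vangle u v < inner_angle C P) -> wide K U (dot u v / (enorm u * enorm v)).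
Proof.
move=> KC CK u0 v0 ang P /KC CP; have := ang P CP; rewrite /inner_angle.
set S := [set t | _] => lt.
have c1 := vangle_cos u0 v0.
have [t St tl] : exists2 t, S t & vangle u v < t.
  apply: contrapT => no; move: lt; apply/negP; rewrite -leNgt.
  (* The supremum of the empty set is 0 by convention, which does not exceed [vangle u v]. *)
  have [->|/set0P S0] := eqVneq S set0; first by rewrite sup0 acos_ge0.
  by apply: ge_sup => // t St; rewrite leNgt; apply/negP => h; apply: no; exists t.
move: St => [A [B [[CA AP] [CB BP] tE]]]; exists A, B; split; [exact: CK|exact: CK|].
have A0 : A - P != 0 by rewrite subr_eq0; apply/eqP.
have B0 : B - P != 0 by rewrite subr_eq0; apply/eqP.
have c2 := vangle_cos A0 B0.
have nn : 0 < enorm (A - P) * enorm (B - P) by rewrite mulr_gt0 // enorm_gt0.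
rewrite -ltr_pdivrMr //.
move: tl; rewrite tE /vangle => tl.
have ck (x : R) : -1 <= x <= 1 -> cos (acos x) = x by move=> x1; apply: acosK; rewrite in_itv.
by rewrite -(ck _ c1) -(ck _ c2) ltr_cos // in_itv /= acos_ge0 ?acos_lepi.
Qed.

(** By the choice of weights the distances on the two sides are [r] times [a], [b] and [r'] times
    [a'], [b']. The equal products and [a * b = a' * b'] give [r = r'], so one similarity carries
    all four points. *)
Lemma wedge_inscribed K U X e0 f0 (a b a' b' c s : R) : body K U ->
  dot e0 e0 = 1 -> f0 = c *: e0 + s *: quarter e0 -> c ^+ 2 + s ^+ 2 = 1 -> 0 < s ->
  0 < a -> a < b -> 0 < a' -> a' < b' -> a * b = a' * b' -> wide K U c ->
  exists2 T : plane R -> plane R, similarity T &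
    [/\ (K `\` U) (T (X + a *: e0)), (K `\` U) (T (X + b *: e0)),
        (K `\` U) (T (X + b' *: f0)) & (K `\` U) (T (X + a' *: f0))].
Proof.
move=> bK e01 f0E cs1 s0 a0 ab a0' ab' pw wd.
have ba : 0 < b - a by rewrite subr_gt0.
have ba' : 0 < b' - a' by rewrite subr_gt0.
have al0 : 0 < a / (b - a) by rewrite divr_gt0.
have be0 : 0 < a' / (b' - a') by rewrite divr_gt0.
have [Y [e [f [[e1 f1 ec es]]]]] := wedge_points bK cs1 s0 al0 be0 wd.
move=> [x1 [x2 [x3 [x4 [[x10 x40 E1 E2] [E3 k1 k2 k3 k4]]]]]].
have [r rE] : exists r : R, r = x1 / a by eexists.
have [r' rE'] : exists r' : R, r' = x4 / a' by eexists.
have r0 : 0 < r by rewrite rE divr_gt0.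
have r0' : 0 < r' by rewrite rE' divr_gt0.
have x1E : x1 = r * a by rewrite rE divfK // gt_eqF.
have x4E : x4 = r' * a' by rewrite rE' divfK // gt_eqF.
have x2E : x2 = r * b.
  have : (b - a) * (x2 - x1) = (b - a) * (r * (b - a)).
    apply: (mulfI (_ : a != 0)); first by rewrite gt_eqF.
    transitivity ((a / (b - a) * (x2 - x1)) * (b - a) ^+ 2); first by field; rewrite gt_eqF.
    by rewrite E1 x1E; ring.
  by move=> /mulfI h; have := h (lt0r_neq0 ba); rewrite x1E; clear; lra.
have x3E : x3 = r' * b'.
  have : (b' - a') * (x3 - x4) = (b' - a') * (r' * (b' - a')).
    apply: (mulfI (_ : a' != 0)); first by rewrite gt_eqF.
    transitivity ((a' / (b' - a') * (x3 - x4)) * (b' - a') ^+ 2); first by field; rewrite gt_eqF.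
    by rewrite E2 x4E; ring.
  by move=> /mulfI h; have := h (lt0r_neq0 ba'); rewrite x4E; clear; lra.
have rr : r = r'.
  have b0 : 0 < b by apply: lt_trans ab.
  have : r ^+ 2 = r' ^+ 2.
    apply: (mulIf (_ : a * b != 0)); first by rewrite gt_eqF // mulr_gt0.
    by rewrite {2}pw; move: E3; rewrite x1E x2E x3E x4E; clear; lra.
  by move=> /eqP; rewrite eqrXn2 // ?ltW // => /eqP.
rewrite -rr in x3E x4E.
have [T sT HT] := frame_similarity X Y e01 e1 r0.
have fE : f = c *: e + s *: quarter e.
  have qd : dot e (quarter e) = 0 by rewrite dotC quarter_dot crossxx.
  have qc : cross e (quarter e) = 1 by rewrite crossC quarter_cross opprK.
  by apply: (unit_eq e1); rewrite !vecE ?qd ?qc ?e1 ?ec ?es; ring.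
have Te t : T (X + t *: e0) = Y + (r * t) *: e.
  by have := HT t 0; rewrite mulr0 !scale0r !addr0.
have Tf t : T (X + t *: f0) = Y + (r * t) *: f.
  have -> : X + t *: f0 = X + (t * c) *: e0 + (t * s) *: quarter e0.
    by rewrite f0E scalerDr !scalerA addrA.
  by rewrite HT fE scalerDr !scalerA addrA !mulrA.
by exists T => //; rewrite !Te !Tf -x1E -x2E -x3E -x4E.
Qed.

(** The chord [u] is orthogonal to the segment from the centre to its midpoint. *)
Lemma circle_chord o p u (r : R) : enorm (p - o) = r -> enorm (p + u - o) = r ->
  2 * dot u (p - o) + dot u u = 0.
Proof.
move=> h1 h2; have : dot (p + u - o) (p + u - o) = dot (p - o) (p - o).
  by rewrite -!enorm_sqr h1 h2.
by rewrite /dot /=; clear; lra.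
Qed.

(** The sign condition says that the lines P1P2 and P4P3 are parallel or meet at a point to which
    [P1] and [P4] are the nearer vertices. The circle makes the parallel case an isosceles trapezoid
    and otherwise equates the two products of distances. *)
Lemma inscribed_ordered K U C P1 P2 P3 P4 : body K U -> K `\` U `<=` C -> C `<=` K ->
  has_circumcircle P1 P2 P3 P4 -> convex_positive P1 P2 P3 P4 ->
  0 <= cross (P2 - P1) (P3 - P4) ->
  (forall P, C P -> vangle (P2 - P1) (P3 - P4) < inner_angle C P) ->
  exists2 T : plane R -> plane R, similarity T & [/\ C (T P1), C (T P2), C (T P3) & C (T P4)].
Proof.
move=> bK KC CK [ctr [rad [_ [d1 d2 d3 d4]]]] [/andP[_ l124] _ /andP[l341 _] _] uv ang.
have [u uE] : exists u, u = P2 - P1 by eexists.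
have [v vE] : exists v, v = P3 - P4 by eexists.
have P2E : P2 = P1 + u by rewrite uE addrC subrK.
have P3E : P3 = P4 + v by rewrite vE addrC subrK.
rewrite -uE -vE in uv ang.
have uw : 0 < cross u (P4 - P1) by move: l124; rewrite /left_of uE.
have wv : 0 < cross v (P4 - P1).
  by move: l341; rewrite /left_of P3E !vecE /cross /=; clear; lra.
have nz x : 0 < cross x (P4 - P1) -> x != 0.
  by move=> h; apply: contraTneq h => ->; rewrite /cross /= !mul0r subrr ltxx.
have u0 := nz _ uw; have v0 := nz _ wv.
have nu := enorm_gt0 u0; have nv := enorm_gt0 v0.
have [e eE] : exists e, e = (enorm u)^-1 *: u by eexists.
have uue : u = enorm u *: e by rewrite eE scalerA divff ?gt_eqF // scale1r.
have e1 : dot e e = 1.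
  by rewrite eE dotZl dotZr -enorm_sqr; field; rewrite gt_eqF.
rewrite P2E in d2; rewrite P3E in d3.
have cu := circle_chord d1 d2; have cv := circle_chord d4 d3.
suff [T sT [T1 T2 T3 T4]] : exists2 T : plane R -> plane R, similarity T &
    [/\ (K `\` U) (T P1), (K `\` U) (T P2), (K `\` U) (T P3) & (K `\` U) (T P4)].
  by exists T => //; split; exact: KC.
have [uv0|uv0] := eqVneq (cross u v) 0.
  have [be beE] : exists be : R, v = be *: u.
    exists (dot u v / dot u u); rewrite -enorm_sqr.
    apply: (unit_eq e1); rewrite eE !vecE ?uv0; last by ring.
    by rewrite -enorm_sqr; field; rewrite gt_eqF.
  have be0 : 0 < be by rewrite -(pmulr_lgt0 _ uw) -crossZl -beE.
  have [h hE] : exists h : R, h = cross e (P4 - P1) by eexists.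
  have h0 : 0 < h by rewrite hE eE crossZl mulr_gt0 // invr_gt0.
  have b0 : 0 < be * enorm u by rewrite mulr_gt0.
  have [Y [e' [s [e1' s0 [k1 k2 k4 k3]]]]] := trapezoid_points bK nu b0 h0.
  have [T sT HT] := frame_similarity (P1 + (1 / 2) *: u) Y e1 e1' s0.
  (* Both bases have the same perpendicular bisector, which passes through the centre. *)
  have de : dot e (P4 - P1) = (1 - be) / 2 * enorm u.
    have E : enorm u * dot e (P4 - P1) = enorm u * ((1 - be) / 2 * enorm u).
      rewrite -dotZl -uue.
      have : be * (2 * dot u (P4 - ctr) + be * dot u u) = be * 0.
        by rewrite mulr0 -[RHS]cv beE !vecE; ring.
      move=> /(mulfI (lt0r_neq0 be0)) cv'.
      have -> : dot u (P4 - P1) = dot u (P4 - ctr) - dot u (P1 - ctr) by rewrite !vecE; ring.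
      have -> : enorm u * ((1 - be) / 2 * enorm u) = (1 - be) / 2 * dot u u.
        by rewrite -enorm_sqr; ring.
      by clear -cu cv'; lra.
    by apply: (mulfI (lt0r_neq0 nu)).
  have P4E : P4 = P1 + ((1 - be) / 2 * enorm u) *: e + h *: quarter e.
    have qd : dot e (quarter e) = 0 by rewrite dotC quarter_dot crossxx.
    have qc : cross e (quarter e) = 1 by rewrite crossC quarter_cross opprK.
    apply: (unit_eq e1); move: de hE; rewrite !vecE ?qd ?qc ?e1; clear; lra.
  have [n nE] : exists n : R, n = enorm u by eexists.
  have un : u = n *: e by rewrite nE -uue.
  exists T => //; split.
  - have -> : P1 = P1 + (1 / 2) *: u + (- (enorm u / 2)) *: e + 0 *: quarter e.
      by rewrite -nE un; apply: plane_eq; rewrite /= /GRing.scale /=; ring.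
    rewrite HT; suff -> : Y + (s * - (enorm u / 2)) *: e' + (s * 0) *: quarter e' =
      Y - (s * enorm u / 2) *: e' by [].
    by apply: plane_eq; rewrite /= /GRing.scale /=; ring.
  - have -> : P2 = P1 + (1 / 2) *: u + (enorm u / 2) *: e + 0 *: quarter e.
      by rewrite P2E -nE un; apply: plane_eq; rewrite /= /GRing.scale /=; field.
    rewrite HT; suff -> : Y + (s * (enorm u / 2)) *: e' + (s * 0) *: quarter e' =
      Y + (s * enorm u / 2) *: e' by [].
    by apply: plane_eq; rewrite /= /GRing.scale /=; ring.
  - have -> : P3 = P1 + (1 / 2) *: u + (be * enorm u / 2) *: e + h *: quarter e.
      by rewrite P3E P4E beE -nE un; apply: plane_eq; rewrite /= /GRing.scale /=; field.
    rewrite HT; suff -> : Y + (s * (be * enorm u / 2)) *: e' + (s * h) *: quarter e' =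
      Y + (s * h) *: quarter e' + (s * (be * enorm u) / 2) *: e' by [].
    by apply: plane_eq; rewrite /= /GRing.scale /=; ring.
  - have -> : P4 = P1 + (1 / 2) *: u + (- (be * enorm u / 2)) *: e + h *: quarter e.
      by rewrite P4E -nE un; apply: plane_eq; rewrite /= /GRing.scale /=; field.
    rewrite HT; suff -> : Y + (s * - (be * enorm u / 2)) *: e' + (s * h) *: quarter e' =
      Y + (s * h) *: quarter e' - (s * (be * enorm u) / 2) *: e' by [].
    by apply: plane_eq; rewrite /= /GRing.scale /=; ring.
have D0 : 0 < cross u v by rewrite lt_neqAle eq_sym uv0.
have wd := wide_of_angle KC CK u0 v0 ang.
have [c cE] : exists c : R, c = dot u v / (enorm u * enorm v) by eexists.
have [s sE] : exists s : R, s = cross u v / (enorm u * enorm v) by eexists.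
have nn : 0 < enorm u * enorm v by rewrite mulr_gt0.
have s0 : 0 < s by rewrite sE divr_gt0.
have cs1 : c ^+ 2 + s ^+ 2 = 1.
  by rewrite cE sE !expr_div_n -mulrDl lagrange divff // expf_neq0 // gt_eqF.
have [f fE] : exists f, f = (enorm v)^-1 *: v by eexists.
have vvf : v = enorm v *: f by rewrite fE scalerA divff ?gt_eqF // scale1r.
have fcs : f = c *: e + s *: quarter e.
  have qd : dot e (quarter e) = 0 by rewrite dotC quarter_dot crossxx.
  have qc : cross e (quarter e) = 1 by rewrite crossC quarter_cross opprK.
  apply: (unit_eq e1).
    by rewrite dotDr !dotZr qd e1 fE eE cE dotZl dotZr; field; rewrite !gt_eqF.
  by rewrite crossDr !crossZr qc crossxx fE eE sE crossZl crossZr; field; rewrite !gt_eqF.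
(* [X] is where the lines P1P2 and P4P3 meet. *)
have [a aE] : exists a : R, a = cross v (P4 - P1) / cross u v by eexists.
have [a' aE'] : exists a' : R, a' = cross u (P4 - P1) / cross u v by eexists.
have a0 : 0 < a by rewrite aE divr_gt0.
have a0' : 0 < a' by rewrite aE' divr_gt0.
have [X XE] : exists X, X = P1 - a *: u by eexists.
have P1X : P1 = X + (a * enorm u) *: e.
  by rewrite -scalerA -uue XE subrK.
have P2X : P2 = X + ((a + 1) * enorm u) *: e.
  by rewrite -scalerA -uue XE P2E scalerDl scale1r addrA subrK.
have P4X' : P4 = X + a' *: v.
  have -> : P4 = P1 + (P4 - P1) by rewrite addrC subrK.
  rewrite XE aE aE'; move: (P4 - P1) => w.
  by apply: plane_eq; rewrite /cross /= /GRing.scale /=; field; move: D0; rewrite /cross => /lt0r_neq0.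
have P4X : P4 = X + (a' * enorm v) *: f by rewrite -scalerA -vvf.
have P3X : P3 = X + ((a' + 1) * enorm v) *: f.
  by rewrite -scalerA -vvf P3E P4X' scalerDl scale1r addrA.
(* The power of [X] with respect to the circle, computed along each of the two lines. *)
have pw : (a * enorm u) * ((a + 1) * enorm u) = (a' * enorm v) * ((a' + 1) * enorm v).
  have P1X' : P1 = X + a *: u by rewrite XE subrK.
  have oE : dot (P1 - ctr) (P1 - ctr) = dot (P4 - ctr) (P4 - ctr) by rewrite -!enorm_sqr d1 d4.
  have -> : (a * enorm u) * ((a + 1) * enorm u) = a * (a + 1) * enorm u ^+ 2 by ring.
  have -> : (a' * enorm v) * ((a' + 1) * enorm v) = a' * (a' + 1) * enorm v ^+ 2 by ring.
  rewrite !enorm_sqr; rewrite P1X' P4X' in oE; rewrite P1X' in cu; rewrite P4X' in cv.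
  have key w x (b : R) : 2 * dot x (w + b *: x) + dot x x = 0 ->
      dot (w + b *: x) (w + b *: x) = dot w w - b * (b + 1) * dot x x.
    move=> h; have : b * (2 * dot x (w + b *: x) + dot x x) = 0 by rewrite h mulr0.
    by rewrite !vecE [dot x w]dotC; clear; lra.
  have rw x (b : R) : X + b *: x - ctr = X - ctr + b *: x by rewrite addrAC.
  rewrite !rw in oE cu cv; rewrite (key _ _ _ cu) (key _ _ _ cv) in oE.
  by clear -oE; lra.
have [T sT [T1 T2 T3 T4]] : exists2 T : plane R -> plane R, similarity T &
    [/\ (K `\` U) (T (X + (a * enorm u) *: e)), (K `\` U) (T (X + ((a + 1) * enorm u) *: e)),
        (K `\` U) (T (X + ((a' + 1) * enorm v) *: f)) & (K `\` U) (T (X + (a' * enorm v) *: f))].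
  apply: (wedge_inscribed X bK e1 fcs cs1 s0) => //; rewrite ?mulr_gt0 ?ltr_pM2r //.
  - by clear; lra.
  - by clear; lra.
  - by rewrite cE.
by exists T => //; rewrite P1X P2X P3X P4X.
Qed.

Lemma norm_signed_angle u v : u != 0 -> v != 0 -> `|signed_angle u v| = vangle u v.
Proof.
move=> u0 v0; have a0 : 0 <= vangle u v by apply: acos_ge0; exact: vangle_cos.
by rewrite /signed_angle; case: ifP => _; rewrite ?normrN ger0_norm.
Qed.

Lemma vangle_swapN u v : vangle (- v) (- u) = vangle u v.
Proof.
have h x : enorm (- x) = enorm x by rewrite /enorm dotNl dotNr opprK.
by rewrite /vangle !h dotNl dotNr opprK dotC [enorm v * _]mulrC.
Qed.

(** [K] is the closure of the region. Both inclusions matter: boundary points of [K] are points of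
    the curve, and the points that realise inner angles belong to [K]. *)
Lemma jordan_body (g : plane R -> plane R) : jordan_curve g -> convex_curve g ->
  exists K U, [/\ body K U, K `\` U `<=` curve_image g & curve_image g `<=` K].
Proof.
move=> hg [U [bU [p Cp UE]] /convex_setE vU].
have [bK KC] := component_body (curve_compact hg.1) Cp UE bU vU.
exists (closure U), U; split => //; apply: (curve_subset bK hg KC) => z.
by rewrite UE => /connected_component_sub.
Qed.

End Inscribed.

Theorem theorem1p6 (R : realType) (P1 P2 P3 P4 : plane R)
    (hcirc : has_circumcircle P1 P2 P3 P4)
    (hconv : convex_positive P1 P2 P3 P4)
    (g : plane R -> plane R)
    (hg : jordan_curve g) (hgconv : convex_curve g) :
  let lambda := signed_angle (P2 - P1) (P3 - P4) in
  let mu := signed_angle (P1 - P4) (P2 - P3) in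
  (forall P : plane R, curve_image g P ->
     Num.min `|lambda| `|mu| < inner_angle (curve_image g) P) ->
  inscribes g P1 P2 P3 P4.
Proof.
move=> lambda mu ang.
have [K [U [bK KC CK]]] := jordan_body hg hgconv.
have ne (A B X : plane R) : left_of A B X -> B - A != 0.
  by apply: contraTneq => BA; rewrite /left_of BA /cross /= !mul0r subrr ltxx.
have oN (A B : plane R) : A - B = - (B - A) by rewrite opprB.
case: (hconv) => /andP[l1 l1'] /andP[l2 l2'] /andP[l3 l3'] /andP[l4 l4'].
have n12 := ne _ _ _ l1; have n23 := ne _ _ _ l2; have n34 := ne _ _ _ l3; have n41 := ne _ _ _ l4.
have n43 : P3 - P4 != 0 by rewrite oN oppr_eq0.
have n32 : P2 - P3 != 0 by rewrite oN oppr_eq0.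
(* Relabelling by one place exchanges the two pairs of opposite edges, by two places it reverses the
   sign of the angle; so the smaller angle may be taken for the first pair, and nonnegative. *)
have c2 : convex_positive P2 P3 P4 P1 by split; apply/andP.
have c3 : convex_positive P3 P4 P1 P2 by split; apply/andP.
have c4 : convex_positive P4 P1 P2 P3 by split; apply/andP.
case: (hcirc) => ctr [r [r0 [d1 d2 d3 d4]]].
have h2 : has_circumcircle P2 P3 P4 P1 by exists ctr, r.
have h3 : has_circumcircle P3 P4 P1 P2 by exists ctr, r.
have h4 : has_circumcircle P4 P1 P2 P3 by exists ctr, r.
have [le|lt] := leP `|lambda| `|mu|.
  have {}ang P : curve_image g P -> vangle (P2 - P1) (P3 - P4) < inner_angle (curve_image g) P.
    by move=> /ang; rewrite min_l // norm_signed_angle.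
  have [uv|uv] := leP 0 (cross (P2 - P1) (P3 - P4)).
    exact: inscribed_ordered bK KC CK hcirc hconv uv ang.
  have [||T sT [T3 T4 T1 T2]] := inscribed_ordered bK KC CK h3 c3.
  - by rewrite (oN P4) (oN P1) crossNl crossNr opprK crossC oppr_ge0 ltW.
  - by move=> P CP; rewrite (oN P4) (oN P1) vangle_swapN; exact: ang.
  by exists T.
have {}ang P : curve_image g P -> vangle (P1 - P4) (P2 - P3) < inner_angle (curve_image g) P.
  by move=> /ang; rewrite min_r ?ltW // norm_signed_angle.
have [uv|uv] := leP 0 (cross (P1 - P4) (P2 - P3)).
  have [||T sT [T4 T1 T2 T3]] := inscribed_ordered bK KC CK h4 c4; [exact: uv|exact: ang|].
  by exists T.
have [||T sT [T2 T3 T4 T1]] := inscribed_ordered bK KC CK h2 c2.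
- by rewrite (oN P3) (oN P4) crossNl crossNr opprK crossC oppr_ge0 ltW.
- by move=> P CP; rewrite (oN P3) (oN P4) vangle_swapN; exact: ang.
by exists T.
Qed.
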